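(* Let $s\in(0,1)$, $p\in(1,\infty)$, let $\Omega\subset\mathbb{R}^N$ be a smooth bounded open set, and let $f\in W^{-s,p'}(\Omega)$. If $\lambda_1(s,p)<\lambda<\lambda_2(s,p)$, then there is a weak solution of $$\begin{cases}(-\Delta_p)^s u=\lambda|u|^{p-2}u+f(x)&\text{in }\Omega,\\ u=0&\text{in }\Omega^c:=\mathbb{R}^N\setminus\Omega.\end{cases}$$
   Context: Constant: $\mathcal{K}=p(1-s)\left(\int_{S^{N-1}}|\langle\omega,e\rangle|^p\,d\mathcal{H}^{N-1}(\omega)\right)^{-1}$ for any $e\in S^{N-1}$. The fractional $p$-Laplacian is $(-\Delta_p)^su(x)=2\mathcal{K}\,\mathrm{P.V.}\int_{\mathbb{R}^N}\frac{|u(x)-u(y)|^{p-2}(u(x)-u(y))}{|x-y|^{N+sp}}dy$. Spaces: for an open set $A$, $W^{s,p}(A)$ is the set of $u\in L^p(A)$ with $|u|_{W^{s,p}(A)}^p:=\int_{A^2}\frac{|u(x)-u(y)|^p}{|x-y|^{N+sp}}dxdy<\infty$. $\widetilde{W}^{s,p}(\Omega)$ is the space of $u\in W^{s,p}(\Omega)$ whose extension by zero belongs to $W^{s,p}(\mathbb{R}^N)$ (functions are identified with their zero extension), normed by $|\cdot|_{W^{s,p}(\mathbb{R}^N)}$. $W^{-s,p'}(\Omega)$ is its dual, with pairing $\langle\cdot,\cdot\rangle$. $\widehat{W}^{s,p}(\Omega)$ is the set of $u\in L^p_{loc}(\mathbb{R}^N)$ such that $u\in W^{s,p}(U)$ for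 some open $U\supset\supset\Omega$ and $\int_{\mathbb{R}^N}\frac{|u(x)|^{p-1}}{(1+|x|)^{N+sp}}dx<\infty$. Weak solutions: $u\in\widehat{W}^{s,p}(\Omega)$ is a weak solution if $u=0$ a.e. in $\Omega^c$ and, for every $v\in\widetilde{W}^{s,p}(\Omega)$, $$\mathcal{K}\int_{\mathbb{R}^{2N}}\frac{|u(x)-u(y)|^{p-2}(u(x)-u(y))(v(x)-v(y))}{|x-y|^{N+sp}}dxdy=\lambda\int_\Omega|u|^{p-2}uv\,dx+\langle f,v\rangle.$$ Eigenvalues: $\lambda$ is an eigenvalue of $(-\Delta_p)^s$ if there is $u\in\widetilde{W}^{s,p}(\Omega)\setminus\{0\}$ such that, for all $v\in\widetilde{W}^{s,p}(\Omega)$, $$\mathcal{K}\int_{\mathbb{R}^{2N}}\frac{|u(x)-u(y)|^{p-2}(u(x)-u(y))(v(x)-v(y))}{|x-y|^{N+sp}}dxdy=\lambda\int_\Omega|u|^{p-2}uv\,dx.$$ The first eigenvalue is $\lambda_1(s,p)=\inf\{\mathcal{K}|u|_{W^{s,p}(\mathbb{R}^N)}^p: u\in\widetilde{W}^{s,p}(\Omega),\ \|u\|_{L^p(\Omega)}=1\}$, and the second eigenvalue is $\lambda_2(s,p)=\inf\{\lambda:\lambda>\lambda_1(s,p)\text{ is an eigenvalue of }(-\Delta_p)^s\}$. *)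

(* Defs.v *)
From HB Require Import structures.
From mathcomp Require Import all_boot all_order all_algebra.
From mathcomp Require Import all_classical all_reals all_analysis.
Set Implicit Arguments.
Unset Strict Implicit.
Unset Printing Implicit Defensive.
Import Order.TTheory GRing.Theory Num.Theory.
Import numFieldNormedType.Exports.

Local Open Scope classical_set_scope.
Local Open Scope ring_scope.

(* Points of R^N are row vectors 'rV[R]_N. The norm `|x| provided by the     *)
(* library on 'rV[R]_N is the sup norm: it is only used through the topology *)
(* (and boundedness) it induces. All the formulas use the Euclidean [enorm]. *)

Section euclidean.
Context {R : realType} {N : nat}.

Definition dotv (x y : 'rV[R]_N) : R := \sum_(i < N) x 0 i * y 0 i.

Definition enorm (x : 'rV[R]_N) : R := Num.sqrt (dotv x x).

Definition sphere : set 'rV[R]_N := [set x | enorm x = 1].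

End euclidean.

(* Matrices carry the product sigma-algebra, generated by the coordinates;   *)
(* on 'rV[R]_N it is the Borel sigma-algebra.                                *)

Definition measure_matrix_display : measure_display. Proof. exact. Qed.

Section measurable_matrix.
Context (R : realType) (m n : nat).

Definition coord_preimages : set (set 'M[R]_(m, n)) :=
  [set A | exists (i : 'I_m) (j : 'I_n) (B : set R),
    measurable B /\ A = [set M : 'M[R]_(m, n) | B (M i j)]].

Let matrix_set0 : <<s coord_preimages >> set0.
Proof. exact: sigma_algebra0. Qed.

Let matrix_setC A : <<s coord_preimages >> A -> <<s coord_preimages >> (~` A).
Proof. exact: sigma_algebraC. Qed.

Let matrix_bigcup (F : (set 'M[R]_(m, n))^nat) :
  (forall i, <<s coord_preimages >> (F i)) ->
  <<s coord_preimages >> (\bigcup_i (F i)).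
Proof. exact: sigma_algebra_bigcup. Qed.

HB.instance Definition _ := @isMeasurable.Build measure_matrix_display
  'M[R]_(m, n) <<s coord_preimages >> matrix_set0 matrix_setC matrix_bigcup.

End measurable_matrix.

Section measurable_rV.
Context {R : realType}.

Lemma measurable_coord m n i j :
  measurable_fun setT (fun M : 'M[R]_(m, n) => M i j).
Proof.
move=> _ B mB; rewrite setTI; apply: sub_sigma_algebra.
by exists i, j, B.
Qed.

Lemma measurable_fun_rV d (T : measurableType d) n (f : T -> 'rV[R]_n) :
  (forall i, measurable_fun setT (fun t => f t 0 i)) -> measurable_fun setT f.
Proof.
move=> mf.
apply: (@measurability _ _ _ _ setT f (@coord_preimages R 1 n)) => //.
move=> _ [_ [i [j [B [mB ->]]]] <-].
by rewrite (ord1 i); exact: mf.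
Qed.

Definition cons_rV n (z : R * 'rV[R]_n) : 'rV[R]_n.+1 :=
  \row_i (if unlift ord0 i is Some j then z.2 0 j else z.1).

Definition uncons_rV n (v : 'rV[R]_n.+1) : R * 'rV[R]_n :=
  (v 0 ord0, \row_j v 0 (lift ord0 j)).

Lemma cons_rVK n : cancel (@cons_rV n) (@uncons_rV n).
Proof.
move=> [a v]; rewrite /uncons_rV /cons_rV mxE unlift_none /=; congr pair.
by apply/rowP => j; rewrite !mxE liftK.
Qed.

Lemma measurable_cons_rV n : measurable_fun setT (@cons_rV n).
Proof.
apply: measurable_fun_rV => i; rewrite /cons_rV.
case: (unliftP ord0 i) => [j ij|i0].
- rewrite [X in measurable_fun _ X](_ : _ =
    (fun v : 'rV[R]_n => v 0 j) \o snd); last first.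
    by apply/funext => z /=; rewrite mxE ij liftK.
  exact: measurableT_comp (measurable_coord 0 j) measurable_snd.
- rewrite [X in measurable_fun _ X](_ : _ = fst); last first.
    by apply/funext => z /=; rewrite mxE i0 unlift_none.
  exact: measurable_fst.
Qed.

Lemma measurable_uncons_rV n : measurable_fun setT (@uncons_rV n).
Proof.
apply: measurable_fun_pair; first exact: measurable_coord.
apply: measurable_fun_rV => i.
rewrite [X in measurable_fun _ X](_ : _ =
    (fun v : 'rV[R]_n.+1 => v 0 (lift ord0 i))).
  exact: measurable_coord.
by apply/funext => v; rewrite mxE.
Qed.

End measurable_rV.

Lemma product_sigma_finite d1 d2 (T1 : measurableType d1)
    (T2 : measurableType d2) (R : realType)
    (m1 : {sigma_finite_measure set T1 -> \bar R})
    (m2 : {sigma_finite_measure set T2 -> \bar R}) :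
  sigma_finite setT (m1 \x m2)%E.
Proof.
have /sigma_finiteP[F [TF ndF Foo]] := sigma_finiteT m1.
have /sigma_finiteP[G [TG ndG Goo]] := sigma_finiteT m2.
exists (fun n => F n `*` G n).
  rewrite -setXTT TF TG predeqE => -[x y]; split.
    move=> [/= [n _ Fnx] [k _ Gky]]; exists (maxn n k) => //; split.
    - by move: x Fnx; exact/subsetPset/ndF/leq_maxl.
    - by move: y Gky; exact/subsetPset/ndG/leq_maxr.
  by move=> [n _ []/= ? ?]; split; exists n.
move=> k; have [? ?] := Foo k; have [? ?] := Goo k.
split; first exact: measurableX.
by rewrite product_measure1E// lte_mul_pinfty// ge0_fin_numE.
Qed.

Section lebesgue_rV_step.
Context {R : realType} (n : nat).
Variable nu : {sigma_finite_measure set (measurableTypeR R) -> \bar R}.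
Variable mu : {sigma_finite_measure set 'rV[R]_n -> \bar R}.
Local Open Scope ereal_scope.

Definition lebesgue_rVS : set 'rV[R]_n.+1 -> \bar R :=
  pushforward (nu \x mu) (@cons_rV R n).

Let lebesgue_rVS0 : lebesgue_rVS set0 = 0.
Proof. by rewrite /lebesgue_rVS /pushforward preimage_set0 measure0. Qed.

Let lebesgue_rVS_ge0 A : 0 <= lebesgue_rVS A.
Proof. by rewrite /lebesgue_rVS /pushforward measure_ge0. Qed.

Let lebesgue_rVS_sigma_additive : semi_sigma_additive lebesgue_rVS.
Proof.
move=> F mF tF mUF; rewrite /lebesgue_rVS /pushforward preimage_bigcup.
apply: measure_semi_sigma_additive.
- by move=> k; rewrite -[X in measurable X]setTI; exact: measurable_cons_rV.
- apply/trivIsetP => i j _ _ ij; rewrite -preimage_setI.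
  by move/trivIsetP : tF => /(_ _ _ _ _ ij) ->//; rewrite preimage_set0.
- rewrite -preimage_bigcup -[X in measurable X]setTI.
  exact: measurable_cons_rV.
Qed.

HB.instance Definition _ := isMeasure.Build _ _ _ lebesgue_rVS
  lebesgue_rVS0 lebesgue_rVS_ge0 lebesgue_rVS_sigma_additive.

Let lebesgue_rVS_sigma_finite : sigma_finite setT lebesgue_rVS.
Proof.
have [F TF Foo] := product_sigma_finite nu mu.
exists (fun k => @uncons_rV R n @^-1` F k).
  by rewrite -preimage_bigcup -TF preimage_setT.
move=> k; have [mF Flt] := Foo k; split.
  by rewrite -[X in measurable X]setTI; exact: measurable_uncons_rV.
rewrite /lebesgue_rVS /pushforward.
suff -> : @cons_rV R n @^-1` (@uncons_rV R n @^-1` F k) = F k by [].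
by apply/seteqP; split => z /=; rewrite cons_rVK.
Qed.

HB.instance Definition _ := Measure_isSigmaFinite.Build _ _ _ lebesgue_rVS
  lebesgue_rVS_sigma_finite.

End lebesgue_rV_step.

(* Lebesgue measure on R^N (on Borel sets), as the N-fold product of the     *)
(* one-dimensional one; R^0 is a point of mass 1.                            *)
Fixpoint lebesgue_rV (R : realType) (N : nat) :
    {sigma_finite_measure set 'rV[R]_N -> \bar R} :=
  match N return {sigma_finite_measure set 'rV[R]_N -> \bar R} with
  | 0 => \d_(0 : 'rV[R]_0)
  | n.+1 => lebesgue_rVS (@lebesgue_measure R) (lebesgue_rV R n)
  end.

Section hausdorff.
Context {R : realType} {N : nat}.
Implicit Types A : set 'rV[R]_N.
Local Open Scope ereal_scope.

Definition diam A : \bar R :=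
  ereal_sup [set (enorm (x - y)%R)%:E | x in A & y in A].

Definition ball_volume (d : nat) : \bar R :=
  lebesgue_rV R d [set x | (enorm x <= 1)%R].

(* omega_d (diam A / 2)^d, with the usual conventions: 0 for the empty set,  *)
(* and 0^0 = 1 (so that the 0-dimensional Hausdorff measure is counting).    *)
(* Only used on sets of finite diameter.                                     *)
Definition hausdorff_weight (d : nat) A : \bar R :=
  if `[< A = set0 >] then 0
  else ball_volume d * ((fine (diam A) / 2) ^+ d)%R%:E.

Definition hausdorff_delta (d : nat) (delta : R) A : \bar R :=
  ereal_inf [set \sum_(0 <= k <oo) hausdorff_weight d (F k) |
    F in [set F : (set 'rV[R]_N)^nat |
      A `<=` \bigcup_k F k /\ forall k, diam (F k) <= delta%:E]].

Definition hausdorff (d : nat) A : \bar R :=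
  ereal_sup [set hausdorff_delta d delta A | delta in [set t : R | (0 < t)%R]].

End hausdorff.

Section smooth_open_sets.
Context {R : realType} {N : nat}.

Fixpoint Ck (k : nat) (g : 'rV[R]_N -> R) : Prop :=
  match k with
  | 0 => continuous g
  | k'.+1 => (forall x, differentiable g x) /\
      forall i : 'I_N, Ck k' (fun x => 'D_(delta_mx 0 i) g x)
  end.

Definition smooth_fun (g : 'rV[R]_N -> R) : Prop := forall k, Ck k g.

(* Omega is open and, near each boundary point, it is the sublevel set of a  *)
(* C^oo function whose gradient does not vanish at that point.               *)
Definition smooth_open (Omega : set 'rV[R]_N) : Prop :=
  open Omega /\
  forall x0, closure Omega x0 -> ~ Omega x0 ->
    exists (g : 'rV[R]_N -> R) (r : R),
      [/\ smooth_fun g,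
          (exists i : 'I_N, 'D_(delta_mx 0 i) g x0 != 0),
          0 < r &
          forall x, enorm (x - x0) < r -> (Omega x <-> g x < 0)].

End smooth_open_sets.

Section fractional_sobolev.
Context {R : realType} {N : nat}.
Variables (s p : R).
Implicit Types (A Omega : set 'rV[R]_N) (u v : 'rV[R]_N -> R).

Local Notation mu := (lebesgue_rV R N).
Local Notation mu2 := (lebesgue_rV R N \x lebesgue_rV R N)%E.

Definition Lp_norm A u : \bar R := 'N[mu]_(p%:E)[EFin \o (u \_ A)].

Definition in_Lp A u : Prop := measurable_fun A u /\ (Lp_norm A u < +oo)%E.

Definition in_Lp_loc u : Prop :=
  measurable_fun setT u /\ forall C, compact C -> (Lp_norm C u < +oo)%E.

Definition frac_kernel (x y : 'rV[R]_N) : R :=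
  (enorm (x - y) `^ (N%:R + s * p))^-1.

(* |u|_{W^{s,p}(A)}^p *)
Definition gagliardo A u : \bar R :=
  (\int[mu2]_(z in A `*` A)
    (`|u z.1 - u z.2| `^ p * frac_kernel z.1 z.2)%:E)%E.

Definition Wsp A u : Prop := in_Lp A u /\ (gagliardo A u < +oo)%E.

(* The elements of W~^{s,p}(Omega) are represented by their extension by     *)
(* zero. Functions are Borel measurable (every L^p class has such            *)
(* representatives) and those equal almost everywhere are not identified.    *)
Definition Wtilde Omega u : Prop :=
  [/\ forall x, ~ Omega x -> u x = 0, Wsp Omega u & Wsp setT u].

(* W^{-s,p'}(Omega): bounded linear functionals on W~^{s,p}(Omega). The      *)
(* boundedness makes them compatible with equality almost everywhere.        *)
Definition Wdual Omega (f : ('rV[R]_N -> R) -> R) : Prop :=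
  (forall (a : R) u v, Wtilde Omega u -> Wtilde Omega v ->
     f (fun x => a * u x + v x) = a * f u + f v) /\
  exists C : R, forall v, Wtilde Omega v ->
    (`|f v|%:E <= C%:E * gagliardo setT v `^ p^-1)%E.

Definition What Omega u : Prop :=
  [/\ in_Lp_loc u,
      exists U, [/\ open U, compact (closure Omega),
                    closure Omega `<=` U & Wsp U u] &
      (\int[mu]_x (`|u x| `^ (p - 1) /
         (1 + enorm x) `^ (N%:R + s * p))%:E < +oo)%E].

(* |t|^(p-2) t; it vanishes at t = 0 even if p < 2. *)
Definition phi (t : R) : R := `|t| `^ (p - 2) * t.

(* The value does not depend on the unit vector e. [hausdorff] is an outer   *)
(* measure; the integral only evaluates it on Borel sets, where it is        *)
(* countably additive.                                                       *)
Definition Kconst (e : 'rV[R]_N) : R :=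
  p * (1 - s) *
  (fine (\int[hausdorff N.-1]_(w in sphere) (`|dotv w e| `^ p)%:E)%E)^-1.

Variable e : 'rV[R]_N.

(* Both integrals are absolutely convergent for the u and v to which these   *)
(* forms are applied.                                                        *)
Definition plap_form u v : \bar R :=
  ((Kconst e)%:E * \int[mu2]_z
    (phi (u z.1 - u z.2) * (v z.1 - v z.2) * frac_kernel z.1 z.2)%:E)%E.

Definition Lp_form Omega u v : \bar R :=
  (\int[mu]_(x in Omega) (phi (u x) * v x)%:E)%E.

Definition weak_solution Omega (lambda : R) (f : ('rV[R]_N -> R) -> R) u :
    Prop :=
  [/\ What Omega u,
      {ae mu, forall x, ~ Omega x -> u x = 0} &
      forall v, Wtilde Omega v ->
        plap_form u v = (lambda%:E * Lp_form Omega u v + (f v)%:E)%E].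

Definition eigenvalue_plap Omega (lambda : R) : Prop :=
  exists u, [/\ Wtilde Omega u,
    ~ {ae mu, forall x, u x = 0} &
    forall v, Wtilde Omega v ->
      plap_form u v = (lambda%:E * Lp_form Omega u v)%E].

Definition lambda1 Omega : \bar R :=
  ereal_inf [set ((Kconst e)%:E * gagliardo setT u)%E |
    u in [set u | Wtilde Omega u /\ Lp_norm Omega u = 1%E]].

Definition lambda2 Omega : \bar R :=
  ereal_inf [set l%:E | l in [set l : R |
    (lambda1 Omega < l%:E)%E /\ eigenvalue_plap Omega l]].

End fractional_sobolev.

(* Main.v *)
(* Write N(u) for the p-th root of K |u|_{W^{s,p}}^p and M(u) for the L^p norm.
   A fixed point of the map T, where T u minimizes the convex functional
   N(v)^p - lambda p <|u|^(p-2) u, v> - p <f, v>, is a weak solution, and T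
   decreases J = N^p - lambda M^p - p <f, .>, even along the segment [u, T u].
   By uniform convexity and the compact embedding into L^p, an orbit of T along
   which J stays bounded below has a fixed point as a limit: were the orbit
   unbounded, it would give after normalization an eigenfunction for lambda,
   strictly between lambda_1 and lambda_2.

   Bounded below orbits are found by a mountain pass argument. A very negative
   J(u) forces N(u)^p < lambda_2 M(u)^p. On that cone, iterating the map T with
   f = 0, which decreases the Rayleigh quotient N^p / M^p, must lead arbitrarily
   close to the level lambda_1, as there is no eigenvalue in between; and near
   that level the mean of u does not vanish, because first eigenfunctions have
   constant sign. So the cone is the union of two disjoint open sets, according
   to the final sign of the mean, exchanged by u -> -u. On a segment joining
   -t u to t u with J(t u) and J(-t u) very negative, the points whose T-orbit
   eventually enters the one or the other form two disjoint open sets, so some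
   point of the segment lies in neither.

   The constant K makes sense because the (N-1)-dimensional Hausdorff measure is
   finite on the sphere and positive on a cap. *)

From HB Require Import structures.
Require Import Defs.
From mathcomp Require Import all_boot all_order all_algebra.
From mathcomp Require Import all_classical all_reals all_analysis measurable_realfun.
From mathcomp Require Import ring lra zify.
Set Implicit Arguments.
Unset Strict Implicit.
Unset Printing Implicit Defensive.
Import Order.TTheory GRing.Theory Num.Theory.
Import numFieldNormedType.Exports.
Local Open Scope classical_set_scope.
Local Open Scope ring_scope.

(** For lambda > lambda_1 the functional J is unbounded below, so direct minimization fails. No
    degree, genus or gradient flow replaces it: T is a discrete descent, and the only topology
    needed is the connectedness of real segments. Descent comes from the concave part -lambda M^p,
    which lies below its tangent at u; this gives a convex majorant of J touching it at u, and T u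
    minimizes that majorant. The majorant stays below J(u) on all of [u, T u], so a point at a very
    low level is joined to its image inside the cone and both lie on the same side. Uniform
    convexity takes a form valid for every p > 1, without the usual distinction p < 2: |x - y|^p is
    at most e (|x|^p + |y|^p) plus C times the midpoint defect. Its integral controls the distance
    from u to T u by the drop of J. Weak convergence is never introduced: compactness provides an
    M-limit together with lower semicontinuity of every N(. - v). Functions are not identified
    almost everywhere, so N and M are treated as seminorms on a linear subspace. An unbounded orbit
    divided by its norm forgets f because, by homogeneity, f gets multiplied by a power nu^(p-1)
    tending to 0. *)

(** * Real powers with exponent p > 1 *)

Section powers.
Context {R : realType}.
Implicit Types x y t p : R.

Lemma young_mul p x y : 1 < p -> 0 <= x -> 0 <= y ->
  p * (x `^ (p - 1) * y) <= (p - 1) * x `^ p + y `^ p.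
Proof.
move=> p1 x0 y0; have p0 : 0 < p by lra.
have q0 : 0 < p / (p - 1) by rewrite divr_gt0//; lra.
have pq : p^-1 + (p / (p - 1))^-1 = 1 by field; apply/andP; split; lra.
have := conjugate_powR y0 (powR_ge0 x (p - 1)) p0 q0 pq.
rewrite -powRrM (_ : (p - 1) * (p / (p - 1)) = p); last by field; lra.
move=> /(ler_wpM2l (ltW p0)) H.
rewrite (mulrC (_ `^ _) y); apply: (le_trans H).
by rewrite le_eqVlt; apply/orP; left; apply/eqP; field; apply/andP; split; lra.
Qed.

(** Young's inequality with x * x^(p-1) collected into x^p. Convexity of the power is thus available
    without derivatives, at x = 0 included. *)
Lemma powR_tangent p x y : 1 < p -> 0 <= x -> 0 <= y ->
  x `^ p + p * (x `^ (p - 1) * (y - x)) <= y `^ p.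
Proof.
move=> p1 x0 y0; have := young_mul p1 x0 y0.
have : x * x `^ (p - 1) = x `^ p by rewrite mulr_powRB1//; lra.
move=> <-; nra.
Qed.

Lemma powR_le p x y : 1 < p -> 0 <= x -> x <= y -> x `^ p <= y `^ p.
Proof. by move=> p1 x0 xy; apply: ge0_ler_powR; rewrite ?nnegrE; lra. Qed.

Lemma powR_lt p x y : 1 < p -> 0 <= x -> x < y -> x `^ p < y `^ p.
Proof. by move=> p1 x0 xy; apply: gt0_ltr_powR; rewrite ?nnegrE; lra. Qed.

Lemma powR_leE p x y : 1 < p -> 0 <= x -> 0 <= y ->
  (x `^ p <= y `^ p) = (x <= y).
Proof.
move=> p1 x0 y0; apply/idP/idP; last exact: powR_le.
by apply: contraTT; rewrite -!ltNge; exact: powR_lt.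
Qed.

Lemma powR_ltE p x y : 1 < p -> 0 <= x -> 0 <= y ->
  (x `^ p < y `^ p) = (x < y).
Proof. by move=> p1 x0 y0; rewrite !ltNge powR_leE. Qed.

Lemma powR_invK p x : 1 < p -> 0 <= x -> (x `^ p^-1) `^ p = x.
Proof.
by move=> p1 x0; rewrite -powRrM mulVf ?powRr1//; apply/eqP; lra.
Qed.

Lemma powR_Kinv p x : 1 < p -> 0 <= x -> (x `^ p) `^ p^-1 = x.
Proof.
by move=> p1 x0; rewrite -powRrM mulfV ?powRr1//; apply/eqP; lra.
Qed.

Lemma powR_superlinear p A eta : 1 < p -> 0 <= A -> 0 < eta ->
  exists c : R, forall t : R, 0 <= t -> A * t <= eta * t `^ p + c.
Proof.
(* [t0] solves eta t^(p-1) = A: beyond it the power dominates, before it A t is at most A t0. *)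
move=> p1 A0 e0; pose t0 := (A / eta) `^ (p - 1)^-1.
exists (A * t0) => t t_ge0; have t00 : 0 <= t0 by exact: powR_ge0.
have [tt0|t0t] := leP t t0.
  have := ler_wpM2l A0 tt0; have := powR_ge0 t p; nra.
have : t0 `^ (p - 1) <= t `^ (p - 1).
  by apply: ge0_ler_powR; rewrite ?nnegrE; lra.
have Ae : 0 <= A / eta by rewrite divr_ge0//; lra.
rewrite -powRrM mulVf ?powRr1//; last by apply/eqP; lra.
rewrite ler_pdivrMr// => H.
have : t * t `^ (p - 1) = t `^ p by rewrite mulr_powRB1//; lra.
have := mulr_ge0 A0 t00; nra.
Qed.

Lemma powR_continuous_at p x e : 1 < p -> 0 <= x -> 0 < e ->
  exists2 d : R, 0 < d & forall y : R, 0 <= y -> `|y - x| < d ->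
    `|y `^ p - x `^ p| < e.
Proof.
move=> p1 x0 e0; have p0 : 0 <= p by lra.
(* A Lipschitz constant of the power on [0, x + 1], read off the tangent inequality; the cap 1 on
   the radius keeps y in this interval. *)
pose c := p * (x + 1) `^ (p - 1) + 1.
have c0 : 0 < c by rewrite /c; have := mulr_ge0 p0 (powR_ge0 (x + 1) (p - 1)); lra.
have bnd z w : 0 <= z -> 0 <= w -> w <= x + 1 ->
    w `^ p - z `^ p <= c * `|w - z|.
  move=> z0 w0 wx; have := powR_tangent p1 w0 z0 => H.
  have H2 : w `^ (p - 1) <= (x + 1) `^ (p - 1).
    by apply: ge0_ler_powR; rewrite ?nnegrE; lra.
  have H3 : (p * w `^ (p - 1)) * (w - z) <= c * `|w - z|.
    apply: (le_trans (ler_norm _)); rewrite normrM ler_wpM2r//.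
    rewrite ger0_norm ?mulr_ge0 ?powR_ge0// /c.
    by have := ler_wpM2l p0 H2; lra.
  by move: H H3; rewrite -(opprB w z) 2!mulrN mulrA; lra.
exists (Num.min 1 (e / c)); first by rewrite lt_min ltr01 divr_gt0.
move=> y y0; rewrite lt_min => /andP[d1]; rewrite ltr_pdivlMr// => d2.
have yx : y <= x + 1 by move: d1; rewrite ltr_norml; lra.
have xx : x <= x + 1 by lra.
have := bnd x y x0 y0 yx; have := bnd y x y0 x0 xx.
by rewrite (distrC x y) ltr_norml; lra.
Qed.

End powers.

(** * Mountain pass by iterated convex minimization *)

(** The supremum of the points of A works: A is open, so it would extend beyond a supremum lying in
    it (or reach 1, a point of B), and a supremum in B would have points of A inside B. *)
Lemma segment_not_disconnected (R : realType) (A B : R -> Prop) :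
  (forall t : R, 0 <= t <= 1 -> A t -> exists2 d : R, 0 < d &
     forall t' : R, 0 <= t' <= 1 -> `|t' - t| < d -> A t') ->
  (forall t : R, 0 <= t <= 1 -> B t -> exists2 d : R, 0 < d &
     forall t' : R, 0 <= t' <= 1 -> `|t' - t| < d -> B t') ->
  (forall t : R, 0 <= t <= 1 -> A t -> B t -> False) ->
  A 0 -> B 1 -> exists2 t : R, 0 <= t <= 1 & ~ A t /\ ~ B t.
Proof.
move=> oA oB dAB A0 B1; pose E := [set t : R | 0 <= t <= 1 /\ A t].
have E0 : E 0 by split => //; rewrite lexx ler01.
have ubE : ubound E 1 by move=> t [/andP[]].
have hsE : has_sup E by split; [exists 0 | exists 1].
have s01 : 0 <= sup E <= 1.
  by apply/andP; split; [apply: ub_le_sup => //; exact: hsE.2|by apply: ge_sup => //; exists 0].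
exists (sup E) => //; split => [As|Bs].
- have [d d0 Ad] := oA _ s01 As.
  have [s1|s1] := eqVneq (sup E) 1; first by move: (dAB _ s01 As); rewrite s1; exact.
  pose t' := Num.min 1 (sup E + d / 2).
  have t'gt : sup E < t' by rewrite lt_min; apply/andP; split; lra.
  have t'1 : t' <= 1 by rewrite ge_min lexx.
  have t'd : t' <= sup E + d / 2 by rewrite ge_min lexx orbT.
  have : E t'.
    split; first by apply/andP; split; lra.
    by apply: Ad; [apply/andP; split; lra|rewrite ltr_norml; lra].
  by move=> /(ub_le_sup hsE.2); lra.
- have [d d0 Bd] := oB _ s01 Bs.
  have [t [t01 At] st] := sup_adherent d0 hsE.
  have ts : t <= sup E by apply: ub_le_sup => //; exact: hsE.2.
  by apply: (dAB t) => //; apply: Bd => //; rewrite ltr_norml; lra.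
Qed.

(** * Iterated convex minimization for two seminorms, abstractly *)

Section dc_iteration.
Context {R : realType} {X : lmodType R}.
Variables (p : R) (W : set X) (N M : X -> R) (b : X -> X -> R) (Cp : R).
Hypothesis p1 : 1 < p.
Hypothesis W0 : W 0.
Hypothesis WL : forall a u v, W u -> W v -> W (a *: u + v).
Hypothesis N_ge0 : forall u, 0 <= N u.
Hypothesis NZ : forall a u, W u -> N (a *: u) = `|a| * N u.
Hypothesis ND : forall u v, W u -> W v -> N (u + v) <= N u + N v.
Hypothesis M_ge0 : forall u, 0 <= M u.
Hypothesis MZ : forall a u, W u -> M (a *: u) = `|a| * M u.
Hypothesis MD : forall u v, W u -> W v -> M (u + v) <= M u + M v.
Hypothesis Cp0 : 0 <= Cp.
Hypothesis MN : forall u, W u -> M u <= Cp * N u.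

Local Notation g u := (N u `^ p).
Local Notation D u v := ((g u + g v) / 2 - g (2^-1 *: (u + v))).

(** Uniform convexity with an additive error: linear in p-th powers, hence stable under integration
    of a pointwise inequality. *)
Hypothesis UC : forall eps : R, 0 < eps -> exists2 C : R, 0 <= C &
  forall u v, W u -> W v -> g (u - v) <= eps * (g u + g v) + C * D u v.
(** Replaces weak compactness. Convergence is strong for M only; the last clause, lower
    semicontinuity of all distances N(. - v), is what remains of weak convergence. The indices only
    have to satisfy n <= k n. *)
Hypothesis cpt : forall (u_ : nat -> X) (B : R),
  (forall n, W (u_ n) /\ N (u_ n) <= B) ->
  exists (k : nat -> nat) (u : X), [/\ forall n, (n <= k n)%N, W u,
    forall e : R, 0 < e -> exists n0, forall n, (n0 <= n)%N -> M (u_ (k n) - u) < e &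
    forall v c, W v ->
      (exists n0, forall n, (n0 <= n)%N -> N (u_ (k n) - v) <= c) ->
      N (u - v) <= c].

Hypothesis b_lin : forall a u v w, W u -> W v -> W w ->
  b u (a *: v + w) = a * b u v + b u w.
Hypothesis b_bound : forall u v, W u -> W v ->
  `|b u v| <= p * M u `^ (p - 1) * M v.
Hypothesis bM : forall u, W u -> b u u = p * M u `^ p.
Hypothesis b_cvx : forall u v, W u -> W v ->
  M u `^ p + b u (v - u) <= M v `^ p.
Hypothesis bZ : forall (c : R) u v, 0 < c -> W u -> W v ->
  b (c *: u) v = c `^ (p - 1) * b u v.
Hypothesis b_cont : forall u (eps : R), W u -> 0 < eps -> exists2 d : R, 0 < d &
  forall u' v, W u' -> W v -> M (u' - u) < d ->
    `|b u' v - b u v| <= eps * M v.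

Let p0 : 0 < p. Proof. exact: lt_trans ltr01 p1. Qed.

Let WZ a u : W u -> W (a *: u).
Proof. by move=> Wu; rewrite -[a *: u]addr0; exact: WL. Qed.

Let WD u v : W u -> W v -> W (u + v).
Proof. by move=> Wu Wv; rewrite -[u]scale1r; exact: WL. Qed.

Let WB u v : W u -> W v -> W (u - v).
Proof. by move=> Wu Wv; rewrite addrC -scaleN1r; exact: WL. Qed.

Let Wmid u v : W u -> W v -> W (2^-1 *: (u + v)).
Proof. by move=> Wu Wv; exact/WZ/WD. Qed.

Let N0 : N 0 = 0.
Proof. by rewrite -(scale0r 0) NZ// normr0 mul0r. Qed.

Let g0 : g 0 = 0.
Proof. by rewrite N0 powR0 ?gt_eqF. Qed.

Let NN u : W u -> N (- u) = N u.
Proof. by move=> Wu; rewrite -scaleN1r NZ// normrN1 mul1r. Qed.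

Let MN1 u : W u -> M (- u) = M u.
Proof. by move=> Wu; rewrite -scaleN1r MZ// normrN1 mul1r. Qed.

Let NB u v : W u -> W v -> N u - N v <= N (u - v).
Proof.
move=> Wu Wv; have := ND (WB Wu Wv) Wv; rewrite subrK; lra.
Qed.

Let NBC u v : W u -> W v -> N (u - v) = N (v - u).
Proof. by move=> Wu Wv; rewrite -opprB NN//; exact: WB. Qed.

Let MB u v : W u -> W v -> M u - M v <= M (u - v).
Proof.
move=> Wu Wv; have := MD (WB Wu Wv) Wv; rewrite subrK; lra.
Qed.

Let MBC u v : W u -> W v -> M (u - v) = M (v - u).
Proof. by move=> Wu Wv; rewrite -opprB MN1//; exact: WB. Qed.

Definition blf (L : R) (l : X -> R) :=
  [/\ 0 <= L, forall a u v, W u -> W v -> l (a *: u + v) = a * l u + l v &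
      forall v, W v -> `|l v| <= L * N v].

(** The equation dg(u) = l without differentiating g: minimality is all that the abstract argument
    uses, and the Euler-Lagrange equation is extracted from it only for the concrete seminorms. *)
Definition argmin (l : X -> R) u :=
  W u /\ forall v, W v -> g u - l u <= g v - l v.

Lemma blf0 L l : blf L l -> l 0 = 0.
Proof.
case=> L0 ll lb; have := ll 1 0 0 W0 W0.
rewrite scale1r addr0 mul1r; lra.
Qed.

Lemma blfZ L l a u : blf L l -> W u -> l (a *: u) = a * l u.
Proof.
move=> hl Wu; have [L0 ll lb] := hl.
by rewrite -[a *: u]addr0 ll// (blf0 hl) addr0.
Qed.

Lemma blfD L l u v : blf L l -> W u -> W v -> l (u + v) = l u + l v.
Proof. by move=> [L0 ll lb] Wu Wv; rewrite -[u]scale1r ll// mul1r scale1r. Qed.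

Lemma blfB L l u v : blf L l -> W u -> W v -> l (u - v) = l u - l v.
Proof.
move=> [L0 ll lb] Wu Wv.
by rewrite addrC -scaleN1r ll// mulN1r addrC.
Qed.

Lemma blf_mid L l u v : blf L l -> W u -> W v ->
  l (2^-1 *: (u + v)) = (l u + l v) / 2.
Proof.
by move=> hl Wu Wv; rewrite (blfZ _ hl)// ?(blfD hl)//; [ring|exact: WD].
Qed.

Lemma UC_small B e : 0 <= B -> 0 < e -> exists2 d : R, 0 < d &
  forall u v, W u -> W v -> N u <= B -> N v <= B -> D u v < d -> N (u - v) < e.
Proof.
move=> B0 e0; have ep : 0 < e `^ p by exact: powR_gt0.
have Bp : 0 <= B `^ p by exact: powR_ge0.
(* This [eta] gives the first term of [UC] at most half of e^p; the bound on D leaves less than a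
   quarter to the second. *)
pose eta := e `^ p / (4 * (B `^ p + 1)).
have eta0 : 0 < eta by rewrite divr_gt0//; lra.
have [C C0 HC] := UC eta0.
exists (e `^ p / (4 * (C + 1))); first by rewrite divr_gt0//; lra.
move=> u v Wu Wv Nu Nv; rewrite ltr_pdivlMr; last by lra.
move=> HD; rewrite -(powR_ltE p1)//; last exact: ltW.
apply: (le_lt_trans (HC _ _ Wu Wv)).
have gu : g u <= B `^ p by exact: powR_le.
have gv : g v <= B `^ p by exact: powR_le.
have e1 : eta * (4 * (B `^ p + 1)) = e `^ p.
  by rewrite /eta; field; lra.
have e2 : eta * (g u + g v) <= eta * (2 * (B `^ p + 1)).
  by rewrite ler_wpM2l//; lra.
have := D u v; set d := D u v in HD *; move=> _.
have [d0|d0] := leP 0 d.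
  have : C * d <= (C + 1) * d by nra.
  lra.
have : C * d <= 0 by nra.
lra.
Qed.

(** A minimizing sequence is Cauchy, since the value at a midpoint cannot fall below the infimum and
    so the convexity defects tend to 0. The limit comes from [cpt], whose lower semicontinuity turns
    bounds on N(u_m - u_n) into bounds on N(u - u_n). *)
Lemma argmin_exists L l : blf L l -> exists u, argmin l u.
Proof.
move=> hl; have [L0 ll lb] := hl.
pose F v := g v - l v.
have [c Hc] : exists c : R, forall t : R, 0 <= t -> (L + 1) * t <= 1 * t `^ p + c.
  by apply: powR_superlinear => //; lra.
have FN v : W v -> N v - c <= F v.
  move=> Wv; have := Hc _ (N_ge0 v); have := lb _ Wv; rewrite ler_norml /F.
  lra.
pose E := F @` W.
have hiE : has_inf E.
  split; first by exists (F 0); exists 0.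
  exists (- c) => _ [v Wv <-]; have := FN _ Wv; have := N_ge0 v; lra.
have Em v : W v -> inf E <= F v.
  by move=> Wv; apply: ge_inf; [exact: hiE.2|exists v].
have /choice[u_ Hu] : forall n : nat, exists v, W v /\ F v < inf E + harmonic n.
  move=> n; have n0 : 0 < harmonic n :> R by rewrite invr_gt0.
  by have [_ [v Wv <-] Hv] := inf_adherent n0 hiE; exists v.
have Wu n := (Hu n).1.
pose B := c + inf E + 1.
have NuB n : N (u_ n) <= B.
  have := FN _ (Wu n); have := (Hu n).2.
  have : harmonic n <= 1 :> R by rewrite invf_le1// ler1n.
  rewrite /B; lra.
have B0 : 0 <= B by apply: le_trans (NuB 0%N).
have [k [u [kn Wul _ lsc]]] := cpt (fun n => conj (Wu n) (NuB n)).
exists u; split => // v Wv; apply: le_trans (Em _ Wv).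
apply/ler_addgt0Pr => e e0.
(* Chosen so that replacing u_n by u costs the linear term at most e / 2. *)
pose eta := e / (2 * (L + 1)).
have eta0 : 0 < eta by rewrite divr_gt0//; lra.
have Leta : 2 * (L * eta) <= e.
  have -> : e = 2 * (L + 1) * eta by rewrite /eta; field; lra.
  nra.
have [d d0 Hd] := UC_small B0 eta0.
pose n0 := (Num.truncn (d^-1 + 2 * e^-1)).+1.
have Hn0 n : (n0 <= n)%N -> (harmonic n < d /\ harmonic n < e / 2 :> R).
  move=> n0n; have Hn : d^-1 + 2 * e^-1 < n.+1%:R.
    apply: lt_le_trans (truncnS_gt _) _; rewrite ler_nat; exact: leqW.
  have di : 0 < d^-1 by rewrite invr_gt0.
  have ei : 0 < 2 * e^-1 by rewrite mulr_gt0// invr_gt0.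
  have Hh y : 0 < y -> y <= d^-1 + 2 * e^-1 -> harmonic n < y^-1.
    move=> y0 /le_lt_trans/(_ Hn) yn.
    by rewrite /harmonic ltf_pV2 ?posrE.
  have -> : e / 2 = (2 * e^-1)^-1 by rewrite invfM invrK mulrC.
  by rewrite -[d]invrK; split; apply: Hh; lra.
have cauchy m n : (n0 <= m)%N -> (n0 <= n)%N -> N (u_ m - u_ n) < eta.
  move=> /Hn0[md me] /Hn0[nd ne]; apply: Hd => //.
  have := Em _ (Wmid (Wu m) (Wu n)); rewrite /F (blf_mid hl)//.
  have := (Hu m).2; have := (Hu n).2; rewrite /F; lra.
have kn0 n : (n0 <= n)%N -> (n0 <= k n)%N by move=> h; exact: leq_trans (kn n).
have Nun n : (n0 <= n)%N -> N (u - u_ (k n)) <= eta.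
  move=> n0n; apply: lsc => //; exists n0 => m n0m.
  by rewrite ltW// cauchy//; exact: kn0.
have gl : forall n, (n0 <= n)%N -> g (u_ (k n)) <= inf E + e / 2 + l u + L * eta.
  move=> n n0n; have := (Hu (k n)).2; have := (Hn0 _ (kn0 _ n0n)).2.
  have := lb _ (WB Wul (Wu (k n))); rewrite (blfB hl)// ler_norml /F.
  have := ler_wpM2l L0 (Nun _ n0n); lra.
set c' := inf E + _ + _ + _ in gl.
have c'0 : 0 <= c' by apply: le_trans (gl n0 _) => //; exact: powR_ge0.
suff : g u <= c' by rewrite /c'; lra.
rewrite -[leRHS](powR_invK p1)// powR_le//.
rewrite -(subr0 u); apply: lsc => //; exists n0 => n n0n.
rewrite subr0 -(powR_leE p1)//; last exact: powR_ge0.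
by rewrite powR_invK//; exact: gl.
Qed.

(** Both minimality conditions are tested at the midpoint and added. This quantifies the
    monotonicity of dg and is the source of uniqueness and stability. *)
Lemma argmin_D l l' L L' u v : blf L l -> blf L' l' -> argmin l u ->
  argmin l' v -> 4 * D u v <= (l u - l v) - (l' u - l' v).
Proof.
move=> hl hl' [Wu Hu] [Wv Hv].
have := Hu _ (Wmid Wu Wv); have := Hv _ (Wmid Wu Wv).
rewrite (blf_mid hl)// (blf_mid hl')//; lra.
Qed.

Lemma argmin_cont L l u e : blf L l -> argmin l u -> 0 < e ->
  exists2 d : R, 0 < d & forall (L' : R) (l' : X -> R) v, blf L' l' ->
    (forall w, W w -> `|l' w - l w| <= d * N w) -> argmin l' v -> N (v - u) < e.
Proof.
move=> hl Au e0; have [L0 ll lb] := hl.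
(* An a priori bound: a form l' within distance 1 of l has norm at most L + 1, and one more unit in
   the slope leaves N v <= c for its minimizers. *)
have [c Hc] : exists c : R, forall t : R, 0 <= t -> (L + 2) * t <= 1 * t `^ p + c.
  by apply: powR_superlinear => //; lra.
have bnd L' l' v : blf L' l' ->
    (forall w, W w -> `|l' w - l w| <= 1 * N w) -> argmin l' v -> N v <= c.
  move=> hl' l'l [Wv Av]; have := Av _ W0; rewrite g0 (blf0 hl').
  have := Hc _ (N_ge0 v); have := l'l _ Wv; have := lb _ Wv; rewrite !ler_norml.
  lra.
have Nu : N u <= c.
  by apply: (bnd L l) => // w Ww; rewrite subrr normr0 mul1r.
have c0 : 0 <= c by apply: le_trans Nu.
have [d d0 Hd] := UC_small c0 e0.
pose r := d / (c + 1).
have r0 : 0 < r by rewrite divr_gt0//; lra.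
have rE : r * (c + 1) = d by rewrite /r; field; lra.
exists (Num.min 1 r); first by rewrite lt_min ltr01.
move=> L' l' v hl' l'l Av.
have m1 : Num.min 1 r <= 1 by rewrite ge_min lexx.
have mr : Num.min 1 r <= r by rewrite ge_min lexx orbT.
have Nv : N v <= c.
  apply: (bnd _ _ _ hl') => // w Ww; apply: (le_trans (l'l _ Ww)).
  by rewrite ler_wpM2r.
have [Wu Wv] := (Au.1, Av.1).
apply: Hd => //; have := argmin_D hl' hl Av Au.
have := l'l _ (WB Wv Wu); rewrite (blfB hl)// (blfB hl')// ler_norml.
have NW : N (v - u) <= 2 * c.
  by have := ND Wv (WZ (-1) Wu); rewrite NZ// normrN1 mul1r scaleN1r; lra.
have : Num.min 1 r * N (v - u) <= r * (2 * c).
  by rewrite ler_pM// le_min ler01 ltW.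
lra.
Qed.

(** g is homogeneous of degree p, so its derivative has degree p - 1. *)
Lemma argmin_scale l u c L : blf L l -> argmin l u -> 0 < c ->
  argmin (fun v => c `^ (p - 1) * l v) (c *: u).
Proof.
move=> hl [Wu Au] c0; split; first exact: WZ.
move=> v Wv; have := Au _ (WZ c^-1 Wv).
have cp : c * c `^ (p - 1) = c `^ p by rewrite mulr_powRB1//; lra.
have cp0 : 0 < c `^ p by exact: powR_gt0.
have vE : v = c *: (c^-1 *: v) by rewrite scalerA mulfV ?scale1r//; lra.
rewrite [in X in _ -> X]vE; move: (c^-1 *: v) (WZ c^-1 Wv) => w Ww H.
rewrite !(blfZ _ hl)// !NZ// !(ger0_norm (ltW c0)) !powRM// ?(ltW c0)//.
rewrite !mulrA !(mulrC _ c) cp -!mulrBr; nra.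
Qed.

Lemma blf_b kappa sigma h L u : 0 <= kappa -> blf L h -> W u ->
  exists L', blf L' (fun v => kappa * b u v + sigma * h v).
Proof.
move=> k0 [L0 hl hb] Wu.
have k1 : 0 <= kappa * (p * M u `^ (p - 1) * Cp).
  by rewrite !mulr_ge0// ?powR_ge0// ltW.
exists (kappa * (p * M u `^ (p - 1) * Cp) + `|sigma| * L); split.
- by rewrite addr_ge0// mulr_ge0.
- by move=> a v w Wv Ww; rewrite b_lin// hl//; ring.
- move=> v Wv; apply: (le_trans (ler_normD _ _)); rewrite mulrDl lerD//.
    rewrite normrM (ger0_norm k0) -!mulrA ler_wpM2l// mulrA.
    apply: (le_trans (b_bound Wu Wv)).
    by rewrite ler_wpM2l ?MN// mulr_ge0 ?powR_ge0// ltW.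
  by rewrite normrM -mulrA ler_wpM2l// hb.
Qed.

(** The datum u enters through M only, so the convergence provided by [cpt] already yields
    N-convergence of the solutions. The coefficient of h varies too, because it tends to 0 along
    rescaled orbits. *)
Lemma argmin_b_cont kappa sigma h L u z e : 0 <= kappa -> blf L h -> W u ->
  argmin (fun v => kappa * b u v + sigma * h v) z -> 0 < e ->
  exists2 d : R, 0 < d & forall u' sigma' z', W u' -> M (u' - u) < d ->
    `|sigma' - sigma| < d ->
    argmin (fun v => kappa * b u' v + sigma' * h v) z' -> N (z' - z) < e.
Proof.
move=> k0 hh Wu Az e0; have [L' hl] := blf_b sigma k0 hh Wu.
have [L0 hlin hb] := hh.
have [d d0 Hd] := argmin_cont hl Az e0.
pose eps := d / (2 * (kappa * Cp + 1)).
have kC : 0 <= kappa * Cp by exact: mulr_ge0.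
have eps0 : 0 < eps by rewrite divr_gt0//; lra.
have epsE : 2 * (kappa * Cp * eps) <= d.
  have -> : d = 2 * (kappa * Cp + 1) * eps by rewrite /eps; field; lra.
  nra.
have [d1 d10 Hd1] := b_cont Wu eps0.
pose d2 := d / (2 * (L + 1)).
have d20 : 0 < d2 by rewrite divr_gt0//; lra.
have d2E : 2 * (L * d2) <= d.
  have -> : d = 2 * (L + 1) * d2 by rewrite /d2; field; lra.
  nra.
exists (Num.min d1 d2); first by rewrite lt_min d10.
move=> u' s' z' Wu'; rewrite !lt_min => /andP[ud1 _] /andP[_ sd2] Az'.
have [L'' hl'] := blf_b s' k0 hh Wu'.
apply: (Hd _ _ _ hl' _ Az') => w Ww.
have -> : kappa * b u' w + s' * h w - (kappa * b u w + sigma * h w) =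
  kappa * (b u' w - b u w) + (s' - sigma) * h w by ring.
apply: (le_trans (ler_normD _ _)); rewrite !normrM (ger0_norm k0).
have H1 : kappa * `|b u' w - b u w| <= kappa * Cp * eps * N w.
  have := le_trans (Hd1 _ _ Wu' Ww ud1) (ler_wpM2l (ltW eps0) (MN Ww)).
  by move=> /(ler_wpM2l k0); lra.
have H2 : `|s' - sigma| * `|h w| <= d2 * (L * N w).
  by rewrite ler_pM// ?hb// ltW.
have := N_ge0 w; nra.
Qed.

Section functional.
Variables (kappa : R) (h : X -> R) (L : R).
Hypothesis k0 : 0 <= kappa.
Hypothesis hh : blf L h.

Definition energy u := g u - kappa * M u `^ p - h u.

(** The map T of the overview. [xget] selects one minimizer, which is determined only up to
    N-distance 0 as N is a seminorm; the default 0 never occurs for u in W. *)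
Definition iterate u := xget 0 (argmin (fun v => kappa * b u v + h v)).

Lemma iterateP u : W u -> argmin (fun v => kappa * b u v + h v) (iterate u).
Proof.
move=> Wu; rewrite /iterate; case: xgetP => //= Hno.
have [L' hl] := blf_b 1 k0 hh Wu; have [z Az] := argmin_exists hl.
by have := Hno z; case; move: Az; under eq_fun do rewrite mul1r.
Qed.

Lemma W_iterate u : W u -> W (iterate u).
Proof. by move=> /iterateP[]. Qed.

Lemma W_iter_iterate n u : W u -> W (iter n iterate u).
Proof. by elim: n => [//|n IH] Wu; rewrite iterS; exact/W_iterate/IH. Qed.

(* The concave part of the energy lies below its tangent at u. *)
Lemma energy_majorant u v : W u -> W v ->
  energy v <= energy u + (g v - (kappa * b u v + h v))
                       - (g u - (kappa * b u u + h u)).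
Proof.
move=> Wu Wv; have := b_cvx Wu Wv.
have -> : b u (v - u) = b u v - b u u.
  by rewrite addrC -scaleN1r b_lin// mulN1r addrC.
move=> /(ler_wpM2l k0); rewrite /energy; lra.
Qed.

(** Minimality of z tested at the midpoint gains twice the defect D. Along an orbit with energies
    bounded below, the defects of consecutive iterates therefore tend to 0. *)
Lemma argmin_energy_D u z : W u -> argmin (fun v => kappa * b u v + h v) z ->
  2 * D u z <= energy u - energy z.
Proof.
move=> Wu [Wz Az]; have := energy_majorant Wu Wz; have := Az _ (Wmid Wu Wz).
have [L' hl] := blf_b 1 k0 hh Wu.
have -> : kappa * b u (2^-1 *: (u + z)) + h (2^-1 *: (u + z)) =
    ((kappa * b u u + h u) + (kappa * b u z + h z)) / 2.
  by have := blf_mid hl Wu Wz; rewrite !mul1r.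
lra.
Qed.

End functional.

(** * Segments, open sets and continuous maps for the seminorm N *)

Definition seg (t : R) (u v : X) := t *: (v - u) + u.

Lemma W_seg t u v : W u -> W v -> W (seg t u v).
Proof. by move=> Wu Wv; exact/WL/Wu/WB. Qed.

Lemma seg0 u v : seg 0 u v = u.
Proof. by rewrite /seg scale0r add0r. Qed.

Lemma seg1 u v : seg 1 u v = v.
Proof. by rewrite /seg scale1r subrK. Qed.

Lemma g_seg t u v : W u -> W v -> 0 <= t <= 1 ->
  g (seg t u v) <= (1 - t) * g u + t * g v.
Proof.
move=> Wu Wv /andP[t0 t1].
pose m := (1 - t) * N u + t * N v.
have m0 : 0 <= m by rewrite addr_ge0// mulr_ge0//; lra.
have Nm : N (seg t u v) <= m.
  have -> : seg t u v = (1 - t) *: u + t *: v.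
    by rewrite /seg scalerBr scalerBl scale1r -addrA [RHS]addrC (addrC u).
  apply: (le_trans (ND (WZ _ Wu) (WZ _ Wv))).
  by rewrite !NZ// !ger0_norm//; lra.
apply: (le_trans (powR_le p1 (N_ge0 _) Nm)).
have H1 := powR_tangent p1 m0 (N_ge0 u).
have H2 := powR_tangent p1 m0 (N_ge0 v).
have t1' : 0 <= 1 - t by lra.
have := ler_wpM2l t1' H1; have := ler_wpM2l t0 H2.
have : (1 - t) * (p * (m `^ (p - 1) * (N u - m))) +
       t * (p * (m `^ (p - 1) * (N v - m))) = 0 by rewrite /m; ring.
lra.
Qed.

(** The majorant touching the energy at u is convex and minimal at z, so on the segment it never
    exceeds its value at u. Sublevel sets thus contain the whole segment, not only its endpoints. *)
Lemma energy_seg kappa h L u z t : 0 <= kappa -> blf L h -> W u ->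
  argmin (fun v => kappa * b u v + h v) z -> 0 <= t <= 1 ->
  energy kappa h (seg t u z) <= energy kappa h u.
Proof.
move=> k0 hh Wu [Wz Az] t01.
have := energy_majorant h k0 Wu (W_seg t Wu Wz).
have := g_seg Wu Wz t01; have := Az _ Wu.
have [L' hl] := blf_b 1 k0 hh Wu.
have -> : kappa * b u (seg t u z) + h (seg t u z) =
    (1 - t) * (kappa * b u u + h u) + t * (kappa * b u z + h z).
  have [_ lin _] := hl; have := lin t _ _ (WB Wz Wu) Wu.
  by rewrite (blfB hl)// !mul1r => ->; ring.
move: t01 => /andP[t0 t1]; nra.
Qed.

(** Openness relative to W for N, spelled out by hand because X carries no topology. *)
Definition opn (U : set X) := forall u, W u -> U u -> exists2 d : R, 0 < d &
  forall v, W v -> N (v - u) < d -> U v.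

Lemma opnI U V : opn U -> opn V -> opn (U `&` V).
Proof.
move=> oU oV u Wu [Uu Vu].
have [d d0 Hd] := oU _ Wu Uu; have [e e0 He] := oV _ Wu Vu.
exists (Num.min d e); first by rewrite lt_min d0.
by move=> v Wv; rewrite lt_min => /andP[? ?]; split; [exact: Hd|exact: He].
Qed.

Definition cts (T : X -> X) := forall u, W u -> W (T u) /\
  forall e : R, 0 < e -> exists2 d : R, 0 < d &
    forall v, W v -> N (v - u) < d -> N (T v - T u) < e.

Lemma opn_preimage T U : cts T -> opn U -> opn (T @^-1` U).
Proof.
move=> cT oU u Wu /(oU _ (cT _ Wu).1)[e e0 He].
have [d d0 Hd] := (cT _ Wu).2 _ e0; exists d => // v Wv vu.
by apply: He; [exact: (cT _ Wv).1|exact: Hd].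
Qed.

Lemma cts_iter T n : cts T -> cts (iter n T).
Proof.
move=> cT; elim: n => [|n IH] u Wu.
  by split => // e e0; exists e.
have [WT HT] := IH _ Wu; have [WT' HT'] := cT _ WT.
split => // e e0; have [d d0 Hd] := HT' _ e0; have [d' d'0 Hd'] := HT _ d0.
exists d' => // v Wv vu; apply: Hd; [exact: (IH _ Wv).1|exact: Hd'].
Qed.

Lemma cts_iterate kappa h L : 0 <= kappa -> blf L h -> cts (iterate kappa h).
Proof.
move=> k0 hh u Wu; have Au := iterateP k0 hh Wu; split; first exact: Au.1.
move=> e e0.
have Au' : argmin (fun v => kappa * b u v + 1 * h v) (iterate kappa h u).
  by under eq_fun do rewrite mul1r.
have [d d0 Hd] := argmin_b_cont k0 hh Wu Au' e0.
have C1 : 0 < Cp + 1 by rewrite ltr_wpDl.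
exists (d / (Cp + 1)); first by rewrite divr_gt0.
move=> v Wv; rewrite ltr_pdivlMr//.
move=> vu; apply: (Hd v 1) => //; last 2 first.
- by rewrite subrr normr0.
- by under eq_fun do rewrite mul1r; exact: (iterateP k0 hh Wv).
by have := MN (WB Wv Wu); have := N_ge0 (v - u); lra.
Qed.

Lemma seg_not_disconnected U V u v : W u -> W v -> opn U -> opn V ->
  (forall x, W x -> U x -> V x -> False) -> U u -> V v ->
  exists2 t : R, 0 <= t <= 1 & ~ U (seg t u v) /\ ~ V (seg t u v).
Proof.
move=> Wu Wv oU oV dUV Uu Vv.
have H Z : opn Z -> forall t : R, 0 <= t <= 1 -> Z (seg t u v) -> exists2 d : R, 0 < d &
     forall t' : R, 0 <= t' <= 1 -> `|t' - t| < d -> Z (seg t' u v).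
  move=> oZ t _ /(oZ _ (W_seg _ Wu Wv))[d d0 Hd].
  exists (d / (N (v - u) + 1)).
    by rewrite divr_gt0//; have := N_ge0 (v - u); lra.
  move=> t' _; rewrite ltr_pdivlMr; last by have := N_ge0 (v - u); lra.
  move=> t't; apply: Hd; first exact: W_seg.
  have -> : seg t' u v - seg t u v = (t' - t) *: (v - u).
    by rewrite /seg opprD addrACA subrr addr0 scalerBl.
  rewrite NZ; last exact: WB.
  have := normr_ge0 (t' - t); lra.
apply: (@segment_not_disconnected R (fun t => U (seg t u v))
  (fun t => V (seg t u v))) => //; try exact: H; rewrite ?seg0 ?seg1//.
by move=> t _; apply: dUV; exact: W_seg.
Qed.

Lemma seg_connected U V u v : W u -> W v -> opn U -> opn V ->
  (forall x, W x -> U x -> V x -> False) ->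
  (forall t : R, 0 <= t <= 1 -> U (seg t u v) \/ V (seg t u v)) -> U u -> U v.
Proof.
move=> Wu Wv oU oV dUV cov Uu.
have := cov 1; rewrite ler01 lexx seg1 => -[//|//|Vv].
have [t t01 [nU nV]] := seg_not_disconnected Wu Wv oU oV dUV Uu Vv.
by have [] := cov _ t01.
Qed.

Lemma opn_exists (A : nat -> set X) :
  (forall n, opn (A n)) -> opn [set u | exists n, A n u].
Proof.
move=> oA u Wu [n An]; have [d d0 Hd] := oA n _ Wu An.
by exists d => // v Wv vu; exists n; exact: Hd.
Qed.

Lemma argmin_ext l l' u : (forall v, W v -> l v = l' v) ->
  argmin l u -> argmin l' u.
Proof. by move=> ll' [Wu Au]; split => // v Wv; rewrite -!ll'//; exact: Au. Qed.

Lemma opn_energy_lt kappa h L c : 0 <= kappa -> blf L h ->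
  opn [set u | energy kappa h u < c].
Proof.
move=> k0 hh u Wu /= Hu; have [L0 hlin hb] := hh.
(* A quarter of the gap: the three terms of the energy may each vary by e. *)
pose e := (c - energy kappa h u) / 4.
have e0 : 0 < e by rewrite divr_gt0// subr_gt0.
have eE : c = energy kappa h u + 4 * e by rewrite /e; field.
have [d1 d10 Hd1] := powR_continuous_at p1 (N_ge0 u) e0.
have ek : 0 < e / (kappa + 1) by rewrite divr_gt0//; lra.
have [d2 d20 Hd2] := powR_continuous_at p1 (M_ge0 u) ek.
have C1 : 0 < Cp + 1 by rewrite ltr_wpDl.
have L1 : 0 < L + 1 by lra.
exists (Num.min d1 (Num.min (d2 / (Cp + 1)) (e / (L + 1)))).
  by rewrite !lt_min d10/=; apply/andP; split; exact: divr_gt0.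
move=> v Wv; rewrite !lt_min => /and3P[vu1].
rewrite !ltr_pdivlMr// => vu2 vu3.
have H1 : `|g v - g u| < e.
  apply: Hd1 => //; apply: le_lt_trans vu1.
  by rewrite ler_norml; have := NB Wu Wv; have := NB Wv Wu; rewrite (NBC Wu)//; lra.
have H2 : kappa * `|M v `^ p - M u `^ p| <= e.
  have : `|M v `^ p - M u `^ p| < e / (kappa + 1).
    apply: Hd2 => //; apply: (@le_lt_trans _ _ (M (v - u))).
      by rewrite ler_norml; have := MB Wu Wv; have := MB Wv Wu; rewrite (MBC Wu)//; lra.
    by have := MN (WB Wv Wu); have := N_ge0 (v - u); lra.
  rewrite ltr_pdivlMr; last by lra.
  by have := normr_ge0 (M v `^ p - M u `^ p); lra.
have H3 : `|h v - h u| < e.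
  rewrite -(blfB hh)//; apply: (le_lt_trans (hb _ (WB Wv Wu))).
  by have := N_ge0 (v - u); lra.
have H4 : `|kappa * (M v `^ p - M u `^ p)| <= e by rewrite normrM (ger0_norm k0).
rewrite eE /energy; move: H1 H3 H4; rewrite !ltr_norml ler_norml; lra.
Qed.

(** * The gap between two eigenvalues and the mountain pass *)

Section minimax.
Variables (Q : X -> R) (CQ r1 r2 : R).
Hypothesis CQ0 : 0 <= CQ.
Hypothesis Q_lin : forall a u v, W u -> W v -> Q (a *: u + v) = a * Q u + Q v.
Hypothesis Q_bound : forall u, W u -> `|Q u| <= CQ * M u.
Hypothesis r1_ge0 : 0 <= r1.
Hypothesis r1_near : forall r, r1 < r -> exists2 u, W u & N u < r * M u.
Hypothesis Q_sep : forall u, W u -> 0 < M u -> N u <= r1 * M u -> Q u <> 0.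
(** Such a u would be an eigenfunction for r^p. The numbers r1 and r2 are p-th roots of eigenvalue
    bounds, so that quotients N / M can be compared without powers. *)
Hypothesis nores : forall r u, r1 < r < r2 -> 0 < M u ->
  ~ argmin (fun v => r `^ p * b u v) u.

Let M0 : M 0 = 0.
Proof. by rewrite -(scale0r 0) MZ// normr0 mul0r. Qed.

Let QZ a u : W u -> Q (a *: u) = a * Q u.
Proof.
move=> Wu; have := Q_lin 1 W0 W0; rewrite scale1r addr0 mul1r => Q0.
by rewrite -[a *: u]addr0 Q_lin//; lra.
Qed.

Let QB u v : W u -> W v -> Q (u - v) = Q u - Q v.
Proof. by move=> Wu Wv; rewrite addrC -scaleN1r Q_lin// mulN1r addrC. Qed.

Definition cone r : set X := [set u | W u /\ N u < r * M u].

Lemma cone_pos r u : 0 <= r -> cone r u -> 0 < M u.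
Proof.
move=> r0 [Wu Hu]; rewrite lt_neqAle M_ge0 andbT; apply/eqP => Mu.
by move: Hu; rewrite -Mu mulr0; have := N_ge0 u; lra.
Qed.

Lemma cone_scale r c u : 0 < c -> cone r u -> cone r (c *: u).
Proof.
move=> c0 [Wu Hu]; split; first exact: WZ.
by rewrite NZ// MZ// ger0_norm ?ltW// mulrCA ltr_pM2l.
Qed.

Lemma opn_cone r : 0 <= r -> opn (cone r).
Proof.
move=> r0 u Wu [_ Hu].
have rC : 0 < r * Cp + 1 by rewrite ltr_wpDl// mulr_ge0.
exists ((r * M u - N u) / (r * Cp + 1)); first by rewrite divr_gt0// subr_gt0.
move=> v Wv; rewrite ltr_pdivlMr// => vu; split => //.
have := ler_wpM2l r0 (MN (WB Wv Wu)); have := ler_wpM2l r0 (MB Wu Wv).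
have := NB Wv Wu; rewrite (MBC Wu)//; lra.
Qed.

Lemma opn_sign sg : opn [set u | 0 < sg * Q u].
Proof.
move=> u Wu /= Hu.
have C1 : 0 < `|sg| * (CQ * Cp) + 1 by rewrite ltr_wpDl// !mulr_ge0.
exists (sg * Q u / (`|sg| * (CQ * Cp) + 1)); first by rewrite divr_gt0.
move=> v Wv; rewrite ltr_pdivlMr// => vu.
have H1 : `|sg * (Q v - Q u)| <= `|sg| * (CQ * (Cp * N (v - u))).
  rewrite normrM ler_wpM2l// -QB//; apply: (le_trans (Q_bound (WB Wv Wu))).
  by rewrite ler_wpM2l// MN//; exact: WB.
by move: H1; have := N_ge0 (v - u); rewrite ler_norml; lra.
Qed.

(** The cone is the negativity set of the energy without h, so energy descent also controls Rayleigh
    quotients. *)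
Lemma energy0_lt0 r u : 0 <= r ->
  (energy (r `^ p) (fun=> 0) u < 0) = (N u < r * M u).
Proof.
move=> r0; rewrite /energy subr0 subr_lt0 -powRM// powR_ltE//.
by rewrite mulr_ge0.
Qed.

Let hz : blf 0 (fun=> 0 : R).
Proof. by split => // *; rewrite ?mulr0 ?addr0// normr0 mul0r. Qed.

(** Inverse iteration for the nonlinear eigenvalue problem. By homogeneity another coefficient than
    1 would only rescale the image, and cones are invariant under positive scaling. *)
Local Notation S := (iterate 1 (fun=> 0)).

Let SP u : W u -> argmin (b u) (S u).
Proof.
move=> /(iterateP ler01 hz); apply: argmin_ext => v _.
by rewrite mul1r addr0.
Qed.

Let WS u : W u -> W (S u).
Proof. by move=> /SP[]. Qed.

Let blf_b1 u : W u -> exists L, blf L (b u).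
Proof.
move=> /(blf_b 0 ler01 hz)[L hL]; exists L; move: hL.
by under eq_fun do rewrite mul1r mul0r addr0.
Qed.

Lemma argmin_b_scale r u z : 0 < r -> W u -> argmin (b u) z ->
  exists2 c, 0 < c & argmin (fun v => r `^ p * b u v + 0) (c *: z).
Proof.
(* c^(p-1) = r^p. *)
move=> r0 Wu Az; pose c := r `^ (p / (p - 1)).
have pp : 0 < p - 1 by rewrite subr_gt0.
have c0 : 0 < c by exact: powR_gt0.
exists c => //; have [L hL] := blf_b1 Wu.
apply: argmin_ext (argmin_scale hL Az c0) => v _.
by rewrite addr0 /c -powRrM mulfVK// gt_eqF.
Qed.

(** The right multiple of S u is the image of u under the iteration with coefficient r^p and h = 0,
    whose energy is negative exactly on the cone; [energy_seg] then keeps the segment inside. *)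
Lemma S_seg r u : 0 < r -> cone r u -> exists2 c, 0 < c &
  forall t : R, 0 <= t <= 1 -> cone r (seg t u (c *: S u)).
Proof.
move=> r0 [Wu Hu]; have [c c0 Ac] := argmin_b_scale r0 Wu (SP Wu).
exists c => // t t01; split; first by apply: W_seg; [|exact: Ac.1].
have r0' := ltW r0.
rewrite -energy0_lt0//; move: Hu; rewrite -energy0_lt0//; apply: le_lt_trans.
by apply: (energy_seg _ hz) => //; exact: powR_ge0.
Qed.

Lemma cone_S r u : 0 < r -> cone r u -> cone r (S u).
Proof.
move=> r0 Cu; have [c c0 Hc] := S_seg r0 Cu.
have := Hc 1; rewrite ler01 lexx seg1 => /(_ isT) Cc.
have ci : 0 < c^-1 by rewrite invr_gt0.
have := cone_scale ci Cc; rewrite scalerA mulVf ?scale1r//.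
by rewrite gt_eqF.
Qed.

(** The convergence is strong in M, so the normalization M = 1 survives and the limit cannot
    vanish. *)
Lemma normalized_limit (w_ : nat -> X) (rho : R) :
  (forall n, W (w_ n)) -> (forall n, M (w_ n) = 1) ->
  (forall n, N (w_ n) < rho + harmonic n) ->
  exists (k : nat -> nat) (w : X), [/\ forall n, (n <= k n)%N, W w, M w = 1,
    N w <= rho & forall e : R, 0 < e -> exists n0, forall n, (n0 <= n)%N ->
      M (w_ (k n) - w) < e].
Proof.
move=> Ww Mw Nw.
have [] := @cpt w_ (rho + 1).
  move=> n; split => //; apply: ltW; apply: (lt_le_trans (Nw n)).
  by rewrite lerD2l invf_le1// ler1n.
move=> k [w [kn Ww' Mlim lsc]]; exists k, w; split => //.
- apply/eqP; rewrite eq_le; apply/andP; split; apply/ler_addgt0Pr => e /Mlim[n0].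
    move=> /(_ _ (leqnn n0)); have := MB Ww' (Ww (k n0)); rewrite Mw MBC//; lra.
  move=> /(_ _ (leqnn n0)); have := MB (Ww (k n0)) Ww'; rewrite Mw//; lra.
- apply/ler_addgt0Pr => e e0; rewrite -[w]subr0; apply: lsc => //.
  have [n0 _ Hn0] := cvgr_lt _ (@cvg_harmonic R) _ e0.
  exists n0 => n n0n; rewrite subr0; apply: ltW; apply: (lt_trans (Nw _)).
  by rewrite ltrD2l; apply: Hn0; exact: leq_trans (kn n).
Qed.

(** By compactness: otherwise a normalized sequence in the kernel of Q with N tending to r1 would
    converge to a minimizer in that kernel, contrary to [Q_sep]. *)
Lemma sign_gap : exists2 r0, r1 < r0 & forall u, cone r0 u -> Q u <> 0.
Proof.
apply: contrapT => Hno.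
have /choice[u_ Hu] n : exists u, cone (r1 + harmonic n) u /\ Q u = 0.
  apply: contrapT => Hn; apply: Hno; exists (r1 + harmonic n).
    by rewrite ltrDl invr_gt0.
  by move=> u Cu Qu; apply: Hn; exists u.
have rn n : 0 <= r1 + harmonic n by rewrite addr_ge0// invr_ge0.
have Mu n := cone_pos (rn n) (Hu n).1.
pose w_ n := (M (u_ n))^-1 *: u_ n.
have Wu n := (Hu n).1.1.
have Mi n : 0 < (M (u_ n))^-1 by rewrite invr_gt0.
have Ww n : W (w_ n) by exact: WZ.
have Mw n : M (w_ n) = 1.
  by rewrite /w_ MZ// gtr0_norm// mulVf// gt_eqF.
have Nw n : N (w_ n) < r1 + harmonic n.
  by have [_] := cone_scale (Mi n) (Hu n).1; rewrite -/(w_ n) Mw mulr1.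
have [k [w [kn Ww' Mw' Nw' Mlim]]] := normalized_limit Ww Mw Nw.
have Mpos : 0 < M w by rewrite Mw'.
apply: (Q_sep Ww' Mpos); first by rewrite Mw' mulr1.
apply/eqP; rewrite -normr_le0; apply/ler_addgt0Pr => e e0; rewrite add0r.
have C1 : 0 < CQ + 1 by rewrite ltr_wpDl.
have [n0 /(_ _ (leqnn n0))] := Mlim _ (divr_gt0 e0 C1).
rewrite ltr_pdivlMr// MBC// => He.
have := Q_bound (WB Ww' (Ww (k n0))); rewrite QB// /w_ QZ// (Hu _).2 mulr0 subr0.
by have := M_ge0 (w - w_ (k n0)); rewrite /w_; lra.
Qed.

Section splitting.
Variable r0 : R.
Hypothesis r10 : r1 < r0.
Hypothesis Q_gap : forall u, cone r0 u -> Q u <> 0.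

Let r0_gt0 : 0 < r0. Proof. exact: le_lt_trans r1_ge0 r10. Qed.

(** Q has no zero on the cone, which contains the segment from u to a positive multiple of S u. *)
Lemma sign_S sg u : cone r0 u -> 0 < sg * Q u ->
  cone r0 (S u) /\ 0 < sg * Q (S u).
Proof.
move=> Cu su; split; first exact: cone_S.
have sg0 : sg != 0 by apply: contraTneq su => ->; rewrite mul0r ltxx.
have [c c0 Hc] := S_seg r0_gt0 Cu.
have Wcs : W (c *: S u) by exact/WZ/WS/Cu.1.
have : [set x | 0 < sg * Q x] (c *: S u).
  apply: (seg_connected Cu.1 Wcs (@opn_sign sg) (@opn_sign (- sg))) => //.
    by move=> x _ /=; lra.
  move=> t /Hc/Q_gap Qt /=; have [| |/eqP] := ltrgtP 0 (sg * Q (seg t u (c *: S u))).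
  - by left.
  - by right; lra.
  - by rewrite eq_sym mulf_eq0 (negbTE sg0) => /eqP.
by rewrite /= QZ; [rewrite mulrCA pmulr_rgt0|apply: WS; exact: Cu.1].
Qed.

(* S decreases the Rayleigh quotient and, on [cone r0], preserves the sign of Q. *)
Definition basin sg : set X :=
  [set u | exists n, cone r0 (iter n S u) /\ 0 < sg * Q (iter n S u)].

Lemma opn_basin sg : opn (basin sg).
Proof.
apply: opn_exists => n; have cS := cts_iter n (cts_iterate ler01 hz).
apply: (@opn_preimage (iter n S) (cone r0 `&` [set u | 0 < sg * Q u]) cS).
by apply: opnI; [exact/opn_cone/ltW|exact: opn_sign].
Qed.

(** Inside [cone r0] the sign is permanent, so two entrance times can be compared at the later
    one. *)
Lemma basin_disj u : basin 1 u -> basin (-1) u -> False.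
Proof.
have mono sg n m : (n <= m)%N -> cone r0 (iter n S u) ->
    0 < sg * Q (iter n S u) -> 0 < sg * Q (iter m S u).
  move=> /subnK <- Cu su; suff : cone r0 (iter (m - n + n) S u) /\
    0 < sg * Q (iter (m - n + n) S u) by case.
  by elim: (m - n)%N => [//|j [IH1 IH2]]; rewrite addSn iterS; exact: sign_S.
move=> [n [Cn sn]] [m [Cm sm]].
have := mono _ _ _ (leq_maxl n m) Cn sn; have := mono _ _ _ (leq_maxr n m) Cm sm.
lra.
Qed.

(** If the orbit never enters [cone r0], the quotients N / M along it have an infimum [rho] in [r0,
    r2[. Normalized iterates with quotients tending to [rho] have a limit, which is shown to be an
    eigenfunction for rho^p, against [nores]. *)
Lemma basin_cover u : cone r2 u -> basin 1 u \/ basin (-1) u.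
Proof.
move=> Cu; have [r2p|r2n] := ltP 0 r2; last first.
  by case: Cu => _; have := N_ge0 u; have := M_ge0 u; nra.
suff [n Cn] : exists n, cone r0 (iter n S u).
  have [Qp|Qn|/esym/(Q_gap Cn)//] := ltrgtP 0 (Q (iter n S u)).
    by left; exists n; split => //; lra.
  by right; exists n; split => //; lra.
apply: contrapT => Hno.
have C2 n : cone r2 (iter n S u).
  by elim: n => [//|n IH]; rewrite iterS; exact: cone_S.
have Wn n := (C2 n).1.
have Mn n : 0 < M (iter n S u) := cone_pos (ltW r2p) (C2 n).
pose q n := N (iter n S u) / M (iter n S u).
have qge n : r0 <= q n.
  rewrite ler_pdivlMr// leNgt; apply/negP => Hn; apply: Hno.
  by exists n; split.
have qlt n : q n < r2 by rewrite ltr_pdivrMr//; exact: (C2 n).2.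
have hi : has_inf (range q).
  by split; [exists (q 0%N); exists 0%N|exists r0 => _ [n _ <-]].
pose rho := inf (range q).
have rho0 : r0 <= rho by apply: lb_le_inf; [exact: hi.1|move=> _ [n _ <-]].
have rhoq n : rho <= q n by apply: ge_inf; [exact: hi.2|exists n].
have rho2 : rho < r2 by apply: le_lt_trans (rhoq 0%N) (qlt 0%N).
have rhop : 0 < rho by exact: lt_le_trans rho0.
have /choice[j Hj] n : exists j, q j < rho + harmonic n.
  have n0 : 0 < harmonic n :> R by rewrite invr_gt0.
  by have [_ [m _ <-] Hm] := inf_adherent n0 hi; exists m.
(* The same factor normalizes the iterate and rescales its image, so that [z_ n] is still the image
   of [w_ n]. *)
pose c n := (M (iter (j n) S u))^-1.
have c0 n : 0 < c n by rewrite invr_gt0.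
pose w_ n := c n *: iter (j n) S u.
pose z_ n := c n *: iter (j n).+1 S u.
have Ww n : W (w_ n) by exact: WZ.
have Mw n : M (w_ n) = 1 by rewrite /w_ MZ// gtr0_norm// mulVf// gt_eqF.
have Nw n : N (w_ n) < rho + harmonic n.
  by rewrite /w_ NZ// gtr0_norm// mulrC; exact: Hj.
have Az n : argmin (fun v => 1 * b (w_ n) v + 0 * 0) (z_ n).
  have [L hL] := blf_b1 (Wn (j n)).
  apply: argmin_ext (argmin_scale hL (SP (Wn (j n))) (c0 n)) => v Wv.
  by rewrite mulr0 addr0 mul1r bZ.
have [k [w [kn Ww' Mw' Nw' Mlim]]] := normalized_limit Ww Mw Nw.
have Asw := SP Ww'.
(* Otherwise, by continuity of the solution in its datum, some [z_] would lie in this open cone as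
   well, with a quotient below the infimum. *)
have nC : ~ cone rho (S w).
  move=> Csw; have [e e0 He] := opn_cone (ltW rhop) (WS Ww') Csw.
  have Asw' : argmin (fun v => 1 * b w v + 0 * 0) (S w).
    by apply: argmin_ext Asw => v _; rewrite mulr0 addr0 mul1r.
  have [d d0 Hd] := argmin_b_cont ler01 hz Ww' Asw' e0.
  have [n0 /(_ _ (leqnn n0)) Hn0] := Mlim _ d0.
  have : cone rho (z_ (k n0)).
    apply: He; first exact: (Az _).1.
    by apply: (Hd (w_ (k n0)) 0) => //; rewrite subrr normr0.
  rewrite /z_ => -[_]; rewrite NZ// MZ// gtr0_norm// mulrCA ltr_pM2l//.
  by have := rhoq (j (k n0)).+1; rewrite ler_pdivlMr// leNgt => /negbTE ->.
have [c' c'0 [Wv Av]] := argmin_b_scale rhop Ww' Asw.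
apply: (@nores rho w); [by rewrite rho2 andbT; exact: lt_le_trans rho0|by rewrite Mw'|].
(* At level [rho] the image of w has energy at least 0 and w has energy at most 0. By the majorant
   inequality w is then also a minimizer. *)
have E1 : 0 <= energy (rho `^ p) (fun=> 0) (c' *: S w).
  rewrite leNgt energy0_lt0 ?ltW//; apply/negP => H; apply: nC.
  have : cone rho (c' *: S w) by [].
  have ci : 0 < c'^-1 by rewrite invr_gt0.
  by move=> /(cone_scale ci); rewrite scalerA mulVf ?scale1r// gt_eqF.
have E2 : energy (rho `^ p) (fun=> 0) w <= 0.
  rewrite /energy Mw' powR1 mulr1 subr0 subr_le0.
  exact: powR_le.
split => // v Wv'; have := Av _ Wv'; rewrite !addr0.
have := energy_majorant (fun=> 0) (powR_ge0 rho p) Ww' Wv.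
lra.
Qed.

End splitting.

(** Compactness makes the data converge in M, hence the solutions [z_] converge in N to some z.
    Vanishing defects bring [w_] to the same z, so z and the M-limit of the data are at M-distance 0
    and z solves the equation with itself as datum. *)
Lemma argmin_limit kappa sigma h L B (w_ z_ : nat -> X) (sigma_ : nat -> R) :
  0 <= kappa -> blf L h -> (forall n, W (w_ n) /\ N (w_ n) <= B) ->
  (forall n, argmin (fun v => kappa * b (w_ n) v + sigma_ n * h v) (z_ n)) ->
  (forall e : R, 0 < e -> exists n0, forall n, (n0 <= n)%N ->
     `|sigma_ n - sigma| < e) ->
  (forall e : R, 0 < e -> exists n0, forall n, (n0 <= n)%N ->
     D (w_ n) (z_ n) < e) ->
  exists2 z, argmin (fun v => kappa * b z v + sigma * h v) z &
    forall e : R, 0 < e -> exists n, N (w_ n - z) < e.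
Proof.
move=> k0 hh Ww Az Hs HD.
have [k [w [kn Ww' Mlim _]]] := cpt Ww.
have [L' hl] := blf_b sigma k0 hh Ww'; have [z Azw] := argmin_exists hl.
have Wz := Azw.1; have Wk n := (Ww n).1; have Wzk n := (Az n).1.
have zlim (e : R) : 0 < e -> exists n0, forall n, (n0 <= n)%N ->
    N (z_ (k n) - z) < e.
  move=> /(argmin_b_cont k0 hh Ww' Azw)[d d0 Hd].
  have [n1 Hn1] := Mlim _ d0; have [n2 Hn2] := Hs _ d0.
  exists (maxn n1 n2) => n; rewrite geq_max => /andP[n1n n2n].
  apply: (Hd (w_ (k n)) (sigma_ (k n))) => //; first exact: Hn1.
  by apply: Hn2; exact: leq_trans (kn n).
have [nb Hnb] := zlim _ ltr01.
pose B' := Num.max B (N z + 1).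
have B'0 : 0 <= B' by rewrite le_max; apply/orP; right; exact: addr_ge0.
have wlim (e : R) : 0 < e -> exists n0, forall n, (n0 <= n)%N ->
    N (w_ (k n) - z) < e.
  move=> e0; have e2 : 0 < e / 2 by rewrite divr_gt0.
  have [d d0 Hd] := UC_small B'0 e2.
  have [n1 Hn1] := zlim _ e2; have [n2 Hn2] := HD _ d0.
  exists (maxn nb (maxn n1 n2)) => n; rewrite !geq_max => /and3P[nbn n1n n2n].
  have := Hn1 _ n1n; have : N (w_ (k n) - z_ (k n)) < e / 2.
    apply: Hd => //; last by apply: Hn2; exact: leq_trans (kn n).
      by rewrite le_max (Ww _).2.
    rewrite le_max; apply/orP; right.
    by have := NB (Wzk (k n)) Wz; have := Hnb _ nbn; lra.
  have := ND (WB (Wk (k n)) (Wzk (k n))) (WB (Wzk (k n)) Wz).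
  by rewrite addrA subrK; lra.
have Mz : M (z - w) = 0.
  apply/eqP; rewrite eq_le M_ge0 andbT; apply/ler_addgt0Pr => e e0.
  have C1 : 0 < Cp + 1 by rewrite ltr_wpDl.
  have e2 : 0 < e / 2 by rewrite divr_gt0.
  have e2C : 0 < e / 2 / (Cp + 1) by rewrite divr_gt0.
  have [n1 Hn1] := Mlim _ e2; have [n2 Hn2] := wlim _ e2C.
  have := Hn1 _ (leq_maxl n1 n2); have := Hn2 _ (leq_maxr n1 n2).
  set v := w_ _; have Wv : W v by exact: Wk.
  rewrite ltr_pdivlMr//; have := MN (WB Wv Wz); rewrite (MBC Wv Wz).
  have := MD (WB Wz Wv) (WB Wv Ww'); rewrite addrA subrK.
  have := N_ge0 (v - z); lra.
exists z; last first.
  by move=> e /wlim[n0 /(_ _ (leqnn n0))]; exists (k n0).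
apply: argmin_ext Azw => v Wv; congr (_ * _ + _).
apply/esym/eqP; rewrite -subr_eq0 -normr_le0; apply/ler_addgt0Pr => e e0.
have M1 : 0 < M v + 1 by rewrite ltr_wpDl.
have [d d0 Hd] := b_cont Ww' (divr_gt0 e0 M1).
have := Hd _ _ Wz Wv; rewrite Mz => /(_ d0) /le_trans; apply.
rewrite add0r -mulrA ger_pMr// ler_pdivrMl//; lra.
Qed.

(** Off the cone M^p is at most N^p / r2^p, so a fraction [eta] of N^p survives in the energy and
    absorbs h: there the energy is bounded below. *)
Lemma energy_far_from_cone rl h L : 0 <= rl -> rl < r2 -> blf L h ->
  exists c, forall u, W u -> energy (rl `^ p) h u < c -> cone r2 u.
Proof.
move=> rl0 rl2 hh; have [L0 hlin hb] := hh.
have r2p : 0 < r2 by lra.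
pose eta := 1 - rl `^ p / r2 `^ p.
have r2pp : 0 < r2 `^ p by exact: powR_gt0.
have eta0 : 0 < eta by rewrite subr_gt0 ltr_pdivrMr// mul1r powR_lt.
have [c Hc] := powR_superlinear p1 L0 eta0.
exists (- c) => u Wu; apply: contraPP => nC; apply/negP; rewrite -leNgt.
have : r2 * M u <= N u by rewrite leNgt; apply/negP => ?; apply: nC; split.
move=> /(powR_le p1 (mulr_ge0 (ltW r2p) (M_ge0 u))).
rewrite powRM ?(ltW r2p)// mulrC -ler_pdivlMr// => H.
have H2 : rl `^ p * M u `^ p <= (1 - eta) * g u.
  have := ler_wpM2l (powR_ge0 rl p) H; rewrite /eta.
  by rewrite mulrCA; lra.
have := Hc _ (N_ge0 u); have := hb _ Wu; rewrite ler_norml /energy; lra.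
Qed.

Lemma energy_ray rl h L u c : blf L h -> cone rl u -> 0 <= rl -> exists2 t : R, 0 < t &
  energy (rl `^ p) h (t *: u) < c /\ energy (rl `^ p) h (- t *: u) < c.
Proof.
move=> hh [Wu Hu] rl0; pose A := rl `^ p * M u `^ p - g u.
have A0 : 0 < A by rewrite subr_gt0 -powRM// powR_lt.
have A2 : 0 < A / 2 by rewrite divr_gt0.
have [c' Hc'] := powR_superlinear p1 (normr_ge0 (h u)) A2.
(* y is the value of t^p. Half of -A y absorbs the linear term up to c', the other half brings the
   sum below c. *)
pose y := (`|c' - c| + 1) / (A / 2).
have y0 : 0 < y by rewrite divr_gt0// ltr_wpDl.
pose t := y `^ p^-1; have t0 : 0 < t by exact: powR_gt0.
exists t => //.
have tp : t `^ p = y by rewrite powR_invK// ltW.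
have yE : A / 2 * y = `|c' - c| + 1 by rewrite /y; field; lra.
have := Hc' _ (ltW t0); rewrite tp.
have := ler_norm (c' - c); have := ler_norm (h u); have := ler_norm (- h u).
rewrite normrN => h1 h2 h3 h4.
have h5 := ler_wpM2r (ltW t0) h1; have h6 := ler_wpM2r (ltW t0) h2.
have AE : A * y = y * (rl `^ p * M u `^ p) - y * g u by rewrite /A; ring.
rewrite /energy !NZ// !MZ// normrN (gtr0_norm t0) !powRM ?(ltW t0)// tp.
rewrite !(blfZ _ hh)//; clearbody t y A; split; lra.
Qed.

Theorem dc_fixed_point rl h L : r1 < rl < r2 -> blf L h ->
  exists u, argmin (fun v => rl `^ p * b u v + h v) u.
Proof.
move=> /andP[rl1 rl2] hh.
have rl0 : 0 <= rl := le_trans r1_ge0 (ltW rl1).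
have k0 : 0 <= rl `^ p by exact: powR_ge0.
have [L0 hlin hb] := hh.
have [r0 r10 Q_gap] := sign_gap.
have [c Hc] := energy_far_from_cone rl0 rl2 hh.
(* Below r0 the sign of Q is defined; below rl the energy tends to -oo along the ray through the
   point. *)
have rm1 : r1 < Num.min r0 rl by rewrite lt_min r10.
have [phi [C0 Cl Qphi]] : exists u, [/\ cone r0 u, cone rl u & 0 < Q u].
  have [u Wu Hu] := r1_near rm1.
  have C0 : cone r0 u.
    by split => //; apply: (lt_le_trans Hu); rewrite ler_wpM2r// ge_min lexx.
  have Cl : cone rl u.
    by split => //; apply: (lt_le_trans Hu); rewrite ler_wpM2r// ge_min lexx orbT.
  have [Qp|Qn|/esym/(Q_gap _ C0)//] := ltrgtP 0 (Q u); first by exists u.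
  have WNu : W (- u) by rewrite -scaleN1r; exact: WZ.
  exists (- u); split; rewrite /cone /= ?NN ?MN1//.
  - by split => //; exact: C0.2.
  - by split => //; exact: Cl.2.
  - by rewrite -scaleN1r QZ//; lra.
have Wphi := C0.1.
have [t t0 [Jt JNt]] := energy_ray c hh Cl rl0.
pose T := iterate (rl `^ p) h; pose J := energy (rl `^ p) h.
have cT : cts T by exact: (cts_iterate k0 hh).
have TP u : W u -> argmin (fun v => rl `^ p * b u v + h v) (T u).
  exact: (iterateP k0 hh).
have Titer n u : W u -> W (iter n T u) by exact: (W_iter_iterate k0 hh n).
have oV sg : opn ([set u | J u < c] `&` basin r0 sg).
  by apply: opnI; [exact: (opn_energy_lt k0 hh)|exact: (opn_basin r10)].
(* Each condition is open since the iterates of T are continuous, and by [Vinv] it persists once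
   satisfied. *)
pose U sg := [set u | exists n, ([set u | J u < c] `&` basin r0 sg) (iter n T u)].
have oU sg : opn (U sg).
  by apply: opn_exists => n; apply: (opn_preimage (cts_iter n cT) (oV sg)).
(* The energy stays below c on [u, T u], so this segment lies in [cone r2], which the basins
   cover. *)
have segV u : W u -> J u < c -> forall s : R, 0 <= s <= 1 ->
    basin r0 1 (seg s u (T u)) \/ basin r0 (-1) (seg s u (T u)).
  move=> Wu Ju s s01; apply: (basin_cover r10 Q_gap); apply: Hc.
    by apply: W_seg => //; exact: (TP _ Wu).1.
  by apply: le_lt_trans Ju; apply: (energy_seg k0 hh Wu (TP _ Wu)).
have JT u : W u -> J (T u) <= J u.
  move=> Wu; have := energy_seg k0 hh Wu (TP _ Wu) (t := 1).
  by rewrite seg1; apply; rewrite ler01 lexx.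
have Vinv sg u : sg = 1 \/ sg = -1 -> W u -> J u < c -> basin r0 sg u ->
    J (T u) < c /\ basin r0 sg (T u).
  move=> sgE Wu Ju Bu; split; first exact: le_lt_trans (JT _ Wu) Ju.
  have WT := (TP _ Wu).1.
  have oB1 := @opn_basin _ r10 1; have oB2 := @opn_basin _ r10 (-1).
  case: sgE Bu => -> Bu.
    apply: (seg_connected Wu WT oB1 oB2 _ (segV _ Wu Ju) Bu).
    by move=> x _; exact: (basin_disj r10 Q_gap).
  apply: (seg_connected Wu WT oB2 oB1 _ _ Bu).
    by move=> x _ ? ?; exact: (basin_disj r10 Q_gap (u := x)).
  by move=> s /(segV _ Wu Ju)[]; [right|left].
have Umono sg u n m : sg = 1 \/ sg = -1 -> W u -> (n <= m)%N ->
    ([set u | J u < c] `&` basin r0 sg) (iter n T u) ->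
    basin r0 sg (iter m T u).
  move=> sgE Wu /subnK <- [Ju Bu].
  suff : J (iter (m - n + n) T u) < c /\ basin r0 sg (iter (m - n + n) T u) by case.
  elim: (m - n)%N => [//|j [IH1 IH2]]; rewrite addSn iterS.
  by apply: Vinv => //; exact: Titer.
have dU u : W u -> U 1 u -> U (-1) u -> False.
  move=> Wu [n Vn] [m Vm]; apply: (@basin_disj r0 r10 Q_gap (iter (maxn n m) T u)).
    by apply: Umono Vn; [left|exact: Wu|exact: leq_maxl].
  by apply: Umono Vm; [right|exact: Wu|exact: leq_maxr].
have Wtp : W (t *: phi) by exact: WZ.
have Wtn : W (- t *: phi) by exact: WZ.
have U1 : U 1 (t *: phi).
  exists 0%N; split => //; exists 0%N; split; first exact: cone_scale.
  by rewrite /= QZ// mul1r mulr_gt0.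
have UN1 : U (-1) (- t *: phi).
  exists 0%N; split => //; exists 0%N; split.
    have := cone_scale t0 C0; rewrite /cone /= scaleNr => -[_].
    by rewrite NN// MN1// => ?; split => //; rewrite -scaleNr.
  by rewrite /= QZ//; have := mulr_gt0 t0 Qphi; lra.
have [s _ [nU nUN]] :=
  seg_not_disconnected Wtp Wtn (oU 1) (oU (-1)) dU U1 UN1.
pose u0 := seg s (t *: phi) (- t *: phi).
have Wu0 : W u0 by exact: W_seg.
pose u_ n := iter n T u0.
have Wu n : W (u_ n) by exact: Titer.
(* Below c an iterate would belong to a basin, and [u0] to one of the sets U. *)
have Jge n : c <= J (u_ n).
  rewrite leNgt; apply/negP => Jn.
  by have [Bn|Bn] := basin_cover r10 Q_gap (Hc _ (Wu n) Jn);
    [apply: nU; exists n|apply: nUN; exists n].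
have Jdec n m : (n <= m)%N -> J (u_ m) <= J (u_ n).
  move=> /subnK <-; elim: (m - n)%N => [//|j IH].
  by rewrite addSn; apply: le_trans IH; exact: JT.
have DJ n : 2 * D (u_ n) (u_ n.+1) <= J (u_ n) - J (u_ n.+1).
  exact: (argmin_energy_D k0 hh (Wu n) (TP _ (Wu n))).
have [[B HB]|unb] := pselect (exists B, forall n, N (u_ n) <= B).
  have [| | | |z Az _] := @argmin_limit (rl `^ p) 1 h L B u_ (fun n => u_ n.+1)
      (fun=> 1) k0 hh.
  - by move=> n; split.
  - by move=> n; under eq_fun do rewrite mul1r; exact: TP.
  - by move=> e e0; exists 0%N => n _; rewrite subrr normr0.
  - move=> e e0; have hi : has_inf (range (J \o u_)).
      by split; [exists (J (u_ 0%N)); exists 0%N|exists c => _ [n _ <-]; exact: Jge].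
    have [_ [n0 _ <-] Hn0] := inf_adherent e0 hi.
    exists n0 => n n0n; have := Jdec _ _ n0n; have := DJ n.
    have : inf (range (J \o u_)) <= J (u_ n.+1).
      by apply: ge_inf; [exact: hi.2|exists n.+1].
    move: Hn0; rewrite /=; lra.
  - by exists z; move: Az; under eq_fun do rewrite mul1r.
(* The unbounded case: iterates of large norm are divided by it, and their images by the same
   number. *)
have /choice[j Hj] n : exists j, n.+1%:R < N (u_ j).
  apply: contrapT => Hn; apply: unb; exists n.+1%:R => j; rewrite leNgt.
  by apply/negP => Hj; apply: Hn; exists j.
pose nu n := (N (u_ (j n)))^-1.
have Nj n : 0 < N (u_ (j n)) by apply: lt_trans (Hj n).
have nu0 n : 0 < nu n by rewrite invr_gt0.
have nuh n : nu n < harmonic n by rewrite /nu /harmonic ltf_pV2 ?posrE.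
pose w_ n := nu n *: u_ (j n); pose z_ n := nu n *: u_ (j n).+1.
have NW n : N (w_ n) = 1 by rewrite /w_ NZ// gtr0_norm// mulVf// gt_eqF.
have [| | | |z Az zlim] := @argmin_limit (rl `^ p) 0 h L 1 w_ z_
    (fun n => nu n `^ (p - 1)) k0 hh.
- by move=> n; split; [exact: WZ|rewrite NW].
- move=> n; have [L' hL] := blf_b 1 k0 hh (Wu (j n)).
  have : argmin (fun v => rl `^ p * b (u_ (j n)) v + 1 * h v) (u_ (j n).+1).
    by under eq_fun do rewrite mul1r; exact: TP.
  move=> /(argmin_scale hL)/(_ (nu0 n)); apply: argmin_ext => v Wv.
  by rewrite bZ//; ring.
- move=> e e0; have pp : 0 < p - 1 by rewrite subr_gt0.
  have e1 : 0 < e `^ (p - 1)^-1 by exact: powR_gt0.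
  have [n0 _ Hn0] := cvgr_lt _ (@cvg_harmonic R) _ e1.
  exists n0 => n n0n; rewrite subr0 ger0_norm ?powR_ge0//.
  have -> : e = (e `^ (p - 1)^-1) `^ (p - 1).
    by rewrite -powRrM mulVf ?gt_eqF// powRr1// ltW.
  apply: gt0_ltr_powR; rewrite ?nnegrE ?powR_ge0// ?ltW//.
  by apply: (lt_trans (nuh n)); exact: Hn0.
- move=> e e0; pose A := J (u_ 0%N) - c + 1.
  have A0 : 0 < A by have := Jge 0%N; rewrite /A; lra.
  have [n0 _ Hn0] := cvgr_lt _ (@cvg_harmonic R) _ (divr_gt0 e0 A0).
  exists n0 => n n0n.
  (* D is homogeneous of degree p, while unscaled defects are bounded by the total drop of the
     energy. *)
  have -> : D (w_ n) (z_ n) = nu n `^ p * D (u_ (j n)) (u_ (j n).+1).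
    have -> : 2^-1 *: (w_ n + z_ n) =
        nu n *: (2^-1 *: (u_ (j n) + u_ (j n).+1)).
      by rewrite /w_ /z_ -scalerDr !scalerA mulrC.
    rewrite (NZ (nu n) (Wmid _ _))// /w_ /z_ !(NZ (nu n))//.
    by rewrite gtr0_norm// !powRM ?(ltW (nu0 n))//; ring.
  have DA : D (u_ (j n)) (u_ (j n).+1) < A.
    have := DJ (j n); have := Jdec _ _ (leq0n (j n)); have := Jge (j n).+1.
    have := Jge 0%N; rewrite /A; lra.
  have nu1 : nu n `^ p <= nu n.
    apply: ge1r_powR; last exact: ltW.
    by rewrite nu0 ltW// (lt_le_trans (nuh n))// invf_le1// ler1n.
  have HA : harmonic n * A < e by rewrite -ltr_pdivlMr//; exact: Hn0.
  have := nuh n; have := nu0 n; have := powR_ge0 (nu n) p.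
  set d := D _ _ in DA *; move=> a1 a2 a3.
  have [dn|dp] := ltP d 0; first by apply: le_lt_trans e0; nra.
  have : nu n `^ p * d <= nu n * A by rewrite ler_pM// ltW.
  by move=> /le_lt_trans; apply; apply: lt_trans HA; rewrite ltr_pM2r.
exfalso; have [|n Hn] := zlim 2^-1; first by rewrite invr_gt0.
have Wz := Az.1.
have Nz : 0 < N z.
  have Wwn : W (w_ n) by exact: WZ.
  by have := NB Wwn Wz; rewrite NW; move: Hn; lra.
apply: (@nores rl z); first by rewrite rl1.
(* If M z = 0 then b z z = 0, and comparison of z with 0 forces N z = 0. *)
- rewrite lt_neqAle M_ge0 andbT; apply/eqP => Mz.
  have := Az.2 _ W0; rewrite bM// -Mz powR0 ?gt_eqF//.
  have [L' hL] := blf_b 0 k0 hh Wz; rewrite (blf0 hL) g0.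
  by have := powR_gt0 p Nz; lra.
- by apply: argmin_ext Az => v _; rewrite mul0r addr0.
Qed.

End minimax.

End dc_iteration.

(** * Lebesgue spaces *)

Section pointwise.
Context {R : realType}.
Variable p : R.
Hypothesis p1 : 1 < p.
Implicit Types a x y t : R.

Let p0 : 0 < p. Proof. exact: lt_trans p1. Qed.
Let pp : 0 < p - 1. Proof. by rewrite subr_gt0. Qed.

(** Strict weighted arithmetic-geometric inequality for x^p and 1 with weights 1/p and 1 - 1/p. With
    mean m the claim is x < m; the logarithm lies strictly below its tangent at m, and the tangent
    terms cancel. *)
Lemma powR_bernoulli_lt x : 0 < x -> x != 1 -> 1 + p * (x - 1) < x `^ p.
Proof.
move=> x0 x1; have [m0|m0] := leP (1 + p * (x - 1)) 0.
  by apply: (le_lt_trans m0); exact: powR_gt0.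
pose m := 1 + p^-1 * (x `^ p - 1).
suff : x < m.
  by rewrite /m -ltrBlDl ltr_pdivlMl//; lra.
have m_gt0 : 0 < m.
  have := mulr_gt0 (eqbRL (invr_gt0 p) p0) (powR_gt0 p x0).
  have : p^-1 < 1 by rewrite invf_lt1.
  by rewrite /m; lra.
rewrite -ltr_ln ?posrE//.
have lnD u : 0 < u -> u != m -> ln u - ln m < u / m - 1.
  move=> u0 um; rewrite -ln_div ?posrE//.
  have um0 : 0 < u / m by exact: divr_gt0.
  have : ln (u / m) != 0.
    apply: contra um; rewrite ln_eq0// -subr_eq0 => /eqP H; apply/eqP; move: H => /eqP.
    by rewrite subr_eq0 => /eqP /(congr1 (fun z => z * m)); rewrite mulfVK ?gt_eqF// mul1r.
  by move=> /expR_gt1Dx; rewrite lnK ?posrE//; lra.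
have xp1 : x `^ p != 1.
  by rewrite powR_eq1 (negbTE x1)/= ltNge (ltW x0)/= gt_eqF.
have xpm : x `^ p != m.
  apply: contra xp1 => /eqP H; apply/eqP.
  have : (x `^ p - 1) * (1 - p^-1) = 0 by move: H; rewrite /m; lra.
  move=> /eqP; rewrite mulf_eq0 => /orP[/eqP|/eqP]; first by lra.
  by have : p^-1 < 1 by [rewrite invf_lt1]; lra.
have m1 : 1 != m.
  apply: contra xp1 => /eqP H; apply/eqP.
  have : p^-1 * (x `^ p - 1) = 0 by move: H; rewrite /m; lra.
  move=> /eqP; rewrite mulf_eq0 invr_eq0 gt_eqF//= => /eqP; lra.
have H1 := lnD _ (powR_gt0 p x0) xpm.
have H2 := lnD _ ltr01 m1.
have pi0 : 0 < p^-1 by rewrite invr_gt0.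
have pi1 : 0 < 1 - p^-1 by rewrite subr_gt0 invf_lt1.
have H3 : p^-1 * (ln (x `^ p) - ln m) < p^-1 * (x `^ p / m - 1).
  by rewrite ltr_pM2l.
have H4 : (1 - p^-1) * (ln 1 - ln m) < (1 - p^-1) * (1 / m - 1).
  by rewrite ltr_pM2l.
have : p^-1 * (x `^ p / m - 1) + (1 - p^-1) * (1 / m - 1) = 0.
  have -> : p^-1 * (x `^ p / m - 1) + (1 - p^-1) * (1 / m - 1) =
    (1 + p^-1 * (x `^ p - 1)) / m - 1 by ring.
  by rewrite -/m mulfV ?subrr// gt_eqF.
have : p^-1 * ln (x `^ p) = ln x by rewrite ln_powR mulrA mulVf ?mul1r// gt_eqF.
move: H3 H4; rewrite ln1; lra.
Qed.

Lemma powR_tangent_lt x y : 0 <= x -> 0 <= y -> x != y ->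
  x `^ p + p * (x `^ (p - 1) * (y - x)) < y `^ p.
Proof.
rewrite le_eqVlt => /predU1P[<-|x0] y0 xy.
  rewrite !powR0 ?gt_eqF// mul0r mulr0 addr0 powR_gt0//.
  by rewrite lt_neqAle xy.
have xpE : x * x `^ (p - 1) = x `^ p by rewrite mulr_powRB1// ltW.
have xp0 : 0 < x `^ p by exact: powR_gt0.
move: y0; rewrite le_eqVlt => /predU1P[<-|y0].
  rewrite powR0 ?gt_eqF//.
  have : 0 < (p - 1) * x `^ p by exact: mulr_gt0.
  rewrite -xpE; lra.
have r0 : 0 < y / x by exact: divr_gt0.
have r1 : y / x != 1.
  apply: contra xy => /eqP H; apply/eqP.
  by rewrite -[y](mulfVK (lt0r_neq0 x0)) H mul1r.
have := powR_bernoulli_lt r0 r1; rewrite -(ltr_pM2l xp0) -powRM ?ltW//.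
rewrite mulrCA mulfV ?gt_eqF// mulr1; apply: le_lt_trans.
rewrite -xpE le_eqVlt; apply/orP; left; apply/eqP; field; lra.
Qed.

Lemma norm_phi t : `|phi p t| = `|t| `^ (p - 1).
Proof.
rewrite /phi normrM norm_powR// normr_id.
have [->|t0] := eqVneq t 0; first by rewrite normr0 mulr0 powR0// gt_eqF.
rewrite -[X in _ * X]powRr1// -powRD; last by rewrite normr_eq0 t0 implybT.
by congr (_ `^ _); lra.
Qed.

Lemma phiM x y : phi p (x * y) = phi p x * phi p y.
Proof. by rewrite /phi normrM powRM//; ring. Qed.

Lemma phi_mul t : phi p t * t = `|t| `^ p.
Proof.
have [->|t0] := eqVneq t 0.
  by rewrite mulr0 normr0 powR0// gt_eqF.
rewrite /phi -mulrA -expr2 -real_normK ?num_real// expr2.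
rewrite -[X in _ * (X * X)]powRr1// -!powRD; last first.
- by rewrite normr_eq0 t0 implybT.
- by rewrite normr_eq0 t0 implybT.
by congr (_ `^ _); lra.
Qed.

Lemma powR_norm_tangent x y :
  `|x| `^ p + p * (phi p x * (y - x)) <= `|y| `^ p.
Proof.
have := powR_tangent p1 (normr_ge0 x) (normr_ge0 y).
have H1 : phi p x * y <= `|x| `^ (p - 1) * `|y|.
  by rewrite -norm_phi -normrM ler_norm.
have H2 : `|x| `^ (p - 1) * `|x| = `|x| `^ p.
  by rewrite mulrC mulr_powRB1.
have H3 : p * (`|x| `^ (p - 1) * `|x|) = p * (phi p x * x) by rewrite H2 phi_mul.
by have := ler_wpM2l (ltW p0) H1; lra.
Qed.

Lemma powR_midpoint_lt x y : x != y ->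
  `|(x + y) / 2| `^ p < (`|x| `^ p + `|y| `^ p) / 2.
Proof.
move=> xy; have [exy|nxy] := eqVneq `|x| `|y|.
  have yE : y = - x.
    by move: exy => /eqP; rewrite eqr_norm2 (negbTE xy)/= => /eqP ->; rewrite opprK.
  have x0 : x != 0 by apply: contraNneq xy; rewrite yE => ->; rewrite oppr0.
  rewrite yE subrr mul0r normr0 powR0 ?gt_eqF// normrN divr_gt0// addr_gt0//;
  by rewrite powR_gt0// normr_gt0.
pose m := (`|x| + `|y|) / 2.
have m0 : 0 <= m by rewrite divr_ge0// addr_ge0.
have mx : m != `|x|.
  by apply: contra nxy => /eqP H; apply/eqP; move: H; rewrite /m; lra.
have my : m != `|y|.
  by apply: contra nxy => /eqP H; apply/eqP; move: H; rewrite /m; lra.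
have H1 := powR_tangent_lt m0 (normr_ge0 x) mx.
have H2 := powR_tangent_lt m0 (normr_ge0 y) my.
have H3 : `|(x + y) / 2| `^ p <= m `^ p.
  apply: powR_le => //; rewrite /m normrM (@ger0_norm _ 2^-1) ?invr_ge0//.
  by have := ler_normD x y; lra.
have : p * (m `^ (p - 1) * (`|x| - m)) + p * (m `^ (p - 1) * (`|y| - m)) = 0.
  by rewrite /m; field.
lra.
Qed.

Lemma continuous_norm_powR : continuous (fun t => `|t| `^ p).
Proof.
move=> t; apply/cvgrPdist_lt => e e0.
have [d d0 Hd] := powR_continuous_at p1 (normr_ge0 t) e0.
near=> s; rewrite distrC; apply: Hd => //.
apply: (le_lt_trans (ler_dist_dist _ _)); rewrite distrC.
by near: s; exact: cvgr_dist_lt.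
Unshelve. all: by end_near. Qed.

(* By homogeneity it suffices to bound the gap (1 + |t|^p) / 2 - |(1 + t) / 2|^p
   from below on a compact part of [-1, 1] avoiding its only zero t = 1. *)
Lemma powR_uniform_convexity e : 0 < e -> exists2 C, 0 <= C & forall x y,
  `|x - y| `^ p <= e * (`|x| `^ p + `|y| `^ p) +
    C * ((`|x| `^ p + `|y| `^ p) / 2 - `|(x + y) / 2| `^ p).
Proof.
move=> e0; pose psi t := (1 + `|t| `^ p) / 2 - `|(1 + t) / 2| `^ p.
have psi_ge0 t : 0 <= psi t.
  have [<-|t1] := eqVneq 1 t.
    rewrite /psi normr1 powR1 (_ : (1 + 1) / 2 = 1) ?normr1 ?powR1 ?subrr//.
    by rewrite mulfV.
  by have := powR_midpoint_lt t1; rewrite normr1 powR1 /psi; lra.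
have cpsi : continuous psi.
  move=> t; apply: cvgB.
    by apply: cvgMl; apply: cvgD; [exact: cvg_cst|exact: continuous_norm_powR].
  apply: (@continuous_comp _ _ _ (fun t : R => (1 + t) / 2) (fun t => `|t| `^ p)).
    by apply: cvgMl; apply: cvgD; [exact: cvg_cst|exact: cvg_id].
  exact: continuous_norm_powR.
have [C C0 HC] : exists2 C, 0 <= C & forall t, -1 <= t <= 1 ->
    `|1 - t| `^ p <= e + C * psi t.
  pose d := e `^ p^-1.
  have d0 : 0 < d by exact: powR_gt0.
  have small t : -1 <= t <= 1 -> 1 - d <= t -> `|1 - t| `^ p <= e.
    move=> t1 dt; rewrite -[leRHS](powR_invK p1) ?(ltW e0)// powR_le//.
    by rewrite -/d ger0_norm; clearbody d; lra.
  have [d2|d2] := ltP (1 - d) (-1).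
    exists 0 => // t t1; rewrite mul0r addr0 small//; lra.
  have [t0 /[!in_itv]/= t0d Hmin] :
      exists2 c, c \in `[-1, 1 - d] & forall t, t \in `[-1, 1 - d] -> psi c <= psi t.
    by apply: EVT_min => //; exact: continuous_subspaceT.
  have m0 : 0 < psi t0.
    have t01 : 1 != t0 by apply/eqP; lra.
    by have := powR_midpoint_lt t01; rewrite normr1 powR1 /psi; lra.
  (* On [-1, 1 - d] the numerator bounds |1 - t|^p and psi is at least its minimum psi t0 > 0;
     closer to 1 the term e suffices. *)
  exists (2 `^ p / psi t0); first by rewrite divr_ge0 ?powR_ge0 ?ltW.
  move=> t t1; have [dt|td] := leP (1 - d) t.
    apply: (le_trans (small _ t1 dt)); rewrite lerDl mulr_ge0//.
    by rewrite divr_ge0 ?powR_ge0 ?ltW.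
  have : psi t0 <= psi t by apply: Hmin; rewrite in_itv/=; lra.
  move=> Ht; have : 2 `^ p <= 2 `^ p / psi t0 * psi t.
    by rewrite mulrAC ler_pdivlMr// ler_wpM2l// powR_ge0.
  have : `|1 - t| `^ p <= 2 `^ p by apply: powR_le; rewrite // ger0_norm; lra.
  lra.
exists C => //.
have main x y : `|y| <= `|x| -> `|x - y| `^ p <= e * (`|x| `^ p + `|y| `^ p) +
    C * ((`|x| `^ p + `|y| `^ p) / 2 - `|(x + y) / 2| `^ p).
  move=> yx; have [x0|x0] := eqVneq x 0.
    have -> : y = 0 by apply/eqP; rewrite -normr_le0 (le_trans yx)// x0 normr0.
    by rewrite x0 subrr addr0 mul0r normr0 powR0 ?gt_eqF//; lra.
  pose t := y / x; have yE : y = x * t by rewrite /t mulrCA mulfV ?mulr1.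
  have t1 : -1 <= t <= 1.
    by rewrite -ler_norml /t normrM normfV ler_pdivrMr ?normr_gt0// mul1r.
  clearbody t; have := HC _ t1.
  rewrite -(ler_pM2l (powR_gt0 p (eqbRL (normr_gt0 x) x0))).
  have -> : x - y = x * (1 - t) by rewrite yE; ring.
  have -> : (x + y) / 2 = x * ((1 + t) / 2) by rewrite yE; ring.
  rewrite [`|y|](_ : _ = `|x| * `|t|); last by rewrite yE normrM.
  rewrite !normrM !powRM// => H; apply: (le_trans H).
  have : 0 <= `|x| `^ p * (e * `|t| `^ p).
    by rewrite !mulr_ge0 ?powR_ge0 ?(ltW e0).
  rewrite /psi [X in _ - X `^ p]normrM [X in _ - X]powRM//; lra.
move=> x y; have [/main//|/ltW/main] := leP `|y| `|x|.
by rewrite distrC (addrC y) (addrC (`|y| `^ p)).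
Qed.

(** By homogeneity only t = y / x matters. Near t = 1 continuity of phi gives the e term; elsewhere
    |x| and |y| are both at most (1 + 1/d) |y - x|, which gives the C term. *)
Lemma phi_continuous_bound e : 0 < e -> exists2 C, 0 <= C & forall x y,
  `|phi p y - phi p x| <= e * `|x| `^ (p - 1) + C * `|y - x| `^ (p - 1).
Proof.
move=> e0.
have [d d0 Hd] : exists2 d, 0 < d & forall t, `|t - 1| < d -> `|phi p t - 1| <= e.
  have cphi : phi p t @[t --> (1 : R)] --> (1 : R).
    have E : \forall t \near (1 : R), t `^ (p - 1) = phi p t.
      near=> t; have t0 : 0 < t by near: t; exact: lt_nbhsr.
      rewrite /phi gtr0_norm// -[X in _ * X]powRr1 ?(ltW t0)//.
      by rewrite -powRD ?(gt_eqF t0) ?implybT//; congr (_ `^ _); lra.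
    have : t `^ (p - 1) @[t --> (1 : R)] --> (1 : R) `^ (p - 1).
      have : derivable (fun t => powR t (p - 1)) (1 : R) 1.
        by apply: derivable_powR; rewrite in_itv/= ltr01.
      by move=> /derivable1_diffP/differentiable_continuous.
    rewrite powR1; apply: cvg_trans; apply: near_eq_cvg.
    by near=> t; near: t.
  have /cvgrPdist_le/(_ _ e0) := cphi.
  move=> /nbhs_ballP[d /= d0 Hd]; exists d => // t td.
  by rewrite distrC; apply: Hd; rewrite /ball/= distrC.
have di : 0 < d^-1 by rewrite invr_gt0.
exists (2 * (1 + d^-1) `^ (p - 1)); first by rewrite mulr_ge0 ?powR_ge0.
move=> x y.
have far : `|x| <= d^-1 * `|y - x| ->
    `|phi p y - phi p x| <=
      e * `|x| `^ (p - 1) + 2 * (1 + d^-1) `^ (p - 1) * `|y - x| `^ (p - 1).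
  move=> xd; have yx0 := normr_ge0 (y - x).
  have yd : `|y| <= (1 + d^-1) * `|y - x|.
    by have := ler_normD (y - x) x; rewrite subrK; lra.
  have xd' : `|x| <= (1 + d^-1) * `|y - x| by lra.
  have H u : `|u| <= (1 + d^-1) * `|y - x| ->
      `|phi p u| <= (1 + d^-1) `^ (p - 1) * `|y - x| `^ (p - 1).
    move=> Hu; rewrite norm_phi -powRM//; last by lra.
    by apply: ge0_ler_powR; rewrite ?nnegrE//; [exact: ltW|apply: le_trans Hu].
  have := H _ yd; have := H _ xd'; have := ler_normB (phi p y) (phi p x).
  have : 0 <= e * `|x| `^ (p - 1) by rewrite mulr_ge0 ?powR_ge0 ?ltW.
  lra.
have [x0|x0] := eqVneq x 0.
  by apply: far; rewrite x0 normr0 mulr_ge0// ltW.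
pose t := y / x; have yE : y = x * t by rewrite /t mulrCA mulfV ?mulr1.
have yxE : `|y - x| = `|x| * `|t - 1| by rewrite yE -normrM mulrBr mulr1.
have [td|dt] := ltP `|t - 1| d; last first.
  by apply: far; rewrite yxE ler_pdivlMl// mulrC ler_wpM2l.
have -> : phi p y - phi p x = phi p x * (phi p t - 1).
  by rewrite yE phiM mulrBr mulr1.
rewrite normrM norm_phi; apply: ler_wpDr.
  by rewrite !mulr_ge0 ?powR_ge0.
by rewrite mulrC ler_wpM2r ?powR_ge0// Hd.
Unshelve. all: by end_near. Qed.

End pointwise.

(* No measurability is needed here: the integral of a nonnegative function is
   a supremum over the simple functions below it. *)
Lemma ge0_le_integral_pointwise d (T : measurableType d) (R : realType)
    (mu : {measure set T -> \bar R}) (f g : T -> \bar R) :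
  (forall x, 0 <= f x)%E -> (forall x, f x <= g x)%E ->
  (\int[mu]_x f x <= \int[mu]_x g x)%E.
Proof.
move=> f0 fg; have g0 x : (0 <= g x)%E by exact: le_trans (f0 x) (fg x).
rewrite !ge0_integralTE//; apply: ge_ereal_sup => _ [h hf <-].
by apply: ereal_sup_ubound; exists h => // x; exact: le_trans (hf x) (fg x).
Qed.

#[local] Opaque integral.

(** * Functions with finite p-mass *)

Section Lp_functions.
Context d {T : measurableType d} {R : realType}.
Variable mu : {measure set T -> \bar R}.
Variable p : R.
Hypothesis p1 : 1 < p.
Implicit Types g h : T -> R.

Let p0 : 0 < p. Proof. exact: lt_trans p1. Qed.
Let pn0 : p != 0. Proof. by rewrite gt_eqF. Qed.

Definition Lpf g := measurable_fun setT g /\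
  (\int[mu]_x (`|g x| `^ p)%:E < +oo)%E.

Definition pmass g : R := \int[mu]_x (`|g x| `^ p).

Definition pnorm g : R := pmass g `^ p^-1.

(** One p-th of the derivative of [pmass] at g in the direction h. *)
Definition pform g h : R := \int[mu]_x (phi p (g x) * h x).

Lemma measurable_norm_powR g (q : R) : measurable_fun setT g ->
  measurable_fun setT (fun x => `|g x| `^ q).
Proof.
move=> mg; apply: (@measurableT_comp _ _ _ _ _ _ (@powR R ^~ q)) => //.
exact: measurableT_comp.
Qed.

Lemma measurable_phi g : measurable_fun setT g ->
  measurable_fun setT (fun x => phi p (g x)).
Proof. by move=> mg; apply: measurable_funM => //; exact: measurable_norm_powR. Qed.

Lemma integrable_ge0 g : measurable_fun setT g -> (forall x, 0 <= g x) ->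
  (\int[mu]_x (g x)%:E < +oo)%E -> mu.-integrable setT (EFin \o g).
Proof.
move=> mg g0 goo; apply/integrableP; split; first exact/measurable_EFinP.
by under eq_integral => x _ do rewrite /= ger0_norm//.
Qed.

Lemma Lpf_integrable g : Lpf g ->
  mu.-integrable setT (EFin \o (fun x => `|g x| `^ p)).
Proof.
by move=> [mg goo]; apply: integrable_ge0 => //; exact: measurable_norm_powR.
Qed.

Lemma pmassE g : Lpf g -> (pmass g)%:E = (\int[mu]_x (`|g x| `^ p)%:E)%E.
Proof.
move=> Lg; rewrite /pmass /Rintegral fineK//.
exact: (integrable_fin_num measurableT (Lpf_integrable Lg)).
Qed.

Lemma pmass_ge0 g : 0 <= pmass g.
Proof. by apply: Rintegral_ge0 => x _; exact: powR_ge0. Qed.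

Lemma pnorm_ge0 g : 0 <= pnorm g. Proof. exact: powR_ge0. Qed.

Lemma pnorm_powR g : pnorm g `^ p = pmass g.
Proof. by rewrite powR_invK// pmass_ge0. Qed.

Lemma pnormE g : Lpf g -> (pnorm g)%:E = 'N[mu]_(p%:E)[EFin \o g]%E.
Proof.
by move=> Lg; rewrite unlock /pnorm -poweR_EFin pmassE.
Qed.

Lemma Lpf_integrable_le g (f : T -> R) : measurable_fun setT f ->
  mu.-integrable setT (EFin \o g) -> (forall x, `|f x| <= g x) ->
  mu.-integrable setT (EFin \o f).
Proof.
move=> mf ig fg; apply: le_integrable ig => //; first exact/measurable_EFinP.
by move=> x _ /=; rewrite lee_fin (le_trans (fg x))// ler_norm.
Qed.

Lemma integrable_comb (a b : R) (f g : T -> R) :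
  mu.-integrable setT (EFin \o f) -> mu.-integrable setT (EFin \o g) ->
  mu.-integrable setT (EFin \o (fun x => a * f x + b * g x)).
Proof.
move=> If Ig.
have := integrableD measurableT (integrableZl measurableT a If)
  (integrableZl measurableT b Ig).
by apply: eq_integrable.
Qed.

Lemma Rintegral_comb (a b : R) (f g : T -> R) :
  mu.-integrable setT (EFin \o f) -> mu.-integrable setT (EFin \o g) ->
  \int[mu]_x (a * f x + b * g x) = a * (\int[mu]_x f x) + b * (\int[mu]_x g x).
Proof.
move=> If Ig; rewrite RintegralD//.
- by rewrite !RintegralZl.
- by have := integrableZl measurableT a If; apply: eq_integrable.
- by have := integrableZl measurableT b Ig; apply: eq_integrable.
Qed.

Lemma powR_normD_le (x y : R) :
  `|x + y| `^ p <= 2 `^ p * (`|x| `^ p + `|y| `^ p).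
Proof.
wlog xy : x y / `|x| <= `|y|.
  move=> H; have [/H//|/ltW/H] := leP `|x| `|y|.
  by rewrite addrC (addrC (_ `^ _)).
apply: (@le_trans _ _ ((2 * `|y|) `^ p)).
  by apply: powR_le => //; have := ler_normD x y; lra.
rewrite powRM// ler_wpM2l ?powR_ge0//; have := powR_ge0 `|x| p; lra.
Qed.

Lemma Lpf_lin (a : R) g h : Lpf g -> Lpf h -> Lpf (fun x => a * g x + h x).
Proof.
move=> Lg Lh; have mf : measurable_fun setT (fun x => a * g x + h x).
  by apply: measurable_funD; [apply: measurable_funM|]; [|exact: Lg.1|exact: Lh.1].
split => //.
have I := integrable_comb (2 `^ p * `|a| `^ p) (2 `^ p)
  (Lpf_integrable Lg) (Lpf_integrable Lh).
have : mu.-integrable setT (EFin \o (fun x => `|a * g x + h x| `^ p)).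
  apply: Lpf_integrable_le I _; first exact: measurable_norm_powR.
  move=> x; rewrite ger0_norm ?powR_ge0//; apply: (le_trans (powR_normD_le _ _)).
  by rewrite normrM powRM//; lra.
by move=> /(integrable_fin_num measurableT); rewrite ge0_fin_numE//;
  apply: integral_ge0 => x _; rewrite lee_fin powR_ge0.
Qed.

Lemma Lpf_0 : Lpf (fun=> 0).
Proof.
split; first exact: measurable_cst.
under eq_integral do rewrite normr0 powR0//.
by rewrite integral0.
Qed.

Lemma Lpf_scale (a : R) g : Lpf g -> Lpf (fun x => a * g x).
Proof. by move=> Lg; have := Lpf_lin a Lg Lpf_0; under eq_fun do rewrite addr0. Qed.

Lemma Lpf_D g h : Lpf g -> Lpf h -> Lpf (fun x => g x + h x).
Proof. by move=> Lg /(Lpf_lin 1 Lg); under eq_fun do rewrite mul1r. Qed.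

Lemma Lpf_B g h : Lpf g -> Lpf h -> Lpf (fun x => g x - h x).
Proof.
by move=> Lg Lh; have := Lpf_lin (-1) Lh Lg; under eq_fun do rewrite mulN1r addrC.
Qed.

Lemma pmassZ (a : R) g : Lpf g -> pmass (fun x => a * g x) = `|a| `^ p * pmass g.
Proof.
move=> Lg; rewrite /pmass -RintegralZl//; last exact: Lpf_integrable.
by apply: eq_Rintegral => x _; rewrite normrM powRM.
Qed.

Lemma pnormZ (a : R) g : Lpf g -> pnorm (fun x => a * g x) = `|a| * pnorm g.
Proof.
by move=> Lg; rewrite /pnorm pmassZ// powRM ?pmass_ge0 ?powR_ge0// powR_Kinv.
Qed.

Lemma pnormD g h : Lpf g -> Lpf h ->
  pnorm (fun x => g x + h x) <= pnorm g + pnorm h.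
Proof.
move=> Lg Lh.
have := @minkowski_EFin _ _ _ mu g h p Lg.1 Lh.1 (ltW p1).
rewrite -(pnormE Lg) -(pnormE Lh).
have -> : (g \+ h)%R = (fun x => g x + h x) by [].
by rewrite -(pnormE (Lpf_D Lg Lh)) -EFinD lee_fin.
Qed.

Lemma hoelder_pnorm g h : Lpf g -> Lpf h ->
  mu.-integrable setT (EFin \o (fun x => `|g x| `^ (p - 1) * `|h x|)) /\
  \int[mu]_x (`|g x| `^ (p - 1) * `|h x|) <= pnorm g `^ (p - 1) * pnorm h.
Proof.
move=> Lg Lh.
have mf : measurable_fun setT (fun x => `|g x| `^ (p - 1) * `|h x|).
  apply: measurable_funM; first exact/measurable_norm_powR/Lg.1.
  by apply: measurableT_comp => //; exact: Lh.1.
have If : mu.-integrable setT (EFin \o (fun x => `|g x| `^ (p - 1) * `|h x|)).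
  apply: (Lpf_integrable_le mf
    (integrable_comb 1 1 (Lpf_integrable Lg) (Lpf_integrable Lh))) => x.
  rewrite ger0_norm ?mulr_ge0 ?powR_ge0// !mul1r.
  have := young_mul p1 (normr_ge0 (g x)) (normr_ge0 (h x)).
  have := powR_ge0 `|g x| p; have := powR_ge0 `|h x| p => a b c.
  have d1 : 0 <= (p - 1) * `|h x| `^ p by rewrite mulr_ge0// subr_ge0 ltW.
  rewrite -(ler_pM2l p0); apply: (le_trans c); lra.
split => //.
pose q := p / (p - 1); have pp : 0 < p - 1 by rewrite subr_gt0.
have q0 : 0 < q by exact: divr_gt0.
have pq : p^-1 + q^-1 = 1 by rewrite /q invfM invrK; field; rewrite !gt_eqF.
have := hoelder mu Lh.1 (measurable_norm_powR (p - 1) Lg.1) p0 q0 pq.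
rewrite -pnormE// Lnorm1 [X in (_ <= _ * X)%E](_ : _ = (pnorm g `^ (p - 1))%:E).
  rewrite -EFinM mulrC => H; rewrite -lee_fin; apply: le_trans H.
  rewrite /Rintegral fineK.
    rewrite le_eqVlt; apply/orP; left; apply/eqP.
    apply: eq_integral => x _ /=.
    by rewrite normrM (ger0_norm (powR_ge0 _ _)) mulrC.
  exact: (integrable_fin_num measurableT If).
rewrite unlock /pnorm -powRrM [p^-1 * (p - 1)](_ : _ = q^-1); last first.
  by rewrite /q invfM invrK mulrC.
set I := (\int[mu]_x _)%E; have -> : I = (pmass g)%:E; last exact: poweR_EFin.
rewrite (pmassE Lg); apply: eq_integral => x _.
rewrite /= ger0_norm ?powR_ge0// -powRrM; congr (_ `^ _)%:E.
by rewrite /q mulrCA mulfV ?mulr1// gt_eqF.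
Qed.

Lemma pform_integrable g h : Lpf g -> Lpf h ->
  mu.-integrable setT (EFin \o (fun x => phi p (g x) * h x)).
Proof.
move=> Lg Lh; apply: (Lpf_integrable_le _ (hoelder_pnorm Lg Lh).1).
  by apply: measurable_funM; [exact/measurable_phi/Lg.1|exact: Lh.1].
by move=> x; rewrite normrM norm_phi.
Qed.

Lemma pform_le g h : Lpf g -> Lpf h ->
  `|pform g h| <= pnorm g `^ (p - 1) * pnorm h.
Proof.
move=> Lg Lh; apply: (le_trans (le_normr_Rintegral _ (pform_integrable Lg Lh))) => //.
apply: le_trans (hoelder_pnorm Lg Lh).2; rewrite le_eqVlt; apply/orP; left.
by apply/eqP; apply: eq_Rintegral => x _; rewrite normrM norm_phi.
Qed.

Lemma pform_lin g (a : R) h1 h2 : Lpf g -> Lpf h1 -> Lpf h2 ->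
  pform g (fun x => a * h1 x + h2 x) = a * pform g h1 + pform g h2.
Proof.
move=> Lg L1 L2.
have := Rintegral_comb a 1 (pform_integrable Lg L1) (pform_integrable Lg L2).
rewrite mul1r => <-; apply: eq_Rintegral => x _; ring.
Qed.

Lemma pform_diag g : pform g g = pmass g.
Proof. by apply: eq_Rintegral => x _; rewrite phi_mul. Qed.

Lemma pform_tangent g h : Lpf g -> Lpf h ->
  pmass g + p * pform g (fun x => h x - g x) <= pmass h.
Proof.
move=> Lg Lh; have Lb := Lpf_B Lh Lg.
have := Rintegral_comb 1 p (Lpf_integrable Lg) (pform_integrable Lg Lb).
rewrite mul1r => <-; apply: le_Rintegral => //.
- exact: (integrable_comb 1 p (Lpf_integrable Lg) (pform_integrable Lg Lb)).
- exact: Lpf_integrable.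
- by move=> x _; rewrite mul1r; exact: powR_norm_tangent.
Qed.

Lemma pformZ (c : R) g h : 0 < c -> Lpf g -> Lpf h ->
  pform (fun x => c * g x) h = c `^ (p - 1) * pform g h.
Proof.
move=> c0 Lg Lh; rewrite /pform -RintegralZl//; last exact: pform_integrable.
apply: eq_Rintegral => x _; rewrite phiM -mulrA; congr (_ * _).
have phic : 0 <= phi p c by rewrite mulr_ge0 ?powR_ge0// ltW.
by rewrite -(ger0_norm phic) norm_phi// gtr0_norm.
Qed.

Let comb_le (e C i j a b k : R) : 0 < e -> 0 <= C -> i <= a * k -> j <= b * k ->
  e * i + C * j <= (e * a + C * b) * k.
Proof.
move=> e0 C0 ia jb; rewrite mulrDl -!mulrA.
by apply: lerD; rewrite ler_wpM2l// ltW.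
Qed.

Lemma pform_cont_bound (e : R) : 0 < e -> exists2 C, 0 <= C &
  forall g g' h, Lpf g -> Lpf g' -> Lpf h ->
  `|pform g' h - pform g h| <=
    (e * pnorm g `^ (p - 1) + C * pnorm (fun x => g' x - g x) `^ (p - 1)) * pnorm h.
Proof.
move=> e0; have [C C0 HC] := phi_continuous_bound p1 e0.
exists C => // g g' h Lg Lg' Lh; have Lb := Lpf_B Lg' Lg.
have [I1 H1] := hoelder_pnorm Lg Lh; have [I2 H2] := hoelder_pnorm Lb Lh.
have J1 := pform_integrable Lg Lh; have J2 := pform_integrable Lg' Lh.
have -> : pform g' h - pform g h = 1 * pform g' h + -1 * pform g h.
  by rewrite mul1r mulN1r.
rewrite -Rintegral_comb//.
apply: (le_trans (le_normr_Rintegral _ (integrable_comb 1 (-1) J2 J1))) => //.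
apply: (@le_trans _ _ (\int[mu]_x (e * (`|g x| `^ (p - 1) * `|h x|) +
    C * (`|g' x - g x| `^ (p - 1) * `|h x|)))).
  apply: le_Rintegral => //.
  - exact: (integrable_norm (integrable_comb 1 (-1) J2 J1)).
  - exact: integrable_comb.
  - move=> x _; move: (HC (g x) (g' x)); clear -e0.
    move: (phi p (g' x)) (phi p (g x)) (_ `^ (p - 1)) (_ `^ (p - 1)) => y z A B.
    have -> : 1 * (y * h x) + -1 * (z * h x) = (y - z) * h x by ring.
    by move=> /(ler_wpM2r (normr_ge0 (h x))); rewrite normrM; lra.
rewrite (Rintegral_comb _ _ I1 I2).
exact: comb_le e0 C0 H1 H2.
Qed.

Let comb_small (e A C x e1 e2 : R) : 0 <= C -> 0 <= A -> 0 < e1 -> 0 < e2 ->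
  e = 2 * (A + 1) * e1 -> e = 2 * (C + 1) * e2 -> x <= e2 -> e1 * A + C * x <= e.
Proof.
move=> C0 A0 e10 e20 E1 E2 xe.
have := ler_wpM2l C0 xe; have : 0 <= A * e1 by rewrite mulr_ge0// ltW.
by have : 0 <= C * e2 by [rewrite mulr_ge0// ltW]; lra.
Qed.

Lemma pform_cont g (e : R) : Lpf g -> 0 < e -> exists2 d : R, 0 < d &
  forall g' h, Lpf g' -> Lpf h -> pnorm (fun x => g' x - g x) < d ->
  `|pform g' h - pform g h| <= e * pnorm h.
Proof.
move=> Lg e0; have pp : 0 < p - 1 by rewrite subr_gt0.
pose A := pnorm g `^ (p - 1); have A0 : 0 <= A by exact: powR_ge0.
pose e1 := e / (2 * (A + 1)).
have e10 : 0 < e1 by rewrite divr_gt0//; lra.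
have e1E : e = 2 * (A + 1) * e1 by rewrite /e1; field; lra.
have [C C0 HC] := pform_cont_bound e10.
pose e2 := e / (2 * (C + 1)).
have e20 : 0 < e2 by rewrite divr_gt0//; lra.
have e2E : e = 2 * (C + 1) * e2 by rewrite /e2; field; lra.
exists (e2 `^ (p - 1)^-1); first exact: powR_gt0.
move=> g' h Lg' Lh dg; apply: (le_trans (HC _ _ _ Lg Lg' Lh)).
rewrite ler_wpM2r ?pnorm_ge0//.
have : pnorm (fun x => g' x - g x) `^ (p - 1) <= e2.
  rewrite -[leRHS]powRr1 ?(ltW e20)// -[X in _ <= _ `^ X](mulVf (lt0r_neq0 pp)).
  rewrite powRrM; apply: ge0_ler_powR; rewrite ?nnegrE ?powR_ge0 ?ltW//.
move=> xe; exact: comb_small C0 A0 e10 e20 e1E e2E xe.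
Qed.

(** The integral of [powR_uniform_convexity]; it serves on any measure space, in particular on pairs
    of points. *)
Lemma pmass_uniform_convexity (e : R) : 0 < e -> exists2 C, 0 <= C &
  forall g h, Lpf g -> Lpf h ->
  pmass (fun x => g x - h x) <= e * (pmass g + pmass h) +
    C * ((pmass g + pmass h) / 2 - pmass (fun x => 2^-1 * (g x + h x))).
Proof.
move=> e0; have [C C0 HC] := powR_uniform_convexity p1 e0.
exists C => // g h Lg Lh; have Lb := Lpf_B Lg Lh.
have Lm := Lpf_scale 2^-1 (Lpf_D Lg Lh).
have Ig := Lpf_integrable Lg; have Ih := Lpf_integrable Lh.
have Im := Lpf_integrable Lm.
have Igh := integrable_comb (e + C / 2) (e + C / 2) Ig Ih.
have -> : e * (pmass g + pmass h) +
    C * ((pmass g + pmass h) / 2 - pmass (fun x => 2^-1 * (g x + h x))) =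
  1 * ((e + C / 2) * pmass g + (e + C / 2) * pmass h) +
  (- C) * pmass (fun x => 2^-1 * (g x + h x)).
  by move: (pmass _) (pmass _) (pmass _) => A B D; ring.
rewrite -[X in 1 * X](Rintegral_comb _ _ Ig Ih) -(Rintegral_comb _ _ Igh Im).
apply: le_Rintegral => //.
- exact: Lpf_integrable.
- exact: integrable_comb.
- move=> x _; apply: (le_trans (HC _ _)); rewrite (mulrC 2^-1).
  by move: (_ `^ p) (_ `^ p) (_ `^ p) => A B D; lra.
Qed.

(** Fatou's lemma. Convergence is asked at every point, so sequences are first cut off by an
    indicator. *)
Lemma pmass_fatou (g_ : nat -> T -> R) g (c : R) : (forall n, Lpf (g_ n)) ->
  measurable_fun setT g -> (forall x, g_ n x @[n --> \oo] --> g x) ->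
  (\forall n \near \oo, pmass (g_ n) <= c) -> Lpf g /\ pmass g <= c.
Proof.
move=> Lg mg gg gc.
have mf n : measurable_fun setT (fun x => (`|g_ n x| `^ p)%:E).
  by apply/measurable_EFinP; exact: measurable_norm_powR (Lg n).1.
have H : (\int[mu]_x (`|g x| `^ p)%:E <= c%:E)%E.
  have -> : (\int[mu]_x (`|g x| `^ p)%:E)%E =
      (\int[mu]_x limn_einf (fun n => (`|g_ n x| `^ p)%:E))%E.
    apply: eq_integral => x _; apply/esym.
    apply: (cvg_limn_einf_sup _).1; apply: cvg_EFin; first exact: nearW.
    apply: (cvg_comp (fun n => g_ n x) (fun t => `|t| `^ p) (gg x)).
    exact: continuous_norm_powR.
  apply: (le_trans (fatou mu measurableT mf _)).
    by move=> n x _; rewrite lee_fin powR_ge0.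
  rewrite limn_einf_lim; apply: lime_le; first exact: is_cvg_einfs.
  near=> n; apply: (@le_trans _ _ (\int[mu]_x (`|g_ n x| `^ p)%:E)%E).
    by apply: ereal_inf_lbound; exists n => /=.
  by rewrite -pmassE// lee_fin; near: n.
have Lgg : Lpf g by split => //; exact: le_lt_trans H (ltry _).
by split => //; rewrite -lee_fin pmassE.
Unshelve. all: by end_near. Qed.

Lemma eq_pmass g h : {ae mu, forall x, g x = h x} -> measurable_fun setT h ->
  Lpf g -> Lpf h /\ pmass h = pmass g.
Proof.
move=> gh mh Lg.
have E : (\int[mu]_x (`|h x| `^ p)%:E)%E = (\int[mu]_x (`|g x| `^ p)%:E)%E.
  apply: ge0_ae_eq_integral => //.
  - by apply/measurable_EFinP; exact: measurable_norm_powR.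
  - by apply/measurable_EFinP; exact: measurable_norm_powR Lg.1.
  - by apply: filterS gh => x /= -> _.
split; first by split => //; rewrite E; exact: Lg.2.
by rewrite /pmass /Rintegral E.
Qed.

End Lp_functions.

(** * Compactness of the fractional Sobolev embedding *)

Section boxes.
Context {R : realType}.

Definition pbox n (I : 'I_n -> set R) : set 'rV[R]_n :=
  [set x | forall i, I i (x 0 i)].

Lemma measurable_pbox n (I : 'I_n -> set R) :
  (forall i, measurable (I i)) -> measurable (pbox I).
Proof.
move=> mI; rewrite (_ : pbox I = \bigcap_(i in [set: 'I_n]) [set x | I i (x 0 i)]).
  apply: fin_bigcap_measurable; first exact: finite_finset.
  by move=> i _; rewrite -[X in measurable X]setTI; exact: measurable_coord.
by apply/seteqP; split => [x H i _|x H i]; exact: H.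
Qed.

Lemma lebesgue_rV_pbox n (I : 'I_n -> set R) (l : 'I_n -> R) :
  (forall i, measurable (I i)) ->
  (forall i, lebesgue_measure (I i) = (l i)%:E) ->
  lebesgue_rV R n (pbox I) = (\prod_(i < n) l i)%:E.
Proof.
elim: n I l => [|n IH] I l mI lI.
  rewrite big_ord0 /= /dirac indicE mem_set//= => i; by case: i.
rewrite big_ord_recl /= /lebesgue_rVS /pushforward.
have -> : @cons_rV R n @^-1` pbox I =
    I ord0 `*` pbox (fun i => I (lift ord0 i)).
  apply/seteqP; split => -[a v] /=; rewrite /pbox /cons_rV /=.
    move=> H; split => [|i]; first by have := H ord0; rewrite mxE unlift_none.
    by have := H (lift ord0 i); rewrite mxE liftK.
  move=> [H0 H] i; rewrite mxE; case: (unliftP ord0 i) => [j|] ->.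
    by rewrite /=; exact: H.
  exact: H0.
rewrite product_measure1E; [|exact: mI|exact: measurable_pbox].
rewrite EFinM; congr (_ * _)%E; first exact: lI.
by rewrite (IH _ (fun i => l (lift ord0 i))).
Qed.

(** Half-open, so that the cubes of a grid are disjoint. *)
Definition hcube n (a : 'rV[R]_n) (h : R) : set 'rV[R]_n :=
  pbox (fun i => `[a 0 i, a 0 i + h[%classic).

Lemma measurable_hcube n a h : measurable (@hcube n a h).
Proof. by apply: measurable_pbox => i; exact: measurable_itv. Qed.

Lemma lebesgue_hcube n a h : 0 <= h -> lebesgue_rV R n (hcube a h) = (h ^+ n)%:E.
Proof.
move=> h0; rewrite (lebesgue_rV_pbox (l := fun=> h)).
- by rewrite prodr_const card_ord.
- by move=> i; exact: measurable_itv.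
- move=> i; rewrite lebesgue_measure_itv /= lte_fin ltrDl.
  case: ltP => [_|h0']; first by rewrite -EFinD addrC addKr.
  by have -> : h = 0 by apply/le_anti; rewrite h0 h0'.
Qed.

Definition ccube n (a : 'rV[R]_n) (h : R) : set 'rV[R]_n :=
  pbox (fun i => `[a 0 i, a 0 i + h]%classic).

Lemma measurable_ccube n a h : measurable (@ccube n a h).
Proof. by apply: measurable_pbox => i; exact: measurable_itv. Qed.

Lemma lebesgue_ccube n a h : 0 <= h -> lebesgue_rV R n (ccube a h) = (h ^+ n)%:E.
Proof.
move=> h0; rewrite (lebesgue_rV_pbox (l := fun=> h)).
- by rewrite prodr_const card_ord.
- by move=> i; exact: measurable_itv.
- move=> i; rewrite lebesgue_measure_itv /= lte_fin ltrDl.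
  case: ltP => [_|h0']; first by rewrite -EFinD addrC addKr.
  by have -> : h = 0 by apply/le_anti; rewrite h0 h0'.
Qed.

End boxes.

Section enorm_facts.
Context {R : realType} {n : nat}.
Implicit Types x y : 'rV[R]_n.

Lemma dotv_ge0 x : 0 <= dotv x x.
Proof. by apply: sumr_ge0 => i _; rewrite -expr2 sqr_ge0. Qed.

Lemma enorm_ge0 x : 0 <= enorm x. Proof. exact: sqrtr_ge0. Qed.

Lemma enorm_sqr x : enorm x ^+ 2 = dotv x x.
Proof. by rewrite sqr_sqrtr// dotv_ge0. Qed.

Lemma coord_le_enorm x i : `|x 0 i| <= enorm x.
Proof.
rewrite -sqrtr_sqr ler_sqrt ?dotv_ge0// /dotv (bigD1 i)//= -expr2 lerDl.
by apply: sumr_ge0 => j _; rewrite -expr2 sqr_ge0.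
Qed.

Lemma enorm_gt0 x : x != 0 -> 0 < enorm x.
Proof.
apply: contraTT; rewrite -leNgt => xle; rewrite negbK; apply/eqP/rowP => i.
rewrite mxE; apply/eqP; rewrite -normr_le0; exact: le_trans (coord_le_enorm x i) _.
Qed.

Lemma enorm_le x (c : R) : 0 <= c -> (forall i, `|x 0 i| <= c) ->
  enorm x <= Num.sqrt n%:R * c.
Proof.
move=> c0 xc; rewrite -[c]ger0_norm// -sqrtr_sqr -sqrtrM ?ler0n//.
rewrite ler_sqrt ?mulr_ge0 ?sqr_ge0// /dotv.
have -> : n%:R * c ^+ 2 = \sum_(i < n) c ^+ 2.
  by rewrite sumr_const card_ord mulr_natl.
apply: ler_sum => i _; rewrite -expr2 -real_normK ?num_real//.
by rewrite lerXn2r ?nnegrE.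
Qed.

Lemma measurable_enorm : measurable_fun setT (@enorm R n).
Proof.
rewrite (_ : @enorm R n = (fun t => t `^ 2^-1) \o (fun x => dotv x x)).
  apply: measurableT_comp; first exact: measurable_powR.
  by apply: measurable_sum => i; apply: measurable_funM; exact: measurable_coord.
by apply/funext => x /=; rewrite powR12_sqrt// dotv_ge0.
Qed.

Lemma measurable_rV_sub :
  measurable_fun setT (fun z : 'rV[R]_n * 'rV[R]_n => z.1 - z.2).
Proof.
apply: measurable_fun_rV => i.
rewrite [X in measurable_fun _ X](_ : _ =
    (fun z : 'rV[R]_n * 'rV[R]_n => z.1 0 i - z.2 0 i)).
  apply: measurable_funB.
    exact: (measurableT_comp (measurable_coord 0 i) measurable_fst).
  exact: (measurableT_comp (measurable_coord 0 i) measurable_snd).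
by apply/funext => z; rewrite !mxE.
Qed.

Lemma bounded_hcube (A : set 'rV[R]_n) : bounded_set A ->
  exists2 r : R, 0 < r & A `<=` hcube (const_mx (- r)) (2 * r).
Proof.
move=> [M [_ HM]]; exists (`|M| + 2); first by have := normr_ge0 M; lra.
have Mlt : M < `|M| + 1 by have := ler_norm M; lra.
move=> x /(HM _ Mlt)/= xM i /=; rewrite in_itv/= mxE.
have : `|x 0 i| <= `|M| + 1.
  apply: le_trans xM; rewrite /Num.norm/= mx_normrE.
  by apply/bigmax_geP; right => /=; exists (0, i).
by rewrite ler_norml => /andP[]; lra.
Qed.

End enorm_facts.

(** * The fractional difference operator and a Poincare inequality on a cube *)

Section difference_operator.
Context {R : realType} {n : nat}.
Variables (s p : R).
Hypothesis p1 : 1 < p.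
Implicit Types u v : 'rV[R]_n -> R.

Local Notation X := 'rV[R]_n.
Local Notation mu := (lebesgue_rV R n).
Local Notation mu2 := (lebesgue_rV R n \x lebesgue_rV R n)%E.

Let p0 : 0 < p. Proof. exact: lt_trans p1. Qed.

(** With the kernel written as a p-th power, the Gagliardo seminorm is the p-mass of a linear image
    of u on pairs of points. The lemmas on [pmass] and [pform] then apply to both seminorms. *)
Definition frac_diff u (z : X * X) : R :=
  (u z.1 - u z.2) * enorm (z.1 - z.2) `^ (- (n%:R + s * p) / p).

Lemma frac_weight_powR (x y : X) :
  (enorm (x - y) `^ (- (n%:R + s * p) / p)) `^ p = frac_kernel s p x y.
Proof. by rewrite -powRrM mulfVK ?gt_eqF// powRN. Qed.

Lemma frac_diff_powR u z :
  `|frac_diff u z| `^ p = `|u z.1 - u z.2| `^ p * frac_kernel s p z.1 z.2.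
Proof.
by rewrite normrM powRM// (ger0_norm (powR_ge0 _ _)) frac_weight_powR.
Qed.

Lemma phi_frac_diff u v z : phi p (frac_diff u z) * frac_diff v z =
  phi p (u z.1 - u z.2) * (v z.1 - v z.2) * frac_kernel s p z.1 z.2.
Proof.
rewrite /frac_diff phiM -frac_weight_powR.
set w := enorm _ `^ _; have <- : phi p w * w = w `^ p.
  by rewrite phi_mul// ger0_norm// powR_ge0.
by rewrite mulrACA.
Qed.

Lemma frac_diff_lin (a : R) u v :
  frac_diff (fun x => a * u x + v x) = (fun z => a * frac_diff u z + frac_diff v z).
Proof. by apply/funext => z; rewrite /frac_diff; ring. Qed.

Lemma measurable_frac_diff u : measurable_fun setT u ->
  measurable_fun setT (frac_diff u).
Proof.
move=> mu'; apply: measurable_funM.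
  apply: measurable_funB; first exact: measurableT_comp mu' measurable_fst.
  exact: measurableT_comp mu' measurable_snd.
apply: (@measurableT_comp _ _ _ _ _ _ (fun t : R => t `^ (- (n%:R + s * p) / p))).
  exact: measurable_powR.
exact: measurableT_comp measurable_enorm measurable_rV_sub.
Qed.

Lemma gagliardoE u : gagliardo s p setT u = (\int[mu2]_z (`|frac_diff u z| `^ p)%:E)%E.
Proof.
by rewrite /gagliardo setXTT; apply: eq_integral => z _; rewrite frac_diff_powR.
Qed.

Lemma frac_diff_lower u x y (delta : R) : 0 < n%:R + s * p ->
  enorm (x - y) <= delta ->
  `|u x - u y| `^ p <= delta `^ (n%:R + s * p) * `|frac_diff u (x, y)| `^ p.
Proof.
move=> sp0 xyd; rewrite frac_diff_powR /= /frac_kernel.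
have [<-|xy] := eqVneq x y; first by rewrite subrr normr0 powR0 ?gt_eqF// mul0r mulr0.
have e0 : 0 < enorm (x - y) by rewrite enorm_gt0// subr_eq0.
rewrite mulrCA ler_peMr ?powR_ge0//.
rewrite ler_pdivlMr ?powR_gt0// mul1r.
apply: ge0_ler_powR; rewrite ?nnegrE ?(ltW sp0) ?(ltW e0)//.
exact: le_trans (enorm_ge0 _) xyd.
Qed.

Section cube.
Variables (Q : set X) (q delta : R).
Hypothesis mQ : measurable Q.
Hypothesis muQ : mu Q = q%:E.
Hypothesis q0 : 0 < q.
Hypothesis sp0 : 0 < n%:R + s * p.
Hypothesis diamQ : forall x y, Q x -> Q y -> enorm (x - y) <= delta.

Lemma integral_indicQ : (\int[mu]_x (\1_Q x)%:E)%E = q%:E.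
Proof. by rewrite integral_indic// setIT; exact: muQ. Qed.

Lemma integrable_indicQ : mu.-integrable setT (EFin \o \1_Q).
Proof.
apply: integrable_ge0; first exact: measurable_indic.
  by move=> x; rewrite indicE.
by rewrite integral_indicQ ltry.
Qed.

Lemma Rintegral_indicQ : \int[mu]_x \1_Q x = q.
Proof. by rewrite /Rintegral integral_indicQ. Qed.

Lemma norm_indicQ_powR (r : R) x : r != 0 -> `|\1_Q x : R| `^ r = \1_Q x.
Proof.
move=> r0; rewrite indicE; case: (x \in Q); first by rewrite normr1 powR1.
by rewrite normr0 powR0.
Qed.

Lemma Lpf_indicQ : Lpf mu p \1_Q.
Proof.
split; first exact: measurable_indic.
under eq_integral do rewrite norm_indicQ_powR ?gt_eqF//.
by rewrite integral_indicQ ltry.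
Qed.

Lemma phi_indicQ x : phi p (\1_Q x) = \1_Q x.
Proof.
rewrite indicE /phi; case: (x \in Q); last by rewrite mulr0.
by rewrite normr1 powR1 mulr1.
Qed.

(** The indicator is a fixed point of phi, so the average is a [pform] and inherits linearity and
    the Hoelder bound. *)
Definition cube_avg u : R := q^-1 * pform mu p \1_Q u.

(** Jensen's inequality from the tangent at u x - a, integrated over the cube: the linear term
    vanishes because a is the mean. *)
Lemma jensen_cube u x : Lpf mu p u ->
  ((q * `|u x - cube_avg u| `^ p)%:E <=
   \int[mu]_y (\1_Q y * `|u x - u y| `^ p)%:E)%E.
Proof.
move=> Lu; set a := cube_avg u.
have LQ := Lpf_indicQ; have IQ := integrable_indicQ.
have IQu := pform_integrable p1 LQ Lu.
have E : (fun y => phi p (\1_Q y) * u y) = (fun y => \1_Q y * u y).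
  by apply/funext => y; rewrite phi_indicQ.
rewrite E in IQu.
have Iu : \int[mu]_y (\1_Q y * u y) = q * a.
  by rewrite /a /cube_avg mulrA mulfV ?gt_eqF// mul1r /pform E.
pose c := p * phi p (u x - a).
pose F y := (`|u x - a| `^ p + c * a) * \1_Q y + (- c) * (\1_Q y * u y).
have IF : mu.-integrable setT (EFin \o F) by exact: integrable_comb.
have intF : \int[mu]_y F y = q * `|u x - a| `^ p.
  rewrite Rintegral_comb// Rintegral_indicQ Iu.
  by move: (_ `^ p) => t; clearbody a c; ring.
have FG y : F y <= \1_Q y * `|u x - u y| `^ p.
  rewrite /F indicE; case: (y \in Q); last by rewrite !mul0r !mulr0 addr0.
  rewrite !mulr1 !mul1r; have := powR_norm_tangent p1 (u x - a) (u x - u y).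
  have -> : u x - u y - (u x - a) = a - u y by ring.
  by rewrite /c; move: (_ `^ p) (_ `^ p) (phi p _) => t t' f; clearbody a; lra.
have mG : measurable_fun setT (fun y => \1_Q y * `|u x - u y| `^ p).
  apply: measurable_funM; first exact: measurable_indic.
  apply: measurable_norm_powR; apply: measurable_funB; first exact: measurable_cst.
  exact: Lu.1.
rewrite -intF.
have -> : (\int[mu]_y F y)%:E = (\int[mu]_y (F y)%:E)%E.
  by rewrite /Rintegral fineK//; exact: integrable_fin_num IF.
have G0 y : 0 <= \1_Q y * `|u x - u y| `^ p.
  by rewrite mulr_ge0 ?powR_ge0// indicE.
have [Goo|] := ltP (\int[mu]_y (\1_Q y * `|u x - u y| `^ p)%:E)%E +oo%E; last first.
  by rewrite leye_eq => /eqP ->; exact: leey.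
apply: le_integral => //; first exact: integrable_ge0.
by move=> y _; rewrite lee_fin.
Qed.

(** Jensen's inequality integrated in x, then the lower bound of the kernel given by the
    diameter. *)
Lemma poincare_cube u : Lpf mu p u ->
  (q%:E * \int[mu]_x (\1_Q x * `|u x - cube_avg u| `^ p)%:E <=
   (delta `^ (n%:R + s * p))%:E *
   \int[mu2]_z (\1_(Q `*` Q) z * `|frac_diff u z| `^ p)%:E)%E.
Proof.
move=> Lu; set a := cube_avg u.
have mf : measurable_fun setT (fun x => \1_Q x * `|u x - a| `^ p).
  apply: measurable_funM; first exact: measurable_indic.
  apply: measurable_norm_powR; apply: measurable_funB; first exact: Lu.1.
  exact: measurable_cst.
pose G z := \1_(Q `*` Q) z * `|u z.1 - u z.2| `^ p.
have mQQ : measurable (Q `*` Q) by exact: measurableX.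
have mG : measurable_fun setT G.
  apply: measurable_funM; first exact: measurable_indic.
  apply: measurable_norm_powR; apply: measurable_funB.
    exact: measurableT_comp Lu.1 measurable_fst.
  exact: measurableT_comp Lu.1 measurable_snd.
have G0 z : 0 <= G z by rewrite mulr_ge0 ?powR_ge0// indicE.
have mH : measurable_fun setT (fun z => \1_(Q `*` Q) z * `|frac_diff u z| `^ p).
  apply: measurable_funM; first exact: measurable_indic.
  by apply: measurable_norm_powR; apply: measurable_frac_diff; exact: Lu.1.
apply: (@le_trans _ _ (\int[mu2]_z (G z)%:E)%E); last first.
  rewrite -ge0_integralZl//; last 2 first.
  - exact/measurable_EFinP.
  - by rewrite lee_fin powR_ge0.
  apply: ge0_le_integral => //.
  - by move=> z _; rewrite lee_fin.
  - exact/measurable_EFinP.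
  - by apply: measurable_funeM; exact/measurable_EFinP.
  move=> [x y] _; rewrite lee_fin /G indicE.
  have [/set_mem[/= Qx Qy]|_] := boolP ((x, y) \in Q `*` Q); last by rewrite !mul0r mulr0.
  by rewrite !mul1r; apply: frac_diff_lower => //; exact: diamQ.
have mEG : measurable_fun setT (EFin \o G) by exact/measurable_EFinP.
have EG0 z : (0 <= (EFin \o G) z)%E by rewrite lee_fin.
rewrite (@fubini_tonelli1 _ _ _ _ _ mu mu _ mEG EG0).
rewrite -ge0_integralZl//; last 2 first.
- exact/measurable_EFinP.
- by rewrite lee_fin ltW.
apply: ge0_le_integral => //.
- by move=> x _; rewrite -EFinM lee_fin !mulr_ge0 ?powR_ge0 ?(ltW q0)// indicE.
- by apply: measurable_funeM; exact/measurable_EFinP.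
- exact: (@measurable_fun_fubini_tonelli_F _ _ _ _ _ mu _ mEG EG0).
move=> x _; rewrite /fubini_F /=.
rewrite indicE; have [/set_mem Qx|_] := boolP (x \in Q); last first.
  rewrite mul0r mule0; apply: integral_ge0 => y _; rewrite lee_fin; exact: G0.
rewrite mul1r -EFinM; apply: (le_trans (jensen_cube x Lu)).
rewrite le_eqVlt; apply/orP; left; apply/eqP; apply: eq_integral => y _.
by rewrite /G !indicE in_setX /= (mem_set Qx).
Qed.

End cube.

End difference_operator.

(** * Control of the p-mass by the energy and finitely many averages *)

Section interpolation.
Context {R : realType} {n : nat}.
Variables (s p : R).
Hypothesis p1 : 1 < p.
Hypothesis s0 : 0 < s.
Implicit Types u v : 'rV[R]_n -> R.

Local Notation X := 'rV[R]_n.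
Local Notation mu := (lebesgue_rV R n).
Local Notation mu2 := (lebesgue_rV R n \x lebesgue_rV R n)%E.

Let p0 : 0 < p. Proof. exact: lt_trans p1. Qed.
Let sp0 : 0 < s * p. Proof. exact: mulr_gt0. Qed.
Let a0 : 0 < n%:R + s * p. Proof. by rewrite ltr_wpDl. Qed.

(** On each cube u is split into oscillation and average. The blocks [Q k] x [Q k] are disjoint, so
    the local energies add up to at most the full one. *)
Lemma partition_estimate (K : finType) (Q : K -> set X) (q delta : R) u :
  (forall k, measurable (Q k)) -> (forall k, mu (Q k) = q%:E) -> 0 < q ->
  (forall k x y, Q k x -> Q k y -> enorm (x - y) <= delta) ->
  (forall k l x, Q k x -> Q l x -> k = l) ->
  (forall x, u x != 0 -> exists k, Q k x) ->
  Lpf mu p u -> Lpf mu2 p (frac_diff s p u) ->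
  pmass mu p u <= 2 `^ p *
    (delta `^ (n%:R + s * p) / q * pmass mu2 p (frac_diff s p u) +
     q * \sum_k `|cube_avg p (Q k) q u| `^ p).
Proof.
move=> mQ muQ q0 diamQ dQ coverQ Lu Lfu.
pose av k := cube_avg p (Q k) q u.
pose f1 k x := \1_(Q k) x * `|u x - av k| `^ p.
pose f2 k z := \1_(Q k `*` Q k) z * `|frac_diff s p u z| `^ p.
have f10 k x : 0 <= f1 k x by rewrite mulr_ge0 ?powR_ge0// indicE.
have f20 k z : 0 <= f2 k z by rewrite mulr_ge0 ?powR_ge0// indicE.
have mf1 k : measurable_fun setT (f1 k).
  apply: measurable_funM; first exact: measurable_indic.
  by apply: measurable_norm_powR; apply: measurable_funB; [exact: Lu.1|exact: measurable_cst].
have mf2 k : measurable_fun setT (f2 k).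
  apply: measurable_funM; first by apply: measurable_indic; exact: measurableX.
  by apply: measurable_norm_powR; exact: Lfu.1.
pose I1 k := (\int[mu]_x (f1 k x)%:E)%E.
pose I2 k := (\int[mu2]_z (f2 k z)%:E)%E.
have I20 k : (0 <= I2 k)%E by apply: integral_ge0 => z _; rewrite lee_fin.
have sumI2 : (\sum_k I2 k <= (pmass mu2 p (frac_diff s p u))%:E)%E.
  rewrite pmassE// -ge0_integral_sum//; last 2 first.
  - by move=> k; exact/measurable_EFinP.
  - by move=> k z _; rewrite lee_fin.
  apply: ge0_le_integral => //.
  - by move=> z _; apply: sume_ge0 => k _; rewrite lee_fin.
  - by apply: emeasurable_sum => k; exact/measurable_EFinP.
  - by apply/measurable_EFinP; apply: measurable_norm_powR; exact: Lfu.1.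
  move=> z _; rewrite sumEFin lee_fin.
  have [[k Qk]|no] := pselect (exists k, (Q k `*` Q k) z); last first.
    rewrite big1 ?powR_ge0// => k _; rewrite /f2 indicE memNset ?mul0r// => Qk.
    by apply: no; exists k.
  rewrite (bigD1 k)//= big1 ?addr0; last first.
    move=> l lk; rewrite /f2 indicE memNset ?mul0r// => -[Ql _].
    by move/eqP: lk; apply; exact: dQ Ql Qk.1.
  by rewrite /f2 indicE mem_set// mul1r.
have I2fin k : I2 k \is a fin_num.
  rewrite ge0_fin_numE//; apply: le_lt_trans (ltry _); apply: le_trans sumI2.
  by rewrite (bigD1 k)//= leeDl// sume_ge0.
have I1le k : (I1 k <= (delta `^ (n%:R + s * p) / q * fine (I2 k))%:E)%E.
  have := poincare_cube p1 (mQ k) (muQ k) q0 a0 (diamQ k) Lu.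
  rewrite -/(I2 k) -(fineK (I2fin k)) -lee_pdivlMl// => /le_trans; apply.
  by rewrite -!EFinM lee_fin mulrA (mulrC q^-1).
rewrite -lee_fin pmassE//.
apply: (@le_trans _ _ (\int[mu]_x \sum_k ((2 `^ p * f1 k x)%:E +
    (2 `^ p * `|av k| `^ p * \1_(Q k) x)%:E))%E).
  apply: ge0_le_integral => //.
  - by apply/measurable_EFinP; apply: measurable_norm_powR; exact: Lu.1.
  - apply: emeasurable_sum => k; apply: emeasurable_funD; apply/measurable_EFinP.
      by apply: measurable_funM => //; exact: measurable_cst.
    by apply: measurable_funM; [exact: measurable_cst|exact: measurable_indic].
  move=> x _; under eq_bigr do rewrite -EFinD.
  rewrite sumEFin lee_fin.
  have t0 k : 0 <= 2 `^ p * f1 k x + 2 `^ p * `|av k| `^ p * \1_(Q k) x.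
    by rewrite addr_ge0// !mulr_ge0 ?powR_ge0// indicE.
  have [->|ux] := eqVneq (u x) 0.
    by rewrite normr0 powR0 ?gt_eqF// sumr_ge0.
  have [k Qk] := coverQ _ ux.
  rewrite (bigD1 k)//=; apply: ler_wpDr; first exact: sumr_ge0.
  rewrite /f1 indicE mem_set// mul1r mulr1 -mulrDr.
  by have := powR_normD_le p1 (u x - av k) (av k); rewrite subrK.
rewrite ge0_integral_sum//; last 2 first.
- move=> k; apply: emeasurable_funD; apply/measurable_EFinP.
    by apply: measurable_funM => //; exact: measurable_cst.
  by apply: measurable_funM; [exact: measurable_cst|exact: measurable_indic].
- move=> k x _; rewrite -EFinD lee_fin.
  by rewrite addr_ge0// !mulr_ge0 ?powR_ge0// indicE.
have Ik k : (\int[mu]_x ((2 `^ p * f1 k x)%:E +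
    (2 `^ p * `|av k| `^ p * \1_(Q k) x)%:E) <=
    (2 `^ p * (delta `^ (n%:R + s * p) / q * fine (I2 k) + q * `|av k| `^ p))%:E)%E.
  rewrite ge0_integralD//; last 3 first.
  - by move=> x _; rewrite lee_fin mulr_ge0 ?powR_ge0.
  - by apply/measurable_EFinP; apply: measurable_funM => //; exact: measurable_cst.
  - apply/measurable_EFinP; apply: measurable_funM; first exact: measurable_cst.
    exact: measurable_indic.
  under eq_integral do rewrite EFinM.
  rewrite ge0_integralZl_EFin ?powR_ge0//; last 2 first.
  - by move=> x _; rewrite lee_fin.
  - exact/measurable_EFinP.
  under [X in (_ + X)%E]eq_integral do rewrite EFinM.
  rewrite ge0_integralZl_EFin ?mulr_ge0 ?powR_ge0//; last first.
    by apply/measurable_EFinP; exact: measurable_indic.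
  rewrite (integral_indicQ (mQ k) (muQ k)) mulrDr EFinD.
  apply: leeD; last by rewrite -EFinM lee_fin -mulrA (mulrC q).
  by rewrite [leRHS]EFinM; apply: lee_wpmul2l; [rewrite lee_fin powR_ge0|exact: I1le].
apply: (le_trans (lee_sum _ (fun k _ => Ik k))).
rewrite sumEFin lee_fin -mulr_sumr ler_wpM2l ?powR_ge0// big_split/= -!mulr_sumr.
rewrite lerD2r ler_wpM2l ?divr_ge0 ?powR_ge0 ?(ltW q0)//.
rewrite -lee_fin; apply: le_trans sumI2; rewrite -sumEFin.
by apply: lee_sum => k _; rewrite fineK.
Qed.

Lemma poincare (r : R) u : 0 < r -> (0 < n)%N ->
  (forall x, ~ hcube (const_mx (- r)) (2 * r) x -> u x = 0) ->
  Lpf mu p u -> Lpf mu2 p (frac_diff s p u) ->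
  r ^+ n * pmass mu p u <= (Num.sqrt n%:R * (3 * r)) `^ (n%:R + s * p) *
     pmass mu2 p (frac_diff s p u).
Proof.
move=> r0 n0 uout Lu Lfu; set c := (Num.sqrt _ * _) `^ _.
(* A cube of side r adjacent to the box, where u vanishes: its points are compared with those of the
   box, at coordinate distance at most 3 r. *)
pose B : set X := hcube (const_mx r) r.
have mB : measurable B by exact: measurable_hcube.
have muB : mu B = (r ^+ n)%:E by apply: lebesgue_hcube; exact: ltW.
pose G (z : X * X) := `|u z.1| `^ p * \1_B z.2.
have G0 z : 0 <= G z by rewrite mulr_ge0 ?powR_ge0// indicE.
have mG : measurable_fun setT G.
  apply: measurable_funM.
    apply: measurable_norm_powR; exact: measurableT_comp Lu.1 measurable_fst.
  have mI : measurable_fun setT (\1_B : X -> R) by exact: measurable_indic.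
  exact: measurableT_comp mI measurable_snd.
have mEG : measurable_fun setT (EFin \o G) by exact/measurable_EFinP.
have EG0 z : (0 <= (EFin \o G) z)%E by rewrite lee_fin.
rewrite -lee_fin EFinM pmassE//.
have <- : (\int[mu2]_z (EFin \o G) z)%E =
    ((r ^+ n)%:E * \int[mu]_x (`|u x| `^ p)%:E)%E.
  rewrite (@fubini_tonelli1 _ _ _ _ _ mu mu _ mEG EG0).
  rewrite -ge0_integralZl_EFin//; last 2 first.
  - by apply/measurable_EFinP; apply: measurable_norm_powR; exact: Lu.1.
  - by rewrite exprn_ge0// ltW.
  apply: eq_integral => x _; rewrite /fubini_F /G /=.
  under eq_integral do rewrite EFinM.
  rewrite ge0_integralZl_EFin ?powR_ge0//; last first.
    by apply/measurable_EFinP; exact: measurable_indic.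
  by rewrite (integral_indicQ mB muB) muleC.
rewrite EFinM pmassE// -ge0_integralZl_EFin//; last 2 first.
- by apply/measurable_EFinP; apply: measurable_norm_powR; exact: Lfu.1.
- exact: powR_ge0.
apply: ge0_le_integral => //.
- by apply: measurable_funeM; apply/measurable_EFinP; apply: measurable_norm_powR; exact: Lfu.1.
move=> [x y] _; rewrite /= lee_fin /G /= indicE.
have [/set_mem By|_] := boolP (y \in B); last by rewrite mulr0 mulr_ge0 ?powR_ge0.
have uy : u y = 0.
  apply: uout => /(_ (Ordinal n0)); rewrite /= in_itv/= mxE.
  by have := By (Ordinal n0); rewrite /= in_itv/= mxE; lra.
rewrite mulr1; have [Bx|/uout ->] := pselect (hcube (const_mx (- r)) (2 * r) x); last first.
  by rewrite normr0 powR0 ?gt_eqF// mulr_ge0 ?powR_ge0.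
have := @frac_diff_lower _ _ s _ p1 u x y (Num.sqrt n%:R * (3 * r)) a0.
rewrite uy subr0; apply; apply: enorm_le; first by rewrite mulr_ge0// ltW.
move=> i; have := Bx i; have := By i; rewrite /= !in_itv/= !mxE ler_norml.
by lra.
Qed.

(** An Ehrling type inequality. On a fine grid the oscillation costs an arbitrarily small multiple
    of the energy, and what remains is finitely many linear functionals. *)
Lemma interpolation (r eta : R) : 0 < r -> 0 < eta ->
  exists (K : finType) (g : K -> X -> R) (C : R),
    [/\ 0 <= C, forall k, Lpf mu p (g k) &
     forall u, (forall x, ~ hcube (const_mx (- r)) (2 * r) x -> u x = 0) ->
      Lpf mu p u -> Lpf mu2 p (frac_diff s p u) ->
      pmass mu p u <= eta * pmass mu2 p (frac_diff s p u) +
        C * \sum_k `|pform mu p (g k) u| `^ p].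
Proof.
move=> r0 eta0.
pose c := 2 `^ p * Num.sqrt n%:R `^ (n%:R + s * p) + 1.
have c0 : 0 < c by rewrite ltr_wpDl// mulr_ge0 ?powR_ge0.
(* On cubes of side h the factor delta^(n + sp) / h^n is a constant times h^(sp); [h0] is the side
   at which it reaches [eta]. *)
pose h0 := (eta / c) `^ (s * p)^-1.
have h00 : 0 < h0 by apply: powR_gt0; exact: divr_gt0.
pose m := (Num.truncn (2 * r / h0)).+1.
pose h := 2 * r / m%:R.
have m0 : 0 < m%:R :> R by rewrite ltr0n.
have h_gt0 : 0 < h by rewrite divr_gt0// mulr_gt0.
have hm : h * m%:R = 2 * r by rewrite /h mulfVK// gt_eqF.
have hh0 : h <= h0.
  rewrite ler_pdivrMr// -ler_pdivrMl// mulrC; apply: ltW; exact: truncnS_gt.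
pose Q (k : {ffun 'I_n -> 'I_m}) : set X :=
  hcube (\row_i (- r + (k i)%:R * h)) h.
have mQ k : measurable (Q k) by exact: measurable_hcube.
have muQ k : mu (Q k) = (h ^+ n)%:E by apply: lebesgue_hcube; exact: ltW.
have q0 : 0 < h ^+ n by exact: exprn_gt0.
have QE k x : Q k x <-> forall i, - r + (k i)%:R * h <= x 0 i < - r + (k i).+1%:R * h.
  by split => H i; have := H i; rewrite /= in_itv/= mxE -natr1 mulrDl mul1r addrA.
pose delta := Num.sqrt n%:R * h.
have diamQ k x y : Q k x -> Q k y -> enorm (x - y) <= delta.
  move=> /QE Qx /QE Qy; apply: enorm_le; first exact: ltW.
  move=> i; have := Qx i; have := Qy i; rewrite !mxE ler_norml -natr1.
  by lra.
have dQ k l x : Q k x -> Q l x -> k = l.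
  have lt_absurd (k' l' : {ffun 'I_n -> 'I_m}) i : Q k' x -> Q l' x ->
      (k' i < l' i)%N -> False.
    move=> /QE/(_ i)/andP[_ Qk] /QE/(_ i)/andP[Ql _] kl.
    have : (k' i).+1%:R * h <= (l' i)%:R * h by rewrite ler_pM2r// ler_nat.
    lra.
  move=> Qk Ql; apply/ffunP => i; apply/val_inj => /=.
  have [kl|lk|//] := ltngtP (k i) (l i).
    by have := lt_absurd _ _ _ Qk Ql kl.
  by have := lt_absurd _ _ _ Ql Qk lk.
have covQ x : hcube (const_mx (- r)) (2 * r) x -> exists k, Q k x.
  move=> Bx.
  have t0 i : 0 <= (x 0 i + r) / h.
    by have := Bx i; rewrite /= in_itv/= mxE => ?; rewrite divr_ge0 ?(ltW h_gt0)//; lra.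
  have tm i : (Num.truncn ((x 0 i + r) / h)%R < m)%N.
    rewrite -(ltr_nat R); have /andP[/le_lt_trans + _] := truncn_itv (t0 i).
    apply.
    rewrite ltr_pdivrMr// mulrC hm.
    by have := Bx i; rewrite /= in_itv/= mxE; lra.
  exists [ffun i => Ordinal (tm i)]; apply/QE => i; rewrite ffunE /=.
  have /andP[] := truncn_itv (t0 i).
  by rewrite ltr_pdivrMr// ler_pdivlMr//; lra.
exists {ffun 'I_n -> 'I_m}, (fun k => \1_(Q k)), (2 `^ p * (h ^+ n * (h ^+ n)^-1 `^ p)).
split.
- by rewrite !mulr_ge0 ?powR_ge0// ltW.
- by move=> k; exact: (Lpf_indicQ p1 (mQ k) (muQ k)).
move=> u uout Lu Lfu.
have covu x : u x != 0 -> exists k, Q k x.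
  by move=> ux; apply: covQ; apply: contrapT => /uout u0; move: ux; rewrite u0 eqxx.
apply: (le_trans (partition_estimate mQ muQ q0 diamQ dQ covu Lu Lfu)).
rewrite mulrDr lerD//.
  rewrite mulrA ler_wpM2r ?pmass_ge0//.
  have -> : delta `^ (n%:R + s * p) / h ^+ n =
      Num.sqrt n%:R `^ (n%:R + s * p) * h `^ (s * p).
    rewrite /delta powRM ?sqrtr_ge0 ?(ltW h_gt0)// -mulrA; congr (_ * _).
    rewrite powRD; last by rewrite (gt_eqF h_gt0) implybT.
    by rewrite powR_mulrn ?(ltW h_gt0)// mulrAC mulfV ?mul1r// gt_eqF.
  rewrite mulrA; apply: (@le_trans _ _ (c * h0 `^ (s * p))).
    apply: ler_pM; rewrite ?mulr_ge0 ?powR_ge0//; first by rewrite /c lerDl.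
    by apply: ge0_ler_powR; rewrite ?nnegrE ?(ltW sp0) ?(ltW h_gt0) ?(ltW h00).
  rewrite /h0 -powRrM mulVf ?gt_eqF// powRr1 ?divr_ge0 ?(ltW eta0) ?(ltW c0)//.
  by rewrite mulrCA mulfV ?mulr1// gt_eqF.
rewrite -!mulrA ler_wpM2l ?powR_ge0// ler_wpM2l ?(ltW q0)// mulr_sumr.
apply: ler_sum => k _; rewrite /cube_avg normrM powRM//.
by rewrite ger0_norm// invr_ge0 ltW.
Qed.

End interpolation.

(** * Limits along ultrafilters and of fast Cauchy sequences *)

Lemma ultra_limit (R : realType) (F : set_system nat) (x : nat -> R) (b : R) :
  UltraFilter F -> (forall i, `|x i| <= b) ->
  exists l, forall e : R, 0 < e -> F [set i | `|x i - l| < e].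
Proof.
move=> UF xb; have [] := @segment_compact R (- b) b (x @ F) _.
  suff : F (x @^-1` `[- b, b]%classic) by [].
  by apply: filterE => i; rewrite /= in_itv/= -ler_norml; exact: xb.
move=> l [_ xl]; exists l => e e0.
have [//|FN] := in_ultra_setVsetC [set i | `|x i - l| < e] UF.
have [] := xl [set y | ~ `|y - l| < e] (ball l e) FN (nbhsx_ballx l e e0).
by move=> y [/= yl]; rewrite /ball/= distrC.
Qed.

Section Lp_limits.
Context d {T : measurableType d} {R : realType}.
Variable mu : {measure set T -> \bar R}.
Variable p : R.
Hypothesis p1 : 1 < p.
Implicit Types g h : T -> R.

Let p0 : 0 < p. Proof. exact: lt_trans p1. Qed.

Lemma pmass_scaled_sum_le g h : Lpf mu p g -> Lpf mu p h ->
  pmass mu p (fun x => g x - h x) <= 2 `^ p * (pmass mu p g + pmass mu p h).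
Proof.
move=> Lg Lh; have Ig := Lpf_integrable Lg; have Ih := Lpf_integrable Lh.
have := Rintegral_comb (2 `^ p) (2 `^ p) Ig Ih; rewrite -mulrDr => <-.
apply: le_Rintegral => //.
- exact: (Lpf_integrable (Lpf_B p1 Lg Lh)).
- exact: integrable_comb.
- move=> x _; rewrite -mulrDr; have := powR_normD_le p1 (g x) (- h x).
  by rewrite normrN.
Qed.

Lemma geometric_half_sum n : \sum_(0 <= i < n) (2^-1 : R) ^+ i <= 2.
Proof.
suff -> : \sum_(0 <= i < n) (2^-1 : R) ^+ i = 2 - 2 * 2^-1 ^+ n.
  by rewrite gerBl mulr_ge0// exprn_ge0// invr_ge0.
elim: n => [|n IH]; first by rewrite big_geq// expr0 mulr1 subrr.
by rewrite big_nat_recr//= IH exprS; field.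
Qed.

(** The Riesz-Fischer argument. The indicator of a full set turns almost everywhere convergence into
    convergence everywhere. *)
Lemma fast_cauchy_limit (v : nat -> T -> R) : (forall i, Lpf mu p (v i)) ->
  (forall i, pmass mu p (fun x => v i.+1 x - v i x) <= (4^-1 ^+ i) `^ p) ->
  exists E : set T, [/\ measurable E, {ae mu, forall x, E x} &
    forall x, cvgn (fun i => \1_E x * v i x)].
Proof.
move=> Lv dv.
(* The weight 2^i is half way between 1 and 4^i: the integrals stay summable, and a finite sum at x
   bounds the increments there by a multiple of 2^-i. *)
pose f i x := (2 ^+ i) `^ p * `|v i.+1 x - v i x| `^ p.
have f0 i x : 0 <= f i x by rewrite mulr_ge0 ?powR_ge0.
have Lb i := Lpf_B p1 (Lv i.+1) (Lv i).
have mf i : measurable_fun setT (fun x => (f i x)%:E).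
  apply/measurable_EFinP; apply: measurable_funM; first exact: measurable_cst.
  by apply: measurable_norm_powR; exact: (Lb i).1.
pose S x := (\sum_(0 <= i <oo) (f i x)%:E)%E.
have S0 x : (0 <= S x)%E by apply: nneseries_ge0 => i _ _; rewrite lee_fin.
have mS : measurable_fun setT S.
  by apply: ge0_emeasurable_sum => // i x _ _; rewrite lee_fin.
have If i : (\int[mu]_x (f i x)%:E <= (2^-1 ^+ i)%:E)%E.
  under eq_integral do rewrite EFinM.
  rewrite ge0_integralZl_EFin ?powR_ge0//; last first.
    by apply/measurable_EFinP; apply: measurable_norm_powR; exact: (Lb i).1.
  rewrite -(pmassE (Lb i)) -EFinM lee_fin.
  apply: (@le_trans _ _ ((2^-1 ^+ i) `^ p)).
    have -> : 2^-1 ^+ i = 2 ^+ i * 4^-1 ^+ i :> R.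
      by rewrite -exprMn; congr (_ ^+ i); field.
    by rewrite powRM ?exprn_ge0 ?invr_ge0// ler_wpM2l ?powR_ge0.
  apply: ge1r_powR; last exact: ltW.
  by rewrite exprn_gt0 ?invr_gt0//= exprn_ile1 ?invr_ge0// invf_le1// ler1n.
have IS : (\int[mu]_x S x <= 2%:E)%E.
  rewrite integral_nneseries//; last by move=> i x _; rewrite lee_fin.
  apply: (lime_le (is_cvg_nneseries _)).
    by move=> i _ _; apply: integral_ge0 => x _; rewrite lee_fin.
  apply: nearW => N; apply: (@le_trans _ _ (\sum_(0 <= i < N) (2^-1 ^+ i)%:E)%E).
    exact: lee_sum.
  by rewrite sumEFin lee_fin; exact: geometric_half_sum.
have SI : mu.-integrable setT S.
  apply/integrableP; split => //; under eq_integral do rewrite gee0_abs//.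
  exact: le_lt_trans IS (ltry _).
exists [set x | S x \is a fin_num]; split.
- have := emeasurable_fin_num measurableT mS; by rewrite setTI.
- by have := integrable_ae measurableT SI; apply: filterS => x /(_ I).
move=> x; rewrite indicE.
have [/set_mem /= Sfin|_] := boolP (x \in _); last first.
  by under eq_fun do rewrite mul0r; exact: is_cvg_cst.
under eq_fun do rewrite mul1r.
pose sx := fine (S x).
have fS i : f i x <= sx.
  rewrite -lee_fin fineK//; apply: (@le_trans _ _ (\sum_(0 <= j < i.+1) (f j x)%:E)%E).
    rewrite big_nat_recr//= leeDr//; apply: sume_ge0 => j _; by rewrite lee_fin.
  by apply: nneseries_lim_ge => j _ _; rewrite lee_fin.
pose c := sx `^ p^-1.
have sx0 : 0 <= sx by exact: fine_ge0.
have dc i : `|v i.+1 x - v i x| <= geometric c 2^-1 i.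
  rewrite /geometric /= -(powR_leE p1) ?mulr_ge0 ?powR_ge0 ?exprn_ge0 ?invr_ge0//.
  rewrite powRM ?powR_ge0 ?exprn_ge0 ?invr_ge0// powR_invK//.
  have e1 : (2^-1 ^+ i) `^ p * (2 ^+ i) `^ p = 1 :> R.
    by rewrite -powRM ?exprn_ge0 ?invr_ge0// -exprMn mulVf// expr1n powR1.
  have -> : `|v i.+1 x - v i x| `^ p = f i x * (2^-1 ^+ i) `^ p.
    by rewrite /f mulrC mulrA e1 mul1r.
  by apply: ler_wpM2r; [exact: powR_ge0|exact: fS].
have cvt : cvgn (series (telescope (v ^~ x))).
  apply: normed_cvg; apply: (series_le_cvg _ _ dc).
  - by move=> i.
  - by move=> i; apply: le_trans (dc i).
  - by apply: is_cvg_geometric_series; rewrite ger0_norm ?invr_ge0// invf_lt1// ltr1n.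
move: cvt; rewrite telescopeK => cvt.
rewrite (_ : (fun i => v i x) = (fun i => (v i x - v 0%N x) + v 0%N x)); last first.
  by apply/funext => i; rewrite subrK.
by apply: is_cvgD => //; exact: is_cvg_cst.
Qed.

End Lp_limits.

(** * The compact embedding *)

Section compact_embedding.
Context {R : realType} {n : nat}.
Variables (s p r : R) (A : set 'rV[R]_n).
Hypothesis p1 : 1 < p.
Hypothesis s0 : 0 < s.
Hypothesis r0 : 0 < r.
Hypothesis n0 : (0 < n)%N.
Hypothesis Ar : A `<=` hcube (const_mx (- r)) (2 * r).

Local Notation X := 'rV[R]_n.
Local Notation mu := (lebesgue_rV R n).
Local Notation mu2 := (lebesgue_rV R n \x lebesgue_rV R n)%E.
Local Notation fd := (frac_diff s p).
Implicit Types u v : X -> R.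

Let p0 : 0 < p. Proof. exact: lt_trans p1. Qed.

Definition frac_space (u : X -> R) := [/\ forall x, ~ A x -> u x = 0,
  Lpf mu p u & Lpf mu2 p (fd u)].

Lemma ae_prod (E : set X) : measurable E -> {ae mu, forall x, E x} ->
  {ae mu2, forall z, E z.1 /\ E z.2}.
Proof.
move=> mE [B [mB B0 EB]].
have nul : mu (~` E) = 0%E.
  apply/eqP; rewrite -measure_le0 -[X in (_ <= X)%E]B0; apply: le_measure.
  - by rewrite inE; exact: measurableC.
  - by rewrite inE.
  - by move=> x nE; exact: EB.
exists ((~` E) `*` setT `|` setT `*` (~` E)); split.
- by apply: measurableU; apply: measurableX => //; exact: measurableC.
- apply/eqP; rewrite -measure_le0; apply: (le_trans (measureU2 _ _ _)).
  + by apply: measurableX => //; exact: measurableC.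
  + by apply: measurableX => //; exact: measurableC.
  have h1 : mu2 (~` E `*` setT) = 0%E.
    rewrite (product_measure1E mu mu (measurableC mE) measurableT).
    by rewrite [X in (X * _)%E](_ : _ = 0%E); [rewrite mul0e|exact: nul].
  have h2 : mu2 (setT `*` ~` E) = 0%E.
    rewrite (product_measure1E mu mu measurableT (measurableC mE)).
    by rewrite [X in (_ * X)%E](_ : _ = 0%E); [rewrite mule0|exact: nul].
  rewrite [X in (X + _ <= _)%E](_ : _ = 0%E); last exact: h1.
  by rewrite [X in (_ + X <= _)%E](_ : _ = 0%E); [rewrite adde0|exact: h2].
- move=> [x y] /= /not_andP[nx|ny]; [by left|by right].
Qed.

Lemma frac_space_lin (a : R) u v : frac_space u -> frac_space v ->
  frac_space (fun x => a * u x + v x).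
Proof.
move=> [u0 Lu Lfu] [v0 Lv Lfv]; split.
- by move=> x Ax; rewrite u0// v0// mulr0 addr0.
- exact: Lpf_lin.
- by rewrite frac_diff_lin; exact: Lpf_lin.
Qed.

Lemma frac_space_B u v : frac_space u -> frac_space v ->
  frac_space (fun x => u x - v x).
Proof.
move=> Wu Wv; have := frac_space_lin (-1) Wv Wu.
by under eq_fun do rewrite mulN1r addrC.
Qed.

Lemma frac_diffB u v : fd (fun x => u x - v x) = (fun z => fd u z - fd v z).
Proof. by apply/funext => z; rewrite /frac_diff; ring. Qed.

Lemma poincare_constant : exists2 c : R, 0 <= c & forall u, frac_space u ->
  pmass mu p u <= c * pmass mu2 p (fd u).
Proof.
have rn : 0 < r ^+ n by exact: exprn_gt0.
exists ((Num.sqrt n%:R * (3 * r)) `^ (n%:R + s * p) / r ^+ n).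
  by rewrite divr_ge0 ?powR_ge0// ltW.
move=> u [u0 Lu Lfu]; rewrite mulrAC ler_pdivlMr// mulrC.
apply: poincare => // x nx; apply: u0; by apply: contra_not nx; exact: Ar.
Qed.

(** Each [eta] involves its own finite family of functionals. All of them converge along one
    ultrafilter, which replaces a diagonal extraction. *)
Lemma ultra_cauchy (u_ : nat -> X -> R) (B : R) :
  (forall i, frac_space (u_ i) /\ pmass mu2 p (fd (u_ i)) <= B) ->
  exists F : set_system nat, [/\ UltraFilter F, \oo `<=` F &
    forall eta : R, 0 < eta -> exists2 D, F D & forall i j, D i -> D j ->
      pmass mu p (fun x => u_ i x - u_ j x) < eta].
Proof.
move=> Hu; have Wu i := (Hu i).1.
have [F [UF oF]] := ultraFilterLemma eventually_filter.
exists F; split => // eta eta0.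
have B0 : 0 <= B by apply: le_trans (Hu 0%N).2; exact: pmass_ge0.
pose B2 := 2 `^ p * (B + B).
have B20 : 0 <= B2 by rewrite mulr_ge0 ?powR_ge0 ?addr_ge0.
pose eta1 := eta / (2 * (B2 + 1)).
have eta10 : 0 < eta1 by rewrite divr_gt0// mulr_gt0// ltr_wpDl.
have [K [g [C [C0 Lg HC]]]] := interpolation (n := n) p1 s0 r0 eta10.
have [c c0 Hc] := poincare_constant.
pose b k := pnorm mu p (g k) `^ (p - 1) * (c * B) `^ p^-1.
have bnd k i : `|pform mu p (g k) (u_ i)| <= b k.
  have [_ Lu _] := Wu i; apply: (le_trans (pform_le p1 (Lg k) Lu)).
  rewrite ler_wpM2l ?powR_ge0// /pnorm.
  apply: ge0_ler_powR; rewrite ?nnegrE ?invr_ge0 ?(ltW p0) ?pmass_ge0 ?mulr_ge0//.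
  apply: (le_trans (Hc _ (Wu i))); rewrite ler_wpM2l//; exact: (Hu i).2.
have /choice[l Hl] k : exists l, forall e : R, 0 < e ->
    F [set i | `|pform mu p (g k) (u_ i) - l| < e].
  exact: ultra_limit UF (bnd k).
pose e2 := eta / (2 * (C * #|K|%:R + 1)).
have CK : 0 <= C * #|K|%:R by rewrite mulr_ge0.
have e20 : 0 < e2 by rewrite divr_gt0// mulr_gt0// ltr_wpDl.
pose e := e2 `^ p^-1 / 2.
have e0 : 0 < e by rewrite divr_gt0// powR_gt0.
exists [set i | forall k, `|pform mu p (g k) (u_ i) - l k| < e].
  apply: (@filter_forall _ _ (fun k i => `|pform mu p (g k) (u_ i) - l k| < e) F) => k.
  exact: Hl.
move=> i j Di Dj.
have [z0 Lz Lfz] := frac_space_B (Wu i) (Wu j).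
have zr x : ~ hcube (const_mx (- r)) (2 * r) x -> u_ i x - u_ j x = 0.
  by move=> nx; apply: z0; apply: contra_not nx; exact: Ar.
apply: (le_lt_trans (HC _ zr Lz Lfz)).
have H1 : pmass mu2 p (fd (fun x => u_ i x - u_ j x)) <= B2.
  have [_ _ Lfi] := Wu i; have [_ _ Lfj] := Wu j.
  rewrite frac_diffB; apply: (le_trans (pmass_scaled_sum_le p1 Lfi Lfj)).
  apply: ler_wpM2l; first exact: powR_ge0.
  exact: lerD (Hu i).2 (Hu j).2.
have H2 k : `|pform mu p (g k) (fun x => u_ i x - u_ j x)| `^ p <= e2.
  have [_ Lui _] := Wu i; have [_ Luj _] := Wu j.
  rewrite -[leRHS](powR_invK p1) ?(ltW e20)//; apply: powR_le => //.
  have -> : pform mu p (g k) (fun x => u_ i x - u_ j x) =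
      pform mu p (g k) (u_ i) - pform mu p (g k) (u_ j).
    have := pform_lin p1 (-1) (Lg k) Luj Lui.
    under [X in pform _ _ _ X]eq_fun do rewrite mulN1r addrC.
    by move=> ->; rewrite mulN1r addrC.
  have -> : e2 `^ p^-1 = e + e by rewrite /e -splitr.
  have := Di k; have := Dj k.
  move: (pform _ _ _ _) (pform _ _ _ _) (l k) => a1 a2 a3 h1 h2.
  by apply: (le_trans (ler_distD a3 _ _)); rewrite (distrC a3) lerD// ltW.
have H3 : \sum_k `|pform mu p (g k) (fun x => u_ i x - u_ j x)| `^ p <=
    #|K|%:R * e2.
  by rewrite mulr_natl -sumr_const; apply: ler_sum => k _; exact: H2.
apply: (@le_lt_trans _ _ (eta1 * B2 + C * (#|K|%:R * e2))).
  by apply: lerD; [rewrite ler_wpM2l// ltW|rewrite ler_wpM2l].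
have E1 : eta = 2 * (B2 + 1) * eta1.
  by rewrite /eta1 mulrC mulfVK// gt_eqF// mulr_gt0// ltr_wpDl.
have E2 : eta = 2 * (C * #|K|%:R + 1) * e2.
  by rewrite /e2 mulrC mulfVK// gt_eqF// mulr_gt0// ltr_wpDl.
clear -E1 E2 eta10 e20; clearbody eta1 e2 B2.
by rewrite mulrA; move: (C * _) E2 => CK E2; lra.
Qed.

(** Indices picked in the sets of the ultrafilter give a fast Cauchy sequence. Fatou's lemma then
    yields both the convergence of p-masses and, on pairs of points, the lower semicontinuity. *)
Theorem frac_space_compact (u_ : nat -> X -> R) (B : R) :
  (forall i, frac_space (u_ i) /\ pmass mu2 p (fd (u_ i)) <= B) ->
  exists (k : nat -> nat) (u : X -> R), [/\ forall i, (i <= k i)%N, frac_space u,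
    forall e : R, 0 < e -> exists i0, forall i, (i0 <= i)%N ->
      pmass mu p (fun x => u_ (k i) x - u x) < e &
    forall v c, frac_space v -> (exists i0, forall i, (i0 <= i)%N ->
        pmass mu2 p (fd (fun x => u_ (k i) x - v x)) <= c) ->
      pmass mu2 p (fd (fun x => u x - v x)) <= c].
Proof.
move=> Hu; have [F [UF oF HF]] := ultra_cauchy Hu.
pose eta i := (4^-1 ^+ i : R) `^ p.
have eta0 i : 0 < eta i by apply: powR_gt0; rewrite exprn_gt0// invr_gt0.
have /choice[D HD] i : exists D, F D /\ forall i1 i2, D i1 -> D i2 ->
    pmass mu p (fun x => u_ i1 x - u_ i2 x) < eta i.
  by have [D FD HD] := HF _ (eta0 i); exists D.
(* [k i] lies in the sets of all levels up to i, so that any later index is comparable with it at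
   level i. *)
have /choice[k Hk] i : exists j, (i <= j)%N /\ forall l, (l <= i)%N -> D l j.
  have F1 : F [set j | (i <= j)%N] by apply: oF; exists i.
  have F2 : F [set j | forall l : 'I_i.+1, D l j].
    by apply: (@filter_forall _ _ (fun (l : 'I_i.+1) j => D l j) F) => l; exact: (HD l).1.
  have [j [ij Dj]] := filter_ex (filterI F1 F2).
  by exists j; split => // l li; exact: (Dj (Ordinal (li : (l < i.+1)%N))).
pose v i := u_ (k i).
have Wv i : frac_space (v i) := (Hu (k i)).1.
have Lv i : Lpf mu p (v i) by have [] := Wv i.
have vv i j : (i <= j)%N -> pmass mu p (fun x => v j x - v i x) < eta i.
  by move=> ij; apply: (HD i).2; [exact: (Hk j).2|exact: (Hk i).2].
have [E [mE aeE cE]] := fast_cauchy_limit p1 Lv (fun i => ltW (vv i i.+1 (leqnSn i))).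
(* A version of [v i] converging everywhere; it agrees with [v i] almost everywhere, and hence so do
   the differences at almost every pair. *)
pose w i x := \1_E x * v i x.
pose u x := limn (fun i => w i x).
have wu x : w i x @[i --> \oo] --> u x by exact: cE.
have mI : measurable_fun setT (\1_E : X -> R) by exact: measurable_indic.
have mw i : measurable_fun setT (w i).
  by apply: measurable_funM => //; exact: (Lv i).1.
have mu' : measurable_fun setT u by apply: measurable_fun_cvg => // x _; exact: wu.
have vw i : {ae mu, forall x, v i x = w i x}.
  by apply: filterS aeE => x Ex; rewrite /w indicE mem_set// mul1r.
have aeE2 := ae_prod mE aeE.
have vw2 i (h : X -> R) : {ae mu2, forall z,
    fd (fun x => v i x - h x) z = fd (fun x => w i x - h x) z}.
  by apply: filterS aeE2 => z [E1 E2]; rewrite /frac_diff /w !indicE !mem_set// !mul1r.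
have A0 x : ~ A x -> u x = 0.
  move=> nA; apply: cvg_lim => //; rewrite (_ : (fun i => w i x) = fun=> 0).
    exact: cvg_cst.
  by apply/funext => i; have [v0 _ _] := Wv i; rewrite /w v0// mulr0.
have fatou2 h c : Lpf mu2 p (fd h) -> measurable_fun setT h ->
    (exists i0, forall i, (i0 <= i)%N -> pmass mu2 p (fd (fun x => v i x - h x)) <= c) ->
    Lpf mu2 p (fd (fun x => u x - h x)) /\ pmass mu2 p (fd (fun x => u x - h x)) <= c.
  move=> Lh mh [i0 Hi0].
  have Lvh i : Lpf mu2 p (fd (fun x => v i x - h x)).
    by have [_ _ Lf] := Wv i; rewrite frac_diffB; exact: (Lpf_B p1 Lf Lh).
  have Lwh i := eq_pmass (vw2 i h)
    (measurable_frac_diff s p (measurable_funB (mw i) mh)) (Lvh i).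
  apply: (pmass_fatou p1 (fun i => (Lwh i).1)).
  - by apply: measurable_frac_diff; exact: measurable_funB.
  - move=> z; apply: cvgMl; apply: cvgB; apply: cvgB;
      [exact: wu|exact: cvg_cst|exact: wu|exact: cvg_cst].
  - by exists i0; [|move=> i /= i0i; rewrite (Lwh i).2; exact: (Hi0 i i0i)].
have L0 : Lpf mu2 p (fd (fun=> 0)).
  rewrite (_ : fd _ = fun=> 0); first exact: Lpf_0.
  by apply/funext => z; rewrite /frac_diff subrr mul0r.
have sub0 (f : X -> R) : (fun x => f x - 0) = f by apply/funext => x; rewrite subr0.
have Lu2 : Lpf mu2 p (fd u).
  have := (fatou2 (fun=> 0) B L0 (measurable_cst _) _).1; rewrite sub0; apply.
  by exists 0%N => i _; rewrite sub0; exact: (Hu (k i)).2.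
have fatou1 j : Lpf mu p (fun x => u x - v j x) /\
    pmass mu p (fun x => u x - v j x) <= eta j.
  have Lwj' i : Lpf mu p (fun x => w i x - v j x) /\
      pmass mu p (fun x => w i x - v j x) = pmass mu p (fun x => v i x - v j x).
    apply: eq_pmass; last exact: (Lpf_B p1 (Lv i) (Lv j)).
      by apply: filterS (vw i) => x ->.
    by apply: measurable_funB => //; exact: (Lv j).1.
  apply: (pmass_fatou p1 (fun i => (Lwj' i).1)).
  - by apply: measurable_funB => //; exact: (Lv j).1.
  - by move=> x; apply: cvgB; [exact: wu|exact: cvg_cst].
  - by exists j => // i /= ji; rewrite (Lwj' i).2; exact/ltW/vv.
have Lu1 : Lpf mu p u.
  have := Lpf_D p1 (fatou1 0%N).1 (Lv 0%N).
  by under [X in Lpf _ _ X]eq_fun do rewrite subrK.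
have Wu : frac_space u by split.
exists k, u; split => //.
- by move=> i; exact: (Hk i).1.
- move=> e e0.
  have e1 : 0 < e `^ p^-1 by exact: powR_gt0.
  have q1 : `|4^-1 : R| < 1 by rewrite ger0_norm ?invr_ge0// invf_lt1// ltr1n.
  have [i0 _ Hi0] := cvgr_lt _ (cvg_expr q1) _ e1.
  exists i0 => i i0i.
  have -> : pmass mu p (fun x => u_ (k i) x - u x) = pmass mu p (fun x => u x - v i x).
    by apply: eq_Rintegral => x _; rewrite distrC.
  apply: (le_lt_trans (fatou1 i).2); rewrite -[ltRHS](powR_invK p1) ?(ltW e0)//.
  by apply: powR_lt => //; exact: Hi0.
- move=> h c [_ Lh Lfh] Hh; exact: (fatou2 h c Lfh Lh.1 Hh).2.
Qed.

End compact_embedding.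

(** * The normalizing constant *)

(* An alias on which every set is measurable, so that the library's [mu_ext]
   computes infima over arbitrary covers. *)
Definition discrete_rV (R : realType) n := 'rV[R]_n.

HB.instance Definition _ (R : realType) n := Pointed.on (discrete_rV R n).
HB.instance Definition _ (R : realType) n := @isMeasurable.Build
  default_measure_display (discrete_rV R n) discrete_measurable
  discrete_measurable0 discrete_measurableC discrete_measurableU.

(** * Hausdorff measure as a metric outer measure *)

Section hausdorff_outer.
Context {R : realType} {n : nat} (d : nat).
Implicit Types A B : set 'rV[R]_n.
Local Open Scope ereal_scope.

Lemma ball_volume_ge0 : 0 <= ball_volume d :> \bar R.
Proof. exact: measure_ge0. Qed.

Lemma diam_ge0 A : A !=set0 -> 0 <= diam A.
Proof.
move=> [x Ax]; apply: (@le_trans _ _ (enorm (x - x))%:E).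
  by rewrite lee_fin enorm_ge0.
by apply: ereal_sup_ubound; exists x => //; exists x.
Qed.

Lemma diam_le A (c : R) : (forall x y, A x -> A y -> (enorm (x - y) <= c)%R) ->
  diam A <= c%:E.
Proof.
move=> H; apply: ge_ereal_sup => _ [x Ax [y Ay <-]].
by rewrite lee_fin; exact: H.
Qed.

Lemma enorm_le_diam A x y (c : R) : diam A <= c%:E -> A x -> A y ->
  (enorm (x - y) <= c)%R.
Proof.
move=> Ac Ax Ay; rewrite -lee_fin; apply: le_trans Ac.
by apply: ereal_sup_ubound; exists x => //; exists y.
Qed.

Lemma hausdorff_weight0 : hausdorff_weight d (@set0 'rV[R]_n) = 0.
Proof. by rewrite /hausdorff_weight ifT//; apply/asboolP. Qed.

Lemma hausdorff_weight_ge0 A : 0 <= hausdorff_weight d A.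
Proof.
rewrite /hausdorff_weight; case: ifPn => // /asboolPn/eqP/set0P/diam_ge0 A0.
by rewrite mule_ge0 ?ball_volume_ge0// lee_fin exprn_ge0// divr_ge0// fine_ge0.
Qed.

(** The infinite value moves the restriction on diameters from the covers into the weight, as
    required to recognize [mu_ext]. *)
Definition capped_weight (delta : R) (A : set (discrete_rV R n)) : \bar R :=
  if diam (A : set 'rV[R]_n) <= delta%:E then hausdorff_weight d (A : set 'rV[R]_n)
  else +oo.

Lemma diam_set0 (delta : R) : diam (@set0 'rV[R]_n) <= delta%:E.
Proof. by apply: diam_le. Qed.

Lemma capped_weight0 delta : capped_weight delta set0 = 0.
Proof. by rewrite /capped_weight diam_set0 hausdorff_weight0. Qed.

Lemma capped_weight_ge0 delta A : 0 <= capped_weight delta A.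
Proof.
by rewrite /capped_weight; case: ifPn => // _; exact: hausdorff_weight_ge0.
Qed.

Lemma hausdorff_deltaE (delta : R) A :
  hausdorff_delta d delta A = mu_ext (capped_weight delta) A.
Proof.
apply/eqP; rewrite eq_le; apply/andP; split.
  apply: le_ereal_inf_tmp => _ [F [_ AF] <-].
  have [[k nk]|H] := pselect (exists k, ~ (diam (F k : set 'rV[R]_n) <= delta%:E)).
    rewrite (nneseries_pinfty (k := k)) ?leey//.
      by move=> j _; exact: capped_weight_ge0.
    by rewrite /capped_weight ifF//; apply/negP.
  have Fd k : diam (F k : set 'rV[R]_n) <= delta%:E.
    by apply: contrapT => nk; apply: H; exists k.
  apply: ereal_inf_lbound; exists F; first by split.
  by apply: eq_eseriesr => k _; rewrite /capped_weight Fd.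
apply: le_ereal_inf_tmp => _ [F [AF Fd] <-].
apply: ereal_inf_lbound; exists F; first by split.
by apply: eq_eseriesr => k _; rewrite /capped_weight Fd.
Qed.

Lemma hausdorff_delta_le A (delta : R) : (0 < delta)%R ->
  hausdorff_delta d delta A <= hausdorff d A.
Proof. by move=> d0; apply: ereal_sup_ubound; exists delta. Qed.

Lemma hausdorff_delta_ge0 (delta : R) A : 0 <= hausdorff_delta d delta A.
Proof. by rewrite hausdorff_deltaE; apply: mu_ext_ge0 => B; exact: capped_weight_ge0. Qed.

Lemma hausdorff_delta_anti A (d1 d2 : R) : (d1 <= d2)%R ->
  hausdorff_delta d d2 A <= hausdorff_delta d d1 A.
Proof.
move=> d12; apply: ereal_inf_le_tmp => _ [F [AF Fd] <-]; exists F => //; split => // k.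
by apply: (le_trans (Fd k)); rewrite lee_fin.
Qed.

Lemma hausdorff_ge0 A : 0 <= hausdorff d A.
Proof.
exact: le_trans (hausdorff_delta_ge0 1 A) (hausdorff_delta_le A ltr01).
Qed.

Lemma hausdorff_set0 : hausdorff d (@set0 'rV[R]_n) = 0.
Proof.
apply/eqP; rewrite eq_le hausdorff_ge0 andbT.
apply: ge_ereal_sup => _ [delta _ <-]; rewrite hausdorff_deltaE mu_ext0//.
  exact: capped_weight0.
by move=> B; exact: capped_weight_ge0.
Qed.

Lemma le_hausdorff : {homo @hausdorff R n d : A B / A `<=` B >-> A <= B}.
Proof.
move=> A B AB; apply: ge_ereal_sup => _ [delta d0 <-].
apply: le_trans (hausdorff_delta_le B d0); rewrite !hausdorff_deltaE.
exact: le_mu_ext.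
Qed.

Lemma hausdorff_sigma_subadditive : sigma_subadditive (@hausdorff R n d).
Proof.
move=> F; apply: ge_ereal_sup => _ [delta d0 <-].
rewrite hausdorff_deltaE.
have sub := @mu_ext_sigma_subadditive _ (discrete_rV R n) R
  (capped_weight delta) (capped_weight_ge0 delta) F.
apply: (le_trans sub).
apply: lee_nneseries => [k *|k *].
  by apply: mu_ext_ge0 => B; exact: capped_weight_ge0.
by rewrite -hausdorff_deltaE; exact: hausdorff_delta_le.
Qed.

HB.instance Definition _ := isOuterMeasure.Build R 'rV[R]_n (@hausdorff R n d)
  hausdorff_set0 hausdorff_ge0 le_hausdorff hausdorff_sigma_subadditive.

(** In a cover of diameter below [eta] no set meets both A and B, so the cover splits into one for A
    and one for B. *)
Lemma hausdorff_metric A B (eta : R) : (0 < eta)%R ->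
  (forall x y, A x -> B y -> (eta <= enorm (x - y))%R) ->
  hausdorff d A + hausdorff d B <= hausdorff d (A `|` B).
Proof.
move=> eta0 AB.
have H1 (delta : R) : (0 < delta)%R -> (delta < eta)%R ->
    hausdorff_delta d delta A + hausdorff_delta d delta B <=
    hausdorff d (A `|` B).
  move=> d0 de; apply: le_trans (hausdorff_delta_le _ d0).
  apply: le_ereal_inf_tmp => _ [F [ABF Fd] <-].
  pose sel (C : set 'rV[R]_n) k := if `[< F k `&` C !=set0 >] then F k else set0.
  have selP C : C `<=` A `|` B -> hausdorff_delta d delta C <=
      \sum_(0 <= k <oo) hausdorff_weight d (sel C k).
    move=> CAB; apply: ereal_inf_lbound; exists (sel C) => //; split.
      move=> x Cx; have [k _ Fkx] := ABF _ (CAB _ Cx); exists k => //.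
      by rewrite /sel ifT//; apply/asboolP; exists x.
    by move=> k; rewrite /sel; case: ifPn => // _; exact: diam_set0.
  have w0 C k : 0 <= hausdorff_weight d (sel C k) by exact: hausdorff_weight_ge0.
  apply: (le_trans (leeD (selP A _) (selP B _))); [by left|by right|].
  rewrite -nneseriesD//; apply: lee_nneseries => [k *|k *].
    exact: adde_ge0.
  rewrite /sel; case: asboolP => [[x [Fx Ax]]|_]; last first.
    rewrite hausdorff_weight0 add0e; case: asboolP => // _.
    by rewrite hausdorff_weight0; exact: hausdorff_weight_ge0.
  rewrite ifF ?hausdorff_weight0 ?adde0//; apply/asboolPn => -[y [Fy By]].
  by have := AB _ _ Ax By; rewrite leNgt (le_lt_trans (enorm_le_diam (Fd k) Fx Fy)).
have [ABoo|] := ltP (hausdorff d (A `|` B)) +oo; last by rewrite leye_eq => /eqP ->; exact: leey.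
set c := hausdorff d (A `|` B) in ABoo H1 *.
have cfin : c \is a fin_num by rewrite ge0_fin_numE// hausdorff_ge0.
have fin C : C `<=` A `|` B -> hausdorff d C \is a fin_num.
  move=> CAB; rewrite ge0_fin_numE ?hausdorff_ge0//.
  exact: le_lt_trans (le_hausdorff CAB) ABoo.
have finA : hausdorff d A \is a fin_num by apply: fin; left.
have findelta C delta : (0 < delta)%R -> C `<=` A `|` B ->
    hausdorff_delta d delta C \is a fin_num.
  move=> d0 /fin; rewrite !ge0_fin_numE ?hausdorff_ge0 ?hausdorff_delta_ge0//.
  exact: le_lt_trans (hausdorff_delta_le _ d0).
(* Independent scales, reduced to a common smaller one, allow the two suprema to be taken one after
   the other. *)
have H2 (d1 d2 : R) : (0 < d1)%R -> (0 < d2)%R ->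
    hausdorff_delta d d1 A + hausdorff_delta d d2 B <= c.
  move=> d10 d20; pose m := Num.min (Num.min d1 d2) (eta / 2)%R.
  have m0 : (0 < m)%R by rewrite !lt_min d10 d20 divr_gt0.
  have me : (m < eta)%R.
    by rewrite gt_min ltr_pdivrMr// ltr_pMr// ltr1n orbT.
  apply: le_trans (H1 m m0 me); apply: leeD; apply: hausdorff_delta_anti.
    by rewrite !ge_min lexx.
  by rewrite !ge_min lexx orbT.
rewrite addeC -leeBrDr//; apply: ge_ereal_sup => _ [d2 d20 <-].
rewrite leeBrDr// addeC -leeBrDr; last by apply: findelta => //; right.
apply: ge_ereal_sup => _ [d1 d10 <-].
rewrite leeBrDr; last by apply: findelta => //; right.
exact: H2.
Qed.

End hausdorff_outer.

Lemma sum_even_odd (R : realType) (g : nat -> \bar R) m :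
  (\sum_(0 <= i < 2 * m) g i =
   \sum_(i < m) g (2 * i + 0)%N + \sum_(i < m) g (2 * i + 1)%N)%E.
Proof.
elim: m => [|m IH]; first by rewrite !big_ord0 big_geq// adde0.
have -> : (2 * m.+1 = (2 * m).+2)%N by lia.
rewrite !big_nat_recr//= IH !big_ord_recr/= !addn0 addn1.
by rewrite -!addeA; congr (_ + _)%E; rewrite addeCA.
Qed.

(** * Additivity on Borel sets by Caratheodory's criterion *)

Section hausdorff_borel.
Context {R : realType} {n : nat} (d : nat).
Local Notation H := (@hausdorff R n d).
Implicit Types A B X : set 'rV[R]_n.
Local Open Scope ereal_scope.

Lemma hausdorff_gap A B (j : 'I_n) (c1 c2 : R) : (c1 < c2)%R ->
  (forall x, A x -> (c2 <= x 0 j)%R) -> (forall x, B x -> (x 0 j <= c1)%R) ->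
  H A + H B <= H (A `|` B).
Proof.
move=> c12 Ac Bc; apply: (@hausdorff_metric R n d A B (c2 - c1)%R).
  by rewrite subr_gt0.
move=> x y Ax By; apply: le_trans (coord_le_enorm _ j).
rewrite !mxE; apply: le_trans (ler_norm _).
by have := Ac _ Ax; have := Bc _ By; lra.
Qed.

Section halfspace.
Variables (j : 'I_n) (a : R) (X : set 'rV[R]_n).
Hypothesis Xoo : H X < +oo.

(** Levels decreasing to a. The bands [B k] between consecutive levels exhaust the part of the
    half-space below t 0, and a tail of them separates it from its complement. *)
Let t (k : nat) : R := (a + harmonic k)%R.
Let S := [set x : 'rV[R]_n | (a < x 0 j)%R].
Let B k := X `&` [set x | (t k.+1 < x 0 j <= t k)%R].

Let t_anti k l : (k <= l)%N -> (t l <= t k)%R.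
Proof. by move=> kl; rewrite lerD2l /harmonic lef_pV2 ?posrE// ler_nat ltnS. Qed.

Let t_lt k l : (k < l)%N -> (t l < t k)%R.
Proof. by move=> kl; rewrite ltrD2l /harmonic ltf_pV2 ?posrE// ltr_nat ltnS. Qed.

Let a_lt k : (a < t k)%R. Proof. by rewrite ltrDl invr_gt0. Qed.

(** Bands of equal parity have a whole band between them, hence positive distance, so their measures
    add up inside X. *)
Let sum_alternate (e m : nat) : \sum_(i < m) H (B (2 * i + e)) <= H X.
Proof.
pose V m := X `&` [set x | exists2 k, (k < m)%N & (t (2 * k + e).+1 < x 0 j)%R].
suff : \sum_(i < m) H (B (2 * i + e)) <= H (V m).
  by move=> /le_trans; apply; apply: le_hausdorff; exact: subIsetl.
elim: m => [|m IH]; first by rewrite big_ord0; exact: hausdorff_ge0.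
rewrite big_ord_recr /=; apply: (le_trans (leeD2r _ IH)).
apply: (@le_trans _ _ (H (V m `|` B (2 * m + e)))); last first.
  apply: le_hausdorff => x [[Xx [k km tk]]|[Xx /andP[tx _]]]; split => //.
    by exists k => //; exact: leqW.
  by exists m.
case: m {IH} => [|m].
  apply: (@hausdorff_metric R n d _ _ 1%R) => // x y [_ [k]]; by rewrite ltn0.
apply: (@hausdorff_gap _ _ j (t (2 * m.+1 + e)) (t (2 * m + e).+1)).
- by apply: t_lt; lia.
- move=> x [_ [k km /ltW]]; apply: le_trans; apply: t_anti; lia.
- by move=> x [_ /andP[]].
Qed.

Let sum_bands : \sum_(0 <= i <oo) H (B i) < +oo.
Proof.
apply: (@le_lt_trans _ _ (H X + H X)); last by rewrite lte_add_pinfty.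
have B0 i : 0 <= H (B i) by exact: hausdorff_ge0.
apply: lime_le; first by apply: is_cvg_nneseries.
apply: nearW => m; apply: (@le_trans _ _ (\sum_(0 <= i < 2 * m) H (B i))).
  by apply: lee_sum_nneg_natr => //; lia.
apply: le_trans (leeD (sum_alternate 0 m) (sum_alternate 1 m)).
by rewrite sum_even_odd.
Qed.

(** The part above level t m is at positive distance from the complement; the rest of the half-space
    is covered by the bands from m on, whose total measure is the tail of a convergent series. *)
Let half_le m : H (X `&` S) + H (X `&` ~` S) <= H X + \sum_(m <= i <oo) H (B i).
Proof.
pose T := X `&` [set x | (t m < x 0 j)%R].
have TS : H T + H (X `&` ~` S) <= H X.
  apply: le_trans (_ : H (T `|` X `&` ~` S) <= _).
    apply: (@hausdorff_gap _ _ j a (t m)) => //.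
      by move=> x [_ /ltW].
    by move=> x [_ /negP]; rewrite -leNgt.
  by apply: le_hausdorff => x [[]|[]].
apply: le_trans (leeD2r _ TS); rewrite addeAC; apply: leeD2r.
rewrite -nneseries_addn; last by move=> i; exact: hausdorff_ge0.
apply: (@le_trans _ _ (H (T `|` \bigcup_i B (i + m)))).
  apply: le_hausdorff => x [Xx Sx].
  have [tx|xt] := ltP (t m) (x 0%R j); first by left.
  right; have ex : exists i, (t i.+1 < x 0 j)%R.
    have e0 : (0 < x 0 j - a)%R by rewrite subr_gt0.
    have [N _ HN] := cvgr_lt _ (@cvg_harmonic R) _ e0.
    by exists N; rewrite /t -ltrBrDl; exact: (HN N.+1 (leqnSn N)).
  case: (ex_minnP ex) => i ti imin.
  have mi : (m <= i)%N.
    rewrite leqNgt; apply/negP => im; have := t_anti im; lra.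
  exists (i - m)%N => //; rewrite subnK//; split => //; apply/andP; split => //.
  case: i ti imin mi => [|i] ti imin mi; first by move: mi;
    rewrite leqn0 => /eqP m0; move: xt; rewrite m0.
  by rewrite leNgt; apply/negP => /imin; rewrite ltnn.
apply: le_trans (outer_measureU2 H _ _) _; apply: leeD => //.
exact: hausdorff_sigma_subadditive.
Qed.

Lemma halfspace_le : H (X `&` S) + H (X `&` ~` S) <= H X.
Proof.
apply/lee_addgt0Pr => e e0.
have B0 k : 0 <= H (B k) by exact: hausdorff_ge0.
have := nneseries_tail_cvg sum_bands (fun k _ => B0 k).
move=> /fine_cvgP[fin /cvgr_lt/(_ _ e0) lt].
have [m []] := filter_ex (filterI fin lt).
move=> finm ltm; apply: le_trans (half_le m) _.
by rewrite leeD2l// -(fineK finm) lee_fin ltW.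
Qed.

End halfspace.

Lemma halfspace_caratheodory (j : 'I_n) (a : R) :
  H.-caratheodory [set x : 'rV[R]_n | (a < x 0 j)%R].
Proof.
apply: le_caratheodory_measurable => X.
have [Xoo|] := ltP (H X) +oo; first exact: halfspace_le.
by rewrite leye_eq => /eqP HX; rewrite [leRHS](_ : _ = +oo); [exact: leey|exact: HX].
Qed.

(** The half-spaces make every coordinate measurable for the Caratheodory sigma-algebra, and the
    coordinates generate the Borel sets. *)
Lemma borel_caratheodory A : measurable A -> H.-caratheodory A.
Proof.
have H1 (j : 'I_n) : measurable_fun setT
    (fun x : caratheodory_type H => (x : 'rV[R]_n) 0%R j).
  apply: (measurability _ (RGenOInfty.measurableE R)) => _ [_ [a ->] <-].
  rewrite setTI (_ : _ @^-1` _ = [set x : 'rV[R]_n | (a < x 0 j)%R]).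
    exact: halfspace_caratheodory.
  by apply/seteqP; split => x /=; rewrite in_itv/= andbT.
move: A; apply: smallest_sub.
  split.
  - exact: caratheodory_measurable_set0.
  - by move=> B mB; rewrite setTD; exact: caratheodory_measurable_setC.
  - exact: caratheodory_measurable_bigcup.
move=> _ [i [j [B [mB ->]]]]; rewrite (ord1 i).
by have := H1 j measurableT _ mB; rewrite setTI.
Qed.

Lemma hausdorff_semi_sigma_additive : semi_sigma_additive H.
Proof.
move=> F mF tF mUF.
apply: (@caratheodory_measure_sigma_additive R 'rV[R]_n H F) => //.
  by move=> i; exact: borel_caratheodory.
exact: borel_caratheodory.
Qed.

End hausdorff_borel.

HB.instance Definition _ (R : realType) n d :=
  isMeasure.Build _ 'rV[R]_n R (@hausdorff R n d)
    (hausdorff_set0 d) (@hausdorff_ge0 R n d)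
    (@hausdorff_semi_sigma_additive R n d).

Section ball_volume.
Context {R : realType} (d : nat).

Lemma ball_volume_fin_gt0 : exists2 w : R, 0 < w & ball_volume d = w%:E.
Proof.
have mB : measurable [set x : 'rV[R]_d | enorm x <= 1].
  have := @measurable_enorm R d measurableT _ (measurable_itv `]-oo, (1 : R)]).
  by rewrite setTI; congr measurable; apply/seteqP; split => x /=; rewrite in_itv.
have up : (ball_volume d <= (2 ^+ d)%:E :> \bar R)%E.
  have h2 : 0 <= 2 :> R by [].
  rewrite -(lebesgue_ccube (const_mx (-1)) h2).
  apply: le_measure; rewrite ?inE//; first exact: measurable_ccube.
  move=> x /= x1 i /=; rewrite in_itv/= mxE.
  have := le_trans (coord_le_enorm x i) x1; rewrite ler_norml; lra.
(* The cube of half-side h lies in the ball because the square root of d is at most d + 1. *)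
pose h : R := (d%:R + 1)^-1.
have d1 : 0 < d%:R + 1 :> R by rewrite ltr_wpDl.
have h0 : 0 < h by rewrite invr_gt0.
have lo : (((2 * h) ^+ d)%:E <= ball_volume d :> \bar R)%E.
  have h2 : 0 <= 2 * h by rewrite mulr_ge0// ltW.
  rewrite -(lebesgue_ccube (const_mx (- h)) h2).
  apply: le_measure; rewrite ?inE//; first exact: measurable_ccube.
  move=> x Cx /=; apply: (@le_trans _ _ (Num.sqrt d%:R * h)).
    apply: enorm_le; first exact: ltW.
    by move=> i; have := Cx i; rewrite /= in_itv/= mxE ler_norml; lra.
  rewrite /h ler_pdivrMr// mul1r -[leRHS]ger0_norm ?(ltW d1)// -sqrtr_sqr.
  rewrite ler_sqrt ?sqr_ge0// sqrrD; have := ler0n R d; have := sqr_ge0 (d%:R : R).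
  by move=> a b; lra.
have fin : ball_volume d \is a @fin_num R.
  by rewrite ge0_fin_numE ?ball_volume_ge0// (le_lt_trans up) ?ltry.
exists (fine (ball_volume d)); last by rewrite fineK.
rewrite -lte_fin fineK//; apply: lt_le_trans lo.
by rewrite lte_fin exprn_gt0// mulr_gt0.
Qed.

End ball_volume.

(** * The sphere has finite measure and its caps have positive measure *)

Section sphere_measure.
Context {R : realType} (n : nat).
Local Notation N := n.+1.
Local Notation H := (@hausdorff R N n).
Implicit Types x y e : 'rV[R]_N.

Lemma dotv_sub x y : dotv (x - y) (x - y) = dotv x x + dotv y y - 2 * dotv x y.
Proof.
rewrite /dotv mulr_sumr -big_split/= -sumrB; apply: eq_bigr => i _.
by rewrite !mxE; ring.
Qed.

Lemma dotv_sphere x : sphere x -> dotv x x = 1.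
Proof. by move=> sx; rewrite -enorm_sqr [enorm x]sx expr1n. Qed.

Lemma dotv_sphere_le x y : sphere x -> sphere y -> `|dotv x y| <= 1.
Proof.
move=> sx sy; have h1 := dotv_ge0 (x - y); have h2 := dotv_ge0 (x + y).
have : dotv (x + y) (x + y) = dotv x x + dotv y y + 2 * dotv x y.
  rewrite /dotv mulr_sumr -!big_split/=; apply: eq_bigr => i _.
  by rewrite !mxE; ring.
rewrite dotv_sub in h1; move: h1 h2; rewrite !(dotv_sphere sx) !(dotv_sphere sy) => h1 h2 h3.
by rewrite ler_norml; lra.
Qed.

Lemma measurable_dotv e : measurable_fun setT (fun x => dotv x e).
Proof.
by apply: measurable_sum => i; apply: measurable_funM;
  [exact: measurable_coord|exact: measurable_cst].
Qed.

Lemma measurable_sphere : measurable (@sphere R N).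
Proof.
have := @measurable_enorm R N measurableT _ (measurable_set1 (1 : R)).
by rewrite setTI.
Qed.

Definition cap e := [set x | sphere x /\ 2^-1 <= dotv x e].

Lemma measurable_cap e : measurable (cap e).
Proof.
rewrite (_ : cap e = sphere `&` (fun x => dotv x e) @^-1` `[2^-1, +oo[).
  apply: measurableI; first exact: measurable_sphere.
  have := measurable_dotv e measurableT (measurable_itv `[(2^-1 : R), +oo[).
  by rewrite setTI.
by apply/seteqP; split => x; rewrite /cap /= in_itv/= andbT.
Qed.

Definition drop_coord (i : 'I_N) x : 'rV[R]_n := \row_j x 0 (lift i j).

Lemma dotv_drop (i : 'I_N) x :
  dotv x x = x 0 i ^+ 2 + dotv (drop_coord i x) (drop_coord i x).
Proof.
rewrite /dotv (bigD1_ord i)//= expr2; congr (_ + _).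
by apply: eq_bigr => j _; rewrite !mxE.
Qed.

(* The cap around e is a graph over a cube of the hyperplane {x_i = 0}, for any
   i with e_i <> 0. *)
Lemma cap_covers_cube e : sphere e -> exists (i : 'I_N) (a : 'rV[R]_n) (h : R),
  0 < h /\ ccube a h `<=` drop_coord i @` cap e.
Proof.
move=> se; have e1 := dotv_sphere se.
have [i ei] : exists i, e 0 i != 0.
  apply: contrapT => no; have : dotv e e = 0.
    rewrite /dotv big1// => i _; have [->|ei] := eqVneq (e 0 i) 0.
      by rewrite mulr0.
    by exfalso; apply: no; exists i.
  by rewrite e1 => /eqP; rewrite oner_eq0.
pose eta := e 0 i ^+ 2.
have eta0 : 0 < eta by rewrite exprn_even_gt0.
have coord1 j : `|e 0 j| <= 1.
  by have := coord_le_enorm e j; rewrite [enorm e]se.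
have eta1 : eta <= 1.
  by rewrite /eta -real_normK ?num_real// exprn_ile1.
(* The squared distance from w to e will be at most 3 n rho in the coordinate i and n rho in the
   others, so at most 1, which means dotv w e >= 1/2. *)
pose rho := eta / (4 * n%:R + 1).
have n0 : 0 <= n%:R :> R by exact: ler0n.
have n1 : 0 < 4 * n%:R + 1 :> R by lra.
have rho0 : 0 < rho by exact: divr_gt0.
have rhoE : rho * (4 * n%:R + 1) = eta by rewrite /rho mulfVK// gt_eqF.
have nrho : 0 <= n%:R * rho by rewrite mulr_ge0// ltW.
have rho1 : rho <= 1 by lra.
pose a := drop_coord i e.
exists i, (a - const_mx rho), (2 * rho); split; first exact: mulr_gt0.
move=> y Cy.
have ya j : `|y 0 j - a 0 j| <= rho.
  by have := Cy j; rewrite /= in_itv/= !mxE ler_norml; lra.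
have a1 j : `|a 0 j| <= 1 by rewrite mxE.
have sq_sum : \sum_(j < n) (3 * rho) = 3 * (n%:R * rho).
  by rewrite sumr_const card_ord -mulr_natl; ring.
have ydiff : `|dotv y y - dotv a a| <= 3 * (n%:R * rho).
  rewrite -sq_sum /dotv -sumrB; apply: (le_trans (ler_norm_sum _ _ _)).
  apply: ler_sum => j _.
  have -> : y 0 j * y 0 j - a 0 j * a 0 j = (y 0 j - a 0 j) * (y 0 j + a 0 j) by ring.
  rewrite normrM mulrC; apply: ler_pM => //.
  have -> : y 0 j + a 0 j = (y 0 j - a 0 j) + 2 * a 0 j by ring.
  apply: (le_trans (ler_normD _ _)); rewrite normrM (@ger0_norm _ 2)//.
  by have := ya j; have := a1 j; lra.
have ada : dotv a a = 1 - eta.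
  by have := dotv_drop i e; rewrite e1 -/a -/eta; lra.
pose q := 1 - dotv y y.
have qeta : `|q - eta| <= 3 * (n%:R * rho).
  have -> : q - eta = - (dotv y y - dotv a a) by rewrite ada /q; ring.
  by rewrite normrN.
have q0 : 0 <= q by move: qeta; rewrite ler_norml; lra.
(* With the sign of e_i, z + e_i is at least as large as z - e_i in absolute value, so (z - e_i)^2
   is at most |z^2 - e_i^2|. *)
pose z := Num.sg (e 0 i) * Num.sqrt q.
have zz : z * z = q.
  rewrite /z mulrACA -expr2 sqr_sg ei mul1r -expr2 sqr_sqrtr//.
have zdiff : (z - e 0 i) ^+ 2 <= `|q - eta|.
  have ze : 0 <= z * e 0 i.
    rewrite /z mulrAC -normrEsg.
    by rewrite mulr_ge0// sqrtr_ge0.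
  have eE : eta = e 0 i * e 0 i by rewrite /eta expr2.
  rewrite -zz eE.
  have -> : z * z - e 0 i * e 0 i = (z - e 0 i) * (z + e 0 i) by ring.
  rewrite normrM -real_normK ?num_real// expr2 ler_wpM2l//.
  rewrite -ler_sqr ?nnegrE// !real_normK ?num_real//.
  by rewrite -subr_ge0; nra.
pose w : 'rV[R]_N := \row_k (if unlift i k is Some j then y 0 j else z).
have wi : w 0 i = z by rewrite mxE unlift_none.
have dw : drop_coord i w = y by apply/rowP => j; rewrite !mxE liftK.
exists w => //; split.
  rewrite /sphere /= /enorm (dotv_drop i) wi dw expr2 zz /q subrK sqrtr1.
  by [].
have ww : dotv w w = 1 by rewrite (dotv_drop i) wi dw expr2 zz /q subrK.
have dwe : dotv (w - e) (w - e) <= 1.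
  rewrite (dotv_drop i) !mxE unlift_none.
  have -> : drop_coord i (w - e) = y - a.
    by apply/rowP => j; rewrite !mxE liftK.
  have H1 : dotv (y - a) (y - a) <= n%:R * rho.
    apply: (@le_trans _ _ (\sum_(j < n) rho)).
      apply: ler_sum => j _; rewrite -expr2 -real_normK ?num_real// 3!mxE.
      have := ya j; rewrite [a 0 j]mxE => yj.
      by rewrite expr2; apply: (le_trans (ler_pM _ _ yj yj)) => //; nra.
    by rewrite sumr_const card_ord mulr_natl.
  by have := le_trans zdiff qeta; lra.
by move: dwe; rewrite dotv_sub ww e1; lra.
Qed.

(** Dropping a coordinate does not increase distances: a set of diameter d in a cover projects into
    a cube of side 2 d, whose volume is 4^n / w times the weight. The projections cover a cube of
    side h. *)
Lemma cap_gt0 e : sphere e -> (0 < H (cap e))%E.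
Proof.
move=> se; have [i [a [h [h0 cubeP]]]] := cap_covers_cube se.
have [w w0 wE] := @ball_volume_fin_gt0 R n.
pose c := w * h ^+ n / 4 ^+ n.
have c0 : 0 < c by rewrite divr_gt0 ?mulr_gt0 ?exprn_gt0.
apply: (@lt_le_trans _ _ c%:E); first by rewrite lte_fin.
apply: le_trans (hausdorff_delta_le n _ ltr01).
apply: le_ereal_inf_tmp => _ [F [cF Fd] <-].
pose dk k := fine (diam (F k)).
have dkE k : F k !=set0 -> 0 <= dk k /\ diam (F k) = (dk k)%:E.
  move=> /diam_ge0 F0; rewrite /dk fineK ?fine_ge0//.
  by rewrite ge0_fin_numE// (le_lt_trans (Fd k)) ?ltry.
pose xk k := xget 0 (F k).
pose C k : set 'rV[R]_n := if `[< F k !=set0 >] then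
  ccube (drop_coord i (xk k) - const_mx (dk k)) (2 * dk k) else set0.
have mC k : measurable (C k).
  by rewrite /C; case: ifPn => // _; exact: measurable_ccube.
have CF : ccube a h `<=` \bigcup_k C k.
  move=> y /cubeP[x capx <-]; have [k _ Fkx] := cF _ capx; exists k => //.
  have Fk0 : F k !=set0 by exists x.
  rewrite /C ifT; last exact/asboolP.
  have [d0 dE] := dkE k Fk0.
  have Fxk : F k (xk k) by exact: (xgetPex 0 Fk0).
  have dx : enorm (x - xk k) <= dk k.
    by apply: enorm_le_diam Fkx Fxk; rewrite dE.
  move=> j /=; rewrite in_itv/= !mxE.
  have := le_trans (coord_le_enorm (x - xk k) (lift i j)) dx.
  by rewrite !mxE ler_norml; lra.
have h0' := ltW h0.
have sub := measure_sigma_subadditive (lebesgue_rV R n) mC (measurable_ccube a h) CF.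
have Ck k : (lebesgue_rV R n (C k) <=
    (4 ^+ n / w)%:E * hausdorff_weight n (F k))%E.
  have q0 : (0 <= (4 ^+ n / w)%:E)%E.
    by rewrite lee_fin divr_ge0 ?exprn_ge0// ltW.
  rewrite /C; case: asboolP => [Fk0|_]; last first.
    by rewrite measure0 mule_ge0// hausdorff_weight_ge0.
  have [d0 dE] := dkE k Fk0.
  have d2 : 0 <= 2 * dk k by rewrite mulr_ge0.
  apply: (@le_trans _ _ ((2 * dk k) ^+ n)%:E).
    by rewrite -(lebesgue_ccube (drop_coord i (xk k) - const_mx (dk k)) d2).
  rewrite /hausdorff_weight ifF; last first.
    by apply/asboolP => F0; case: Fk0 => x; rewrite F0.
  rewrite wE -!EFinM lee_fin mulrA mulfVK ?gt_eqF// -exprMn.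
  by rewrite le_eqVlt; apply/orP; left; apply/eqP; congr (_ ^+ _); rewrite -/(dk k); field.
have : ((h ^+ n)%:E <= (4 ^+ n / w)%:E * \sum_(0 <= k <oo) hausdorff_weight n (F k))%E.
  rewrite -(lebesgue_ccube a h0') -nneseriesZl; last first.
    by move=> k _; exact: hausdorff_weight_ge0.
  by apply: (le_trans sub); apply: lee_nneseries => [k *|k *]; [exact: measure_ge0|exact: Ck].
rewrite -lee_pdivrMl ?divr_gt0 ?exprn_gt0// => Hle; apply: le_trans Hle.
rewrite -EFinM lee_fin /c invf_div le_eqVlt; apply/orP; left; apply/eqP.
by rewrite mulrAC.
Qed.

Lemma hausdorff_delta_finite_cover (K : finType) (B : K -> set 'rV[R]_N) A
    (delta c : R) : A `<=` \bigcup_k B k ->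
  (forall k, diam (B k) <= delta%:E)%E ->
  (forall k, hausdorff_weight n (B k) <= c%:E)%E ->
  (hausdorff_delta n delta A <= (#|K|%:R * c)%:E)%E.
Proof.
move=> AB Bd Bc.
pose F k := if insub k is Some o then B (enum_val (o : 'I_#|K|)) else set0.
have Fo k (kK : (k < #|K|)%N) : F k = B (enum_val (Ordinal kK)).
  by rewrite /F insubT.
have F0 k : (#|K| <= k)%N -> F k = set0.
  by move=> Kk; rewrite /F insubF// ltnNge Kk.
apply: (@le_trans _ _ (\sum_(0 <= k <oo) hausdorff_weight n (F k))%E).
  apply: ereal_inf_lbound; exists F => //; split.
    move=> x /AB[k _ Bkx]; exists (enum_rank k) => //.
    by rewrite (Fo _ (ltn_ord _)) (_ : Ordinal _ = enum_rank k) ?enum_rankK//; exact/val_inj.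
  move=> k; have [kK|Kk] := ltnP k #|K|; first by rewrite (Fo _ kK).
  by rewrite F0//; exact: diam_set0.
rewrite (nneseries_split 0 #|K|); last by move=> k _; exact: hausdorff_weight_ge0.
rewrite add0n [X in (_ + X)%E]eseries0 ?adde0; last first.
  by move=> k Kk _; rewrite F0// hausdorff_weight0.
rewrite big_mkord.
apply: (@le_trans _ _ (\sum_(k < #|K|) c%:E)%E).
  by apply: lee_sum => k _; rewrite (Fo _ (ltn_ord k)).
by rewrite sumEFin lee_fin sumr_const card_ord mulr_natl.
Qed.

(** The sphere is cut according to a coordinate of size at least 1/N, its sign, and a grid of mesh
    2/m for the others. Over such a piece the large coordinate is a Lipschitz function of the
    others, so diameters are O(1/m) while there are O(m^n) pieces. *)
Lemma sphere_lty : (H (@sphere R N) < +oo)%E.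
Proof.
have [w w0 wE] := @ball_volume_fin_gt0 R n.
have NR0 : 0 < N%:R :> R by rewrite ltr0n.
pose C : R := Num.sqrt N%:R * (2 * n%:R * N%:R + 2).
have C0 : 0 < C.
  by rewrite mulr_gt0 ?sqrtr_gt0// ltr_wpDl// !mulr_ge0.
pose c0 : R := (N * 2)%:R * (w * C ^+ n).
apply: (@le_lt_trans _ _ c0%:E); last exact: ltry.
apply: ge_ereal_sup => _ [delta /= delta0 <-].
pose m := (Num.truncn (C / delta)).+1.
have m0 : 0 < m%:R :> R by rewrite ltr0n.
have Cm : C / m%:R <= delta.
  rewrite ler_pdivrMr// mulrC -ler_pdivrMr//; apply: ltW; exact: truncnS_gt.
(* m + 1 cells per coordinate, since the value 1 falls into cell m. *)
pose K := ('I_N * bool * {ffun 'I_n -> 'I_m.+1})%type.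
pose B (k : K) : set 'rV[R]_N := [set x | [/\ sphere x,
  N%:R^-1 <= (-1) ^+ k.1.2 * x 0 k.1.1 &
  forall j, (k.2 j)%:R <= (x 0 (lift k.1.1 j) + 1) * m%:R / 2 <= (k.2 j).+1%:R]].
have aux (a b c q : R) : 0 < q -> c <= (b + 1) * q / 2 <= c + 1 ->
    c <= (a + 1) * q / 2 <= c + 1 -> `|a - b| <= 2 / q.
  move=> q0 /andP[A B1] /andP[C1 D].
  rewrite ler_pdivlMr// -[X in _ * X](gtr0_norm q0) -normrM mulrBl ler_norml.
  apply/andP; split; lra.
have Bdiam k x y : B k x -> B k y -> enorm (x - y) <= C / m%:R.
  case: k => [[i b] c] [/= sx xi xj] [/= sy yi yj].
  have jdiff j : `|x 0 (lift i j) - y 0 (lift i j)| <= 2 / m%:R.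
    by apply: (aux _ _ (c j)%:R _ m0); rewrite natr1; [exact: yj|exact: xj].
  have coord1 (z : 'rV[R]_N) j : sphere z -> `|z 0 j| <= 1.
    by move=> sz; have := coord_le_enorm z j; rewrite [enorm z]sz.
  have sumj : `|dotv (drop_coord i y) (drop_coord i y) -
      dotv (drop_coord i x) (drop_coord i x)| <= n%:R * (2 * (2 / m%:R)).
    rewrite /dotv -sumrB; apply: (le_trans (ler_norm_sum _ _ _)).
    apply: (@le_trans _ _ (\sum_(j < n) (2 * (2 / m%:R)))); last first.
      by rewrite sumr_const card_ord -[X in X <= _](mulr_natl _ n).
    apply: ler_sum => j _; rewrite !mxE.
    set u := y _ _; set v := x _ _.
    have -> : u * u - v * v = (u + v) * (u - v) by ring.
    rewrite normrM; apply: ler_pM => //; last by rewrite distrC; exact: jdiff.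
    apply: (le_trans (ler_normD _ _)).
    by have := coord1 _ (lift i j) sx; have := coord1 _ (lift i j) sy; lra.
  have idiff : `|x 0 i - y 0 i| <= 2 * n%:R * N%:R / m%:R.
    have E : (x 0 i - y 0 i) * (x 0 i + y 0 i) =
        dotv (drop_coord i y) (drop_coord i y) - dotv (drop_coord i x) (drop_coord i x).
      have := dotv_drop i x; have := dotv_drop i y.
      rewrite (dotv_sphere sx) (dotv_sphere sy); lra.
    (* Same sign and size at least 1/N: this allows a division of the difference of squares by x_i +
       y_i. *)
    have big : 2 / N%:R <= `|x 0 i + y 0 i|.
      rewrite -(normrMsign b) mulrDr.
      by apply: le_trans (ler_norm _); rewrite mulr_natl mulr2n; exact: lerD.
    have N2 : 0 < 2 / N%:R :> R by exact: divr_gt0.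
    have := sumj; rewrite -E normrM => /(le_trans (ler_wpM2l (normr_ge0 _) big)).
    rewrite -ler_pdivlMr// => /le_trans; apply.
    rewrite le_eqVlt; apply/orP; left; apply/eqP; field.
    by rewrite !gt_eqF.
  have -> : C / m%:R = Num.sqrt N%:R * ((2 * n%:R * N%:R + 2) / m%:R).
    by rewrite /C mulrA.
  apply: enorm_le; first by rewrite divr_ge0// addr_ge0// !mulr_ge0.
  move=> k; rewrite !mxE; have [j|] := unliftP i k => ->.
    apply: (le_trans (jdiff j)); rewrite ler_pM2r ?invr_gt0// lerDr.
    by rewrite !mulr_ge0.
  by apply: (le_trans idiff); rewrite ler_pM2r ?invr_gt0// lerDl.
have Bd k : (diam (B k) <= (C / m%:R)%:E)%E by apply: diam_le => x y; exact: Bdiam.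
have Bw k : (hausdorff_weight n (B k) <= (w * (C / m%:R / 2) ^+ n)%:E)%E.
  rewrite /hausdorff_weight; case: asboolP => [_|/eqP/set0P B0].
    by rewrite lee_fin mulr_ge0 ?(ltW w0)// exprn_ge0// !divr_ge0// ltW.
  rewrite wE -EFinM lee_fin ler_wpM2l ?(ltW w0)//.
  have dge := diam_ge0 B0.
  have dfin : diam (B k) \is a fin_num.
    by rewrite ge0_fin_numE// (le_lt_trans (Bd k)) ?ltry.
  rewrite lerXn2r ?nnegrE ?divr_ge0 ?fine_ge0 ?(ltW C0)//.
  by rewrite ler_wpM2r ?invr_ge0// -lee_fin fineK.
apply: (@le_trans _ _ (#|{: K}|%:R * (w * (C / m%:R / 2) ^+ n))%:E).
  apply: hausdorff_delta_finite_cover Bw => [x sx|k]; last first.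
    by apply: (le_trans (Bd k)); rewrite lee_fin.
  have [i xi] : exists i, N%:R^-1 <= `|x 0 i|.
    apply: contrapT => no.
    have lt i : `|x 0 i| < N%:R^-1.
      by rewrite ltNge; apply/negP => H1; apply: no; exists i.
    have Ni1 : N%:R^-1 <= 1 :> R by rewrite invf_le1// ler1n.
    have : dotv x x < \sum_(i < N) N%:R^-1.
      apply: ltr_sum; first by apply/hasP; exists ord0 => //; rewrite mem_index_enum.
      move=> i _; rewrite -expr2 -real_normK ?num_real// expr2.
      apply: (@le_lt_trans _ _ (`|x 0 i| * 1)); last by rewrite mulr1.
      by rewrite ler_wpM2l// (le_trans (ltW (lt i))).
    rewrite (dotv_sphere sx) sumr_const card_ord -[X in _ < X](mulr_natl _ N).
    by rewrite mulfV ?ltxx ?gt_eqF.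
  pose t j := (x 0 (lift i j) + 1) * m%:R / 2.
  have x1 j : `|x 0 j| <= 1 by have := coord_le_enorm x j; rewrite [enorm x]sx.
  have t0 j : 0 <= t j.
    by rewrite /t divr_ge0// mulr_ge0//; have := x1 (lift i j); rewrite ler_norml; lra.
  have tm j : (Num.truncn (t j) < m.+1)%N.
    rewrite ltnS -(ler_nat R); have /andP[/le_trans + _] := truncn_itv (t0 j); apply.
    rewrite /t ler_pdivrMr// mulrC ler_wpM2l//.
    by have := x1 (lift i j); rewrite ler_norml; lra.
  exists (i, (x 0 i < 0), [ffun j => Ordinal (tm j)]) => //; split => //=.
    by move: xi; rewrite -normrEsign.
  move=> j; rewrite ffunE /=; have /andP[-> /ltW ->] := truncn_itv (t0 j).
  by [].
rewrite lee_fin !card_prod card_bool card_ffun !card_ord natrM -mulrA /c0.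
rewrite ler_wpM2l// mulrCA ler_wpM2l ?(ltW w0)// natrX -exprMn.
rewrite lerXn2r ?nnegrE ?mulr_ge0 ?divr_ge0 ?(ltW C0)//.
have m1 : m%:R^-1 <= 1 :> R by rewrite invf_le1// ler1n.
rewrite -(natr1 m) (_ : (m%:R + 1) * (C / m%:R / 2) = C * ((1 + m%:R^-1) / 2)); last first.
  by field; rewrite gt_eqF.
by rewrite -[leRHS]mulr1 ler_wpM2l ?(ltW C0)//; lra.
Qed.

Lemma sphere_integral_fin_gt0 p e : 0 < p -> sphere e ->
  exists2 I : R, 0 < I & (\int[H]_(w in sphere) (`|dotv w e| `^ p)%:E)%E = I%:E.
Proof.
move=> p0 se.
have mf : measurable_fun (@sphere R N) (fun w => (`|dotv w e| `^ p)%:E).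
  apply/measurable_EFinP; apply: measurable_funTS.
  apply: (@measurableT_comp _ _ _ _ _ _ (@powR R ^~ p)) => //.
  by apply: measurableT_comp => //; exact: measurable_dotv.
have up : (\int[H]_(w in sphere) (`|dotv w e| `^ p)%:E < +oo)%E.
  apply: le_lt_trans sphere_lty; rewrite -[leRHS]mul1e.
  rewrite -(integral_cst H measurable_sphere 1%:E).
  apply: ge0_le_integral => //; first exact: measurable_sphere.
  move=> w sw; have E1 : (1 : R) = 1 `^ p by rewrite powR1.
  rewrite /cst lee_fin [leRHS]E1.
  by apply: ge0_ler_powR; rewrite ?nnegrE ?(ltW p0)//; exact: dotv_sphere_le.
have lo : (0 < \int[H]_(w in sphere) (`|dotv w e| `^ p)%:E)%E.
  apply: (@lt_le_trans _ _ (\int[H]_(w in cap e) (`|dotv w e| `^ p)%:E)%E); last first.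
    apply: ge0_subset_integral => //.
    - exact: measurable_cap.
    - exact: measurable_sphere.
    - by move=> w [].
  apply: (@lt_le_trans _ _ (\int[H]_(w in cap e) (2^-1 `^ p)%:E)%E).
    rewrite integral_cst; last exact: measurable_cap.
    by rewrite mule_gt0 ?cap_gt0// lte_fin powR_gt0.
  apply: ge0_le_integral => //.
  - exact: measurable_cap.
  - by apply: measurable_funS mf; [exact: measurable_sphere|move=> w []].
  move=> w [_ we]; rewrite lee_fin; apply: ge0_ler_powR; rewrite ?nnegrE ?(ltW p0)//.
  by apply: le_trans (ler_norm _).
exists (fine (\int[H]_(w in sphere) (`|dotv w e| `^ p)%:E)%E).
  by apply: fine_gt0; rewrite lo up.
by rewrite fineK// ge0_fin_numE// ltW.
Qed.

End sphere_measure.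

Lemma Kconst_gt0 (R : realType) (N : nat) (s p : R) (e : 'rV[R]_N) :
  (0 < N)%N -> s < 1 -> 0 < p -> sphere e -> 0 < Kconst s p e.
Proof.
case: N e => // n e _ s1 p0 se.
have [I I0 IE] := sphere_integral_fin_gt0 p0 se.
rewrite /Kconst /= IE /= mulr_gt0 ?invr_gt0// mulr_gt0// subr_gt0//.
Qed.

(** * The Dirichlet problem *)

Section fractional_problem.
Context {R : realType} {n : nat}.
Variables (s p : R).
Hypothesis p1 : 1 < p.
Local Notation X := 'rV[R]_n.
Local Notation mu := (lebesgue_rV R n).
Local Notation mu2 := (lebesgue_rV R n \x lebesgue_rV R n)%E.
Local Notation fd := (frac_diff s p).
Implicit Types (u v : X -> R) (A : set X).

Let p0 : 0 < p. Proof. exact: lt_trans p1. Qed.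

Lemma Lp_norm_ltyP A u :
  (Lp_norm p A u < +oo)%E <-> (\int[mu]_x (`|(u \_ A) x| `^ p)%:E < +oo)%E.
Proof.
have E : ((Lp_norm p A u) `^ p = \int[mu]_x (`|(u \_ A) x| `^ p)%:E)%E.
  by rewrite /Lp_norm powR_Lnorm ?gt_eqF.
split => [lt|]; first by rewrite -E; exact: poweR_lty.
rewrite -E !ltey; apply: contra => /eqP; move=> -> ; apply/eqP.
exact: eqy_poweR.
Qed.

Lemma Wtilde_frac_space Omega u :
  Wtilde s p Omega u <-> frac_space s p Omega u.
Proof.
split=> [[u0 _ [[mu_ Lu] Gu]]|[u0 [mu_ Lu] [mfu Gu]]].
  split => //.
    split => //; have /Lp_norm_ltyP := Lu.
    by rewrite patch_setT.
  split; first exact: measurable_frac_diff.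
  by rewrite -gagliardoE.
have uO : u \_ Omega = u.
  by apply/funext => x; rewrite patchE; case: ifPn => // /negP; rewrite inE => /u0.
have GT : (gagliardo s p setT u < +oo)%E by rewrite gagliardoE.
split => //; split.
- split; first exact: measurable_funS mu_.
  by apply/Lp_norm_ltyP; rewrite uO.
- apply: le_lt_trans GT; rewrite /gagliardo setXTT integral_mkcond.
  apply: ge0_le_integral_pointwise => z; rewrite patchE; case: ifP => // _.
    by rewrite lee_fin mulr_ge0 ?powR_ge0// invr_ge0 powR_ge0.
  by rewrite lee_fin mulr_ge0 ?powR_ge0// invr_ge0 powR_ge0.
- by split => //; apply/Lp_norm_ltyP; rewrite patch_setT.
- by [].
Qed.

Variables (e : X).

Lemma plap_formE Omega u v : frac_space s p Omega u -> frac_space s p Omega v ->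
  plap_form s p e u v = (Kconst s p e * pform mu2 p (fd u) (fd v))%:E.
Proof.
move=> [_ _ Lu] [_ _ Lv]; have I := pform_integrable p1 Lu Lv.
rewrite /plap_form [RHS]EFinM /pform; congr (_ * _)%E.
rewrite /Rintegral fineK; last by move: (integrable_fin_num measurableT I).
by apply: eq_integral => z _; rewrite phi_frac_diff.
Qed.

Lemma Lp_formE Omega u v : frac_space s p Omega u -> frac_space s p Omega v ->
  Lp_form p Omega u v = (pform mu p u v)%:E.
Proof.
move=> [u0 Lu _] [v0 Lv _]; have I := pform_integrable p1 Lu Lv.
rewrite /Lp_form /pform /Rintegral fineK; last by move: (integrable_fin_num measurableT I).
rewrite [LHS]integral_mkcond; congr (integral _ _ _); apply/funext => x; rewrite patchE.
case: ifPn => // /negP; rewrite inE => /v0 ->.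
by rewrite mulr0.
Qed.

(** The whole space serves as the neighbourhood U. The weighted integrand vanishes off a box, inside
    which |u|^(p-1) is at most 1 + |u|^p. *)
Lemma What_frac_space Omega u : bounded_set Omega -> frac_space s p Omega u ->
  0 <= n%:R + s * p -> What s p Omega u.
Proof.
move=> bO Wu sp0; have [u0 [mu_ Lu] _] := Wu.
have [_ _ WT] := (Wtilde_frac_space Omega u).2 Wu.
split.
- split => // C _; apply/Lp_norm_ltyP; apply: le_lt_trans Lu.
  apply: ge0_le_integral_pointwise => x; rewrite lee_fin ?powR_ge0//.
  rewrite patchE; case: ifP => // _; rewrite normr0 powR0 ?powR_ge0//.
  by rewrite gt_eqF.
- exists setT; split => //; first exact: openT.
  have [M [_ HM]] := bO.
  have cK : closed [set x : X | `|x| <= M + 1].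
    apply: (@preimage_closed _ _ (fun x : X => `|x|) [set y | y <= M + 1]).
      by move=> x _; exact: norm_continuous.
    exact: closed_le.
  have OK : closure Omega `<=` [set x : X | `|x| <= M + 1].
    rewrite [X in _ `<=` X]((closure_id _).1 cK); apply: closure_subset => x Ox.
    by apply: HM Ox; rewrite ltrDl.
  apply: bounded_closed_compact; last exact: closed_closure.
  exists (M + 1); split; first exact: num_real.
  by move=> y My x /OK /le_trans; apply; exact: ltW.
- have [r r0 Or] := bounded_hcube bO.
  set B := hcube _ _ in Or.
  have mB : measurable B by exact: measurable_hcube.
  have B2 : 0 <= 2 * r by rewrite mulr_ge0// ltW.
  have muB : mu B = ((2 * r) ^+ n)%:E by exact: lebesgue_hcube.
  have I := integrable_comb 1 1 (integrable_indicQ mB muB) (Lpf_integrable (conj mu_ Lu)).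
  have Ilt : (\int[mu]_x (1 * \1_B x + 1 * `|u x| `^ p)%:E < +oo)%E.
    rewrite -ge0_fin_numE; first by move: (integrable_fin_num measurableT I).
    by apply: integral_ge0 => x _; rewrite lee_fin !mul1r addr_ge0 ?powR_ge0.
  apply: le_lt_trans Ilt; apply: ge0_le_integral_pointwise => x; rewrite lee_fin.
    by rewrite divr_ge0 ?powR_ge0.
  have h1 : 1 <= (1 + enorm x) `^ (n%:R + s * p).
    have E1 : (1 : R) = 1 `^ (n%:R + s * p) by rewrite powR1.
    rewrite {1}E1; apply: ge0_ler_powR.
    - exact: sp0.
    - by rewrite nnegrE.
    - by rewrite nnegrE addr_ge0 ?enorm_ge0.
    - by rewrite lerDl enorm_ge0.
  rewrite ler_pdivrMr ?(lt_le_trans ltr01)// !mul1r.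
  have [Ox|nO] := pselect (B x); last first.
    have ux : u x = 0 by apply: u0 => /Or.
    rewrite ux normr0 powR0; last by rewrite gt_eqF// subr_gt0.
    by rewrite !mulr_ge0 ?addr_ge0 ?powR_ge0.
  have -> : \1_B x = 1 :> R by rewrite indicE mem_set.
  apply: (@le_trans _ _ (1 + `|u x| `^ p)); last first.
    by rewrite ler_peMr// addr_ge0 ?powR_ge0.
  have [u1|u1] := lerP `|u x| 1.
    apply: (@le_trans _ _ 1); last by rewrite lerDl powR_ge0.
    have E1 : (1 : R) = 1 `^ (p - 1) by rewrite powR1.
    by rewrite [leRHS]E1; apply: ge0_ler_powR; rewrite ?nnegrE// subr_ge0 ltW.
  apply: (@le_trans _ _ (`|u x| `^ p)); last by rewrite lerDr.
  by apply: ler_powR; rewrite ?gerBl ?ltW.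
Qed.

End fractional_problem.

Lemma norm_add_lt_sub (R : realFieldType) (a b : R) : 0 < a -> b < 0 ->
  `|a + b| <> a - b.
Proof. by move=> a0 b0; case: (ger0P (a + b)) => _ E; lra. Qed.

(** * First variation and the equality case *)

Section first_variation.
Context d {T : measurableType d} {R : realType}.
Variable mu : {measure set T -> \bar R}.
Variable p : R.
Hypothesis p1 : 1 < p.
Implicit Types g h : T -> R.

Let p0 : 0 < p. Proof. exact: lt_trans p1. Qed.

Lemma pform_0 g : pform mu p g (fun=> 0) = 0.
Proof.
rewrite -[RHS](_ : \int[mu]_x (0 : R) = 0); last by rewrite (Rintegral_cst mu measurableT) mul0r.
by apply: eq_Rintegral => x _; rewrite mulr0.
Qed.

Lemma pmass_0 : pmass mu p (fun=> 0) = 0.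
Proof. by rewrite -pform_diag// pform_0. Qed.

(** The tangent inequality is applied at the perturbed point g + t h, and t tends to 0 by continuity
    of [pform]; nothing is differentiated under the integral. *)
Lemma pform_first_variation_ge K (l : R) g h : 0 < K -> Lpf mu p g -> Lpf mu p h ->
  (forall t, 0 < t -> t * l <=
     K * pmass mu p (fun x => t * h x + g x) - K * pmass mu p g) ->
  l <= K * (p * pform mu p g h).
Proof.
move=> K0 Lg Lh Ht.
have step t : 0 < t -> l <= K * (p * pform mu p (fun x => t * h x + g x) h).
  move=> t0; have Lt : Lpf mu p (fun x => t * h x + g x) by exact: Lpf_lin.
  have := pform_tangent p1 Lt Lg.
  rewrite [X in pform _ _ _ X](_ : _ = fun x => (- t) * h x + (fun=> 0) x); last first.
    by apply/funext => x /=; ring.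
  rewrite (pform_lin p1 (- t) Lt Lh (Lpf_0 mu p1)).
  rewrite pform_0; move=> tan; rewrite -(ler_pM2l t0); apply: le_trans (Ht t t0) _.
  move: tan; move: (pform _ _ _ h) (pmass _ _ g) (pmass _ _ _) => A B C tan.
  rewrite -mulrBr; have -> : t * (K * (p * A)) = K * (t * (p * A)) by ring.
  by rewrite ler_wpM2l ?(ltW K0)//; move: tan; rewrite addr0; nra.
apply/ler_addgt0Pr => eps eps0.
pose c := K * (p * (pnorm mu p h + 1)).
have c0 : 0 < c by rewrite !mulr_gt0// ltr_wpDl// powR_ge0.
have [dl dl0 Hd] := pform_cont p1 Lg (divr_gt0 eps0 c0).
pose t := dl / 2 / (pnorm mu p h + 1).
have nh1 : 0 < pnorm mu p h + 1 by rewrite ltr_wpDl// powR_ge0.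
have t0 : 0 < t by rewrite !divr_gt0.
have Lt : Lpf mu p (fun x => t * h x + g x) by exact: Lpf_lin.
have small : pnorm mu p (fun x => t * h x + g x - g x) < dl.
  rewrite [X in pnorm _ _ X](_ : _ = fun x => t * h x); last first.
    by apply/funext => x; rewrite addrK.
  rewrite (pnormZ p1 t Lh) (gtr0_norm t0) /t mulrAC ltr_pdivrMr//.
  have : 0 <= pnorm mu p h by exact: powR_ge0.
  by move: (pnorm mu p h) => a a0; nra.
have := Hd _ h Lt Lh small.
move=> Hle; apply: le_trans (step t t0) _.
move: Hle; rewrite ler_norml => /andP[_]; rewrite lerBlDr => Hle.
have Kp0 : 0 <= K * p by rewrite mulr_ge0// ltW.
have := ler_wpM2l Kp0 Hle; rewrite -!mulrA => /le_trans; apply.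
rewrite addrC !mulrDr lerD2l.
have -> : K * (p * (eps * (c^-1 * pnorm mu p h))) = eps * (K * (p * pnorm mu p h) / c) by ring.
rewrite -[leRHS]mulr1 ler_wpM2l ?(ltW eps0)// ler_pdivrMr// mul1r /c.
by rewrite ler_wpM2l ?(ltW K0)// ler_wpM2l ?(ltW p0)// lerDl.
Qed.

Lemma ae_norm_eq g h : Lpf mu p g -> Lpf mu p h ->
  (forall x, `|h x| <= `|g x|) -> pmass mu p g <= pmass mu p h ->
  {ae mu, forall x, `|g x| = `|h x|}.
Proof.
move=> Lg Lh hg gh.
have Ig := Lpf_integrable Lg; have Ih := Lpf_integrable Lh.
pose f x := 1 * `|g x| `^ p + (- 1) * `|h x| `^ p.
have f0 x : 0 <= f x.
  by rewrite /f mul1r mulN1r subr_ge0; apply: powR_le.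
have If := integrable_comb 1 (- 1) Ig Ih.
have mf : measurable_fun setT (EFin \o f) by exact: measurable_int If.
have intf : (\int[mu]_x (f x)%:E)%E = 0%E.
  have := Rintegral_comb 1 (- 1) Ig Ih; rewrite -/(pmass mu p g) -/(pmass mu p h).
  move: gh; move: (pmass mu p g) (pmass mu p h) => A B AB E.
  have F := integrable_fin_num measurableT If.
  have i0 : (0 <= \int[mu]_x (f x)%:E)%E by apply: integral_ge0 => x _; rewrite lee_fin.
  apply/eqP; rewrite eq_le i0 andbT -(fineK F) lee_fin.
  rewrite [X in X <= _]E; lra.
have : ae_eq mu setT (EFin \o f) (cst 0%E).
  apply/(ae_eq_integral_abs mu measurableT mf).
  rewrite -[RHS]intf; apply: eq_integral => x _ /=.
  by rewrite ger0_norm.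
apply: filterS => x /(_ I) [] /eqP.
rewrite /f mul1r mulN1r subr_eq0 => /eqP E.
by rewrite -[LHS](powR_Kinv p1 (normr_ge0 _)) E powR_Kinv.
Qed.

End first_variation.

(** * Functions of constant sign *)

Section ground_state_sign.
Context {R : realType} {n : nat}.
Variables (s p : R) (A : set 'rV[R]_n).
Hypothesis p1 : 1 < p.
Local Notation X := 'rV[R]_n.
Local Notation mu := (lebesgue_rV R n).
Local Notation mu2 := (lebesgue_rV R n \x lebesgue_rV R n)%E.
Local Notation fd := (frac_diff s p).
Implicit Types (u v : X -> R).

Let p0 : 0 < p. Proof. exact: lt_trans p1. Qed.

Lemma frac_diff_norm_le u z : `|fd (fun x => `|u x|) z| <= `|fd u z|.
Proof.
rewrite /frac_diff !normrM ler_wpM2r//; exact: ler_dist_dist.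
Qed.

Lemma frac_space_norm u : frac_space s p A u -> frac_space s p A (fun x => `|u x|).
Proof.
move=> [u0 [mu_ Lu] [mfu Lfu]].
have mnu : measurable_fun setT (fun x => `|u x|) by exact: measurableT_comp.
split.
- by move=> x /u0 ->; rewrite normr0.
- split; first exact: mnu.
  apply: le_lt_trans Lu.
  by apply: ge0_le_integral_pointwise => x; rewrite lee_fin ?powR_ge0// normr_id.
- split; first exact: measurable_frac_diff.
  apply: le_lt_trans Lfu.
  apply: ge0_le_integral_pointwise => z; rewrite lee_fin ?powR_ge0//.
  by apply: powR_le => //; exact: frac_diff_norm_le.
Qed.

(* If u takes both signs then |u(x)| - |u(y)| is strictly smaller in absolute
   value than u(x) - u(y) on a set of positive measure. *)
Lemma frac_norm_minimizer_sign u : frac_space s p A u ->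
  pmass mu2 p (fd u) <= pmass mu2 p (fd (fun x => `|u x|)) ->
  {ae mu, forall x, 0 <= u x} \/ {ae mu, forall x, u x <= 0}.
Proof.
move=> Wu le; have [_ [mu_ _] Lfu] := Wu; have [_ _ Lfn] := frac_space_norm Wu.
have [N [mN N0 HN]] := ae_norm_eq p1 Lfu Lfn (frac_diff_norm_le u) le.
pose P := [set x | 0 < u x]; pose M := [set x | u x < 0].
have mP : measurable P.
  have := mu_ measurableT _ (measurable_itv `]0, +oo[).
  by rewrite setTI; congr measurable; apply/seteqP; split => x /=; rewrite in_itv/= ?andbT.
have mM : measurable M.
  have := mu_ measurableT _ (measurable_itv `]-oo, 0[).
  by rewrite setTI; congr measurable; apply/seteqP; split => x /=; rewrite in_itv/=.
have PM : mu2 (P `*` M) = 0%E.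
  apply/eqP; rewrite -measure_le0 -[X in (_ <= X)%E]N0; apply: le_measure.
  - by rewrite inE; exact: measurableX.
  - by rewrite inE.
  move=> [x y] /= [Px My]; apply: HN => /= E; move: Px My; rewrite /P /M /= => Px My.
  have xy : x - y != 0.
    by apply/eqP => /subr0_eq xy; move: My; rewrite -xy; move/lt_trans => /(_ _ Px); rewrite ltxx.
  have e0 := enorm_gt0 xy.
  move: E; rewrite /frac_diff /= !normrM => /mulIf.
  have w0 : enorm (x - y) `^ (- (n%:R + s * p) / p) > 0 by exact: powR_gt0.
  rewrite normr_eq0 gt_eqF// => /(_ isT).
  rewrite (gtr0_norm Px) (ltr0_norm My) opprK.
  rewrite gtr0_norm; last by rewrite subr_gt0; exact: lt_trans My Px.
  by move/esym; exact: norm_add_lt_sub.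
have : (mu P * mu M = 0)%E by rewrite -PM -(product_measure1E mu mu mP mM).
move=> /eqP; rewrite mule_eq0 => /orP[/eqP P0|/eqP M0]; [right|left].
  by exists P; split => // x /= H; rewrite /P /= ltNge; exact/negP.
by exists M; split => // x /= H; rewrite /M /= ltNge; exact/negP.
Qed.

(** B contains the support, so the form is the integral of u, and a nonnegative function of zero
    integral vanishes almost everywhere. *)
Lemma ae_ge0_mean0_pmass (B : set X) (q : R) u : measurable B -> mu B = q%:E ->
  A `<=` B -> frac_space s p A u -> {ae mu, forall x, 0 <= u x} ->
  pform mu p \1_B u = 0 -> pmass mu p u = 0.
Proof.
move=> mB muB AB [u0 Lu _] upos Q0.
have IF := pform_integrable p1 (Lpf_indicQ p1 mB muB) Lu.
have FE x : phi p (\1_B x) * u x = u x.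
  rewrite phi_indicQ indicE; have [xB|nB] := pselect (B x).
    by rewrite mem_set// mul1r.
  by rewrite u0 ?mulr0// => /AB.
have mu_ : measurable_fun setT (EFin \o u) by apply/measurable_EFinP; exact: Lu.1.
have intu : (\int[mu]_x (u x)%:E)%E = 0%E.
  have F := integrable_fin_num measurableT IF.
  move: Q0; rewrite /pform /Rintegral => /eqP; rewrite fine_eq0; last by move: F.
  by move=> /eqP <-; apply: eq_integral => x _; rewrite FE.
have absu : (\int[mu]_x `|(EFin \o u) x|)%E = 0%E.
  rewrite -[RHS]intu; apply: ae_eq_integral => //.
  - exact: measurableT_comp mu_.
  - by apply: filterS upos => x ux _ /=; rewrite ger0_norm.
have := (ae_eq_integral_abs mu measurableT mu_).1 absu.
move=> ae0.
have ae0' : {ae mu, forall x, 0 = u x} by apply: filterS ae0 => x /(_ I) [->].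
have [_ ->] := eq_pmass ae0' Lu.1 (Lpf_0 mu p1).
exact: pmass_0.
Qed.

End ground_state_sign.

#[local] Opaque powR.

(** * The hypotheses of the abstract theorem for the fractional energy *)

Section dirichlet_problem.
Context {R : realType} {n : nat}.
Variables (s p r K : R) (A : set 'rV[R]_n).
Hypothesis p1 : 1 < p.
Hypothesis s0 : 0 < s.
Hypothesis r0 : 0 < r.
Hypothesis n0 : (0 < n)%N.
Hypothesis Ar : A `<=` hcube (const_mx (- r)) (2 * r).
Hypothesis K0 : 0 < K.
Local Notation X := 'rV[R]_n.
Local Notation mu := (lebesgue_rV R n).
Local Notation mu2 := (lebesgue_rV R n \x lebesgue_rV R n)%E.
Local Notation fd := (frac_diff s p).
Local Notation W := (frac_space s p A).
Implicit Types (u v w : X -> R).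

Let p0 : 0 < p. Proof. exact: lt_trans p1. Qed.

Definition energy_norm u : R := K `^ p^-1 * pnorm mu2 p (fd u).

Definition power_form u v : R := p * pform mu p u v.

Local Notation N := energy_norm.
Local Notation M := (pnorm mu p).
Local Notation b := power_form.

Lemma energy_norm_ge0 u : 0 <= N u.
Proof. by apply: mulr_ge0; exact: powR_ge0. Qed.

Lemma energy_norm_powR u : N u `^ p = K * pmass mu2 p (fd u).
Proof.
rewrite /energy_norm powRM ?powR_ge0// (powR_invK p1) ?(ltW K0)//.
by congr (_ * _); exact: pnorm_powR.
Qed.

Lemma energy_norm_powR_le u c : 0 <= c ->
  (N u <= c) = (pmass mu2 p (fd u) <= c `^ p / K).
Proof.
move=> c0; rewrite -(powR_leE p1 (energy_norm_ge0 u) c0) energy_norm_powR.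
by rewrite ler_pdivlMr// mulrC.
Qed.

Lemma energy_norm_le_pmass u v : N u <= N v ->
  pmass mu2 p (fd u) <= pmass mu2 p (fd v).
Proof.
rewrite (energy_norm_powR_le u (energy_norm_ge0 v)) (energy_norm_powR v).
have E (a : R) : K * a / K = a by rewrite mulrAC mulfV ?gt_eqF// mul1r.
by rewrite E.
Qed.

Lemma frac_diff0 : fd (fun _ : X => 0 : R) = (fun _ : X * X => 0 : R).
Proof. by apply/funext => z; rewrite /frac_diff subrr mul0r. Qed.

Lemma frac_space0 : W (fun=> 0).
Proof.
split => //; first exact: Lpf_0.
by rewrite frac_diff0; exact: Lpf_0.
Qed.

Lemma frac_diffZ (a : R) u : fd (fun x => a * u x) = fun z => a * fd u z.
Proof. by apply/funext => z; rewrite /frac_diff -mulrBr mulrA. Qed.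

Lemma frac_diffD u v : fd (fun x => u x + v x) = fun z => fd u z + fd v z.
Proof. by apply/funext => z; rewrite /frac_diff -mulrDl; congr (_ * _); ring. Qed.

Lemma energy_normZ (a : R) u : W u -> N (fun x => a * u x) = `|a| * N u.
Proof.
move=> [_ _ Lu]; rewrite /energy_norm frac_diffZ.
by rewrite [X in _ * X = _](pnormZ p1 a Lu) mulrCA.
Qed.

Lemma energy_normD u v : W u -> W v -> N (fun x => u x + v x) <= N u + N v.
Proof.
move=> [_ _ Lu] [_ _ Lv]; rewrite /energy_norm frac_diffD -mulrDr.
exact: (ler_wpM2l (powR_ge0 _ _) (pnormD p1 Lu Lv)).
Qed.

Lemma pnorm_le_energy_norm : exists2 c : R, 0 <= c & forall u, W u -> M u <= c * N u.
Proof.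
have [c c0 Hc] := poincare_constant p1 s0 r0 n0 Ar.
exists ((c / K) `^ p^-1); first exact: powR_ge0.
move=> u Wu; rewrite -(powR_leE p1) ?powR_ge0 ?mulr_ge0 ?powR_ge0 ?energy_norm_ge0//.
rewrite powRM ?powR_ge0 ?energy_norm_ge0// (powR_invK p1) ?divr_ge0 ?(ltW K0)//.
rewrite energy_norm_powR mulrA mulfVK ?gt_eqF// (pnorm_powR _ p1).
exact: Hc.
Qed.

Lemma energy_norm_uniform_convexity (eps : R) : 0 < eps -> exists2 C : R, 0 <= C &
  forall u v, W u -> W v -> N (fun x => u x - v x) `^ p <=
    eps * (N u `^ p + N v `^ p) +
    C * ((N u `^ p + N v `^ p) / 2 - N (fun x => 2^-1 * (u x + v x)) `^ p).
Proof.
move=> eps0; have [C C0 HC] := pmass_uniform_convexity mu2 p1 eps0.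
exists C; first exact: C0.
move=> u v [_ _ Lu] [_ _ Lv].
have H (x y z t : R) : x = K * pmass mu2 p (fun z => fd u z - fd v z) ->
    y = K * pmass mu2 p (fd u) -> z = K * pmass mu2 p (fd v) ->
    t = K * pmass mu2 p (fun z => 2^-1 * (fd u z + fd v z)) ->
    x <= eps * (y + z) + C * ((y + z) / 2 - t).
  move=> -> -> -> ->; apply: (le_trans (ler_wpM2l (ltW K0) (HC _ _ Lu Lv))).
  move: (pmass _ _ _) (pmass _ _ _) (pmass _ _ _) => a c d.
  by rewrite le_eqVlt; apply/orP; left; apply/eqP; ring.
have E : fd (fun x => 2^-1 * (u x + v x)) = fun z => 2^-1 * (fd u z + fd v z).
  by rewrite frac_diffZ frac_diffD.
apply: H; last by rewrite -E; exact: energy_norm_powR.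
- by rewrite -frac_diffB; exact: energy_norm_powR.
- exact: energy_norm_powR.
- exact: energy_norm_powR.
Qed.

Lemma energy_norm_compact (u_ : nat -> X -> R) (B : R) :
  (forall i, W (u_ i) /\ N (u_ i) <= B) ->
  exists (k : nat -> nat) u, [/\ forall i, (i <= k i)%N, W u,
    forall e : R, 0 < e -> exists i0, forall i, (i0 <= i)%N ->
      M (fun x => u_ (k i) x - u x) < e &
    forall v c, W v -> (exists i0, forall i, (i0 <= i)%N ->
        N (fun x => u_ (k i) x - v x) <= c) ->
      N (fun x => u x - v x) <= c].
Proof.
move=> Hu.
have B0 : 0 <= B by exact: le_trans (energy_norm_ge0 _) (Hu 0%N).2.
have [i|k [u [ki Wu cv lsc]]] := frac_space_compact p1 s0 r0 n0 Ar (u_ := u_) (B := B `^ p / K).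
  by have [Wi] := Hu i; rewrite (energy_norm_powR_le _ B0).
exists k, u; split => //.
  move=> e e0; have [i0 Hi] := cv _ (powR_gt0 p e0); exists i0 => i ii.
  by rewrite -(powR_ltE p1) ?powR_ge0 ?(ltW e0)// (pnorm_powR _ p1); exact: Hi.
move=> v c Wv [i0 Hi].
have c0 : 0 <= c by exact: le_trans (energy_norm_ge0 _) (Hi i0 (leqnn _)).
rewrite energy_norm_powR_le//; apply: lsc => //; exists i0 => i ii.
by rewrite -energy_norm_powR_le//; exact: Hi.
Qed.

Lemma power_form_lin (a : R) u v w : W u -> W v -> W w ->
  b u (fun x => a * v x + w x) = a * b u v + b u w.
Proof.
by move=> [_ Lu _] [_ Lv _] [_ Lw _]; rewrite /power_form pform_lin// mulrDr mulrCA.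
Qed.

Lemma power_form_le u v : W u -> W v -> `|b u v| <= p * M u `^ (p - 1) * M v.
Proof.
move=> [_ Lu _] [_ Lv _]; rewrite /power_form normrM (gtr0_norm p0) -mulrA.
by rewrite ler_pM2l//; exact: pform_le.
Qed.

Lemma power_form_diag u : b u u = p * M u `^ p.
Proof. by rewrite /power_form pform_diag// pnorm_powR. Qed.

Lemma power_form_tangent u v : W u -> W v ->
  M u `^ p + b u (fun x => v x - u x) <= M v `^ p.
Proof.
move=> [_ Lu _] [_ Lv _].
have H (x y : R) : x = pmass mu p u -> y = pmass mu p v ->
    x + b u (fun x => v x - u x) <= y.
  by move=> -> ->; exact: (pform_tangent p1 Lu Lv).
by apply: H; exact: pnorm_powR.
Qed.

Lemma power_formZ (c : R) u v : 0 < c -> W u -> W v ->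
  b (fun x => c * u x) v = c `^ (p - 1) * b u v.
Proof.
by move=> c0 [_ Lu _] [_ Lv _]; rewrite /power_form pformZ// mulrCA.
Qed.

Lemma power_form_cont u (eps : R) : W u -> 0 < eps -> exists2 d : R, 0 < d &
  forall u' v, W u' -> W v -> M (fun x => u' x - u x) < d ->
    `|b u' v - b u v| <= eps * M v.
Proof.
move=> [_ Lu _] eps0; have [d d0 Hd] := pform_cont p1 Lu (divr_gt0 eps0 p0).
exists d => // u' v [_ Lu' _] [_ Lv _] lt.
rewrite /power_form -mulrBr normrM (gtr0_norm p0).
have := Hd u' v Lu' Lv lt; rewrite -(ler_pM2l p0) => /le_trans; apply.
by rewrite mulrA mulrCA mulfV ?gt_eqF// mulr1.
Qed.

(** The linear form Q: the integral of u, written against the indicator of a box containing A so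
    that the Hoelder bound for [pform] applies. *)
Definition box_mean u : R := pform mu p \1_(hcube (const_mx (- r)) (2 * r)) u.

Let mbox : measurable (hcube (const_mx (- r) : X) (2 * r)).
Proof. exact: measurable_hcube. Qed.

Let mubox : mu (hcube (const_mx (- r)) (2 * r)) = ((2 * r) ^+ n)%:E.
Proof. by apply: lebesgue_hcube; rewrite mulr_ge0// ltW. Qed.

Lemma box_mean_lin (a : R) u v : W u -> W v ->
  box_mean (fun x => a * u x + v x) = a * box_mean u + box_mean v.
Proof.
move=> [_ Lu _] [_ Lv _].
exact: (pform_lin p1 a (Lpf_indicQ p1 mbox mubox) Lu Lv).
Qed.

Lemma box_mean_le : exists2 C : R, 0 <= C & forall u, W u -> `|box_mean u| <= C * M u.
Proof.
exists (M \1_(hcube (const_mx (- r)) (2 * r)) `^ (p - 1)); first exact: powR_ge0.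
by move=> u [_ Lu _]; exact: (pform_le p1 (Lpf_indicQ p1 mbox mubox) Lu).
Qed.

Lemma pnorm_eq0 u : pmass mu p u = 0 -> M u = 0.
Proof.
have h : p^-1 != 0 by rewrite invr_eq0 gt_eqF.
by rewrite /pnorm => ->; exact: powR0.
Qed.

(** Passing to |u| keeps M, so minimality gives N u <= r1 M |u| <= N |u|. Then u has constant sign,
    and zero mean would make it null. *)
Lemma box_mean_minimizer (r1 : R) u : (forall v, W v -> r1 * M v <= N v) ->
  W u -> 0 < M u -> N u <= r1 * M u -> box_mean u <> 0.
Proof.
move=> r1M Wu Mu Nu Q0.
have Wn := frac_space_norm p1 Wu; have [u0 Lu Lfu] := Wu.
have Mn : M (fun x => `|u x|) = M u.
  have E : pmass mu p (fun x => `|u x|) = pmass mu p u.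
    by apply: eq_Rintegral => x _; rewrite normr_id.
  exact: (congr1 (fun t => t `^ p^-1) E).
have : N u <= N (fun x => `|u x|) by apply: (le_trans Nu); rewrite -Mn; exact: r1M.
move=> /energy_norm_le_pmass Hle.
suff z : pmass mu p u = 0.
  by move: Mu; rewrite (pnorm_eq0 z) ltxx.
have [pos|neg] := frac_norm_minimizer_sign p1 Wu Hle.
  exact: (ae_ge0_mean0_pmass p1 mbox mubox Ar Wu pos).
pose w x := -1 * u x + (fun=> 0) x.
have Ww : W w by exact: (frac_space_lin p1 (-1) Wu frac_space0).
have wE x : w x = - u x by rewrite /w mulN1r addr0.
have wpos : {ae mu, forall x, 0 <= w x}.
  by apply: filterS neg => x ux; rewrite wE oppr_ge0.
have Qw : box_mean w = 0.
  rewrite (box_mean_lin (-1) Wu frac_space0) Q0 mulr0 add0r.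
  exact: pform_0.
have <- : pmass mu p w = pmass mu p u.
  by apply: eq_Rintegral => x _; rewrite wE normrN.
exact: (ae_ge0_mean0_pmass p1 mbox mubox Ar Ww wpos Qw).
Qed.

(** The one-sided first variation gives an inequality for every direction; the opposite direction
    turns it into an equality. *)
Lemma argmin_euler_lagrange (l : (X -> R) -> R) u :
  (forall (a : R) v w, W v -> W w -> l (fun x => a * v x + w x) = a * l v + l w) ->
  W u -> (forall v, W v -> N u `^ p - l u <= N v `^ p - l v) ->
  forall v, W v -> l v = K * (p * pform mu2 p (fd u) (fd v)).
Proof.
move=> ll Wu mini; have [_ _ Lu] := Wu.
have mini' w : W w ->
    K * pmass mu2 p (fd u) - l u <= K * pmass mu2 p (fd w) - l w.
  move=> Ww.
  have H (x y a c : R) : x = a -> y = c -> x - l u <= y - l w -> a - l u <= c - l w.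
    by move=> -> ->.
  exact: (H _ _ _ _ (energy_norm_powR u) (energy_norm_powR w) (mini w Ww)).
have half v : W v -> l v <= K * (p * pform mu2 p (fd u) (fd v)).
  move=> Wv; have [_ _ Lv] := Wv.
  apply: (pform_first_variation_ge p1 K0 Lu Lv) => t t0.
  have := mini' _ (frac_space_lin p1 t Wv Wu); rewrite (ll t v u Wv Wu) frac_diff_lin.
  by move: (pmass _ _ _) (pmass _ _ _) => a c; lra.
move=> v Wv; apply/le_anti; rewrite half//=.
have Wm : W (fun x => -1 * v x + (fun=> 0) x) by exact: (frac_space_lin p1 (-1) Wv frac_space0).
have l0 : l (fun=> 0) = 0.
  have := ll 1 _ _ frac_space0 frac_space0.
  rewrite (_ : (fun x : X => _) = fun=> 0); last by apply/funext => x; rewrite mulr0 addr0.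
  by move: (l _) => a; lra.
have [_ _ Lv] := Wv; have [_ _ L0] := frac_space0.
have lm : l (fun x => -1 * v x + (fun=> 0) x) = - l v.
  by rewrite (ll (-1) v _ Wv frac_space0) l0 mulN1r addr0.
have fm : pform mu2 p (fd u) (fd (fun x => -1 * v x + (fun=> 0) x)) =
    - pform mu2 p (fd u) (fd v).
  by rewrite frac_diff_lin (pform_lin p1 (-1) Lu Lv L0) frac_diff0 pform_0 mulN1r addr0.
have Hm := half _ Wm; rewrite lm fm !mulrN lerN2 in Hm.
exact: Hm.
Qed.

End dirichlet_problem.

Section solvability.
Context {R : realType} {n : nat}.
Variables (s p r K : R) (A : set 'rV[R]_n).
Hypothesis p1 : 1 < p.
Hypothesis s0 : 0 < s.
Hypothesis r0 : 0 < r.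
Hypothesis n0 : (0 < n)%N.
Hypothesis Ar : A `<=` hcube (const_mx (- r)) (2 * r).
Hypothesis K0 : 0 < K.
Local Notation X := 'rV[R]_n.
Local Notation mu := (lebesgue_rV R n).
Local Notation mu2 := (lebesgue_rV R n \x lebesgue_rV R n)%E.
Local Notation fd := (frac_diff s p).
Local Notation W := (frac_space s p A).
Local Notation N := (energy_norm s p K).
Local Notation M := (pnorm mu p).
Local Notation b := (power_form p).
Implicit Types (u v w : X -> R).

Let V : lmodType R := (X -> R^o)%type.

(** The factor p appears on both sides because N^p and M^p are not divided by p. It also has to be
    carried by h. *)
Lemma frac_dirichlet_solvable (r1 r2 rl L : R) (h : (X -> R) -> R) :
  0 <= r1 ->
  (forall t, r1 < t -> exists2 u, W u & N u < t * M u) ->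
  (forall v, W v -> r1 * M v <= N v) ->
  (forall t u, r1 < t < r2 -> W u -> 0 < M u ->
    ~ forall v, W v -> t `^ p * b u v = K * (p * pform mu2 p (fd u) (fd v))) ->
  r1 < rl < r2 -> 0 <= L ->
  (forall (a : R) u v, W u -> W v -> h (fun x => a * u x + v x) = a * h u + h v) ->
  (forall v, W v -> `|h v| <= L * N v) ->
  exists2 u, W u & forall v, W v ->
    rl `^ p * b u v + h v = K * (p * pform mu2 p (fd u) (fd v)).
Proof.
move=> r10 near r1M nores rr L0 hl hb.
have [Cp Cp0 MN] := pnorm_le_energy_norm p1 s0 r0 n0 Ar K0.
have [CQ CQ0 Qb] := box_mean_le s A p1 r0.
have EL := argmin_euler_lagrange p1 K0.
have [u [Wu mini]] : exists u : V, @argmin R V p W N (fun v => rl `^ p * b u v + h v) u.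
  apply: (@dc_fixed_point R V p W N M b Cp p1 _ _ _ _ _ _ _ _ Cp0 MN _ _ _ _ _ _ _ _
    (box_mean p r) CQ r1 r2 CQ0 _ Qb r10 near _ _ rl h L rr).
  - exact: frac_space0.
  - exact: frac_space_lin.
  - exact: energy_norm_ge0.
  - exact: energy_normZ.
  - exact: energy_normD.
  - by move=> u; exact: powR_ge0.
  - by move=> a u [_ Lu _]; exact: pnormZ.
  - by move=> u v [_ Lu _] [_ Lv _]; exact: pnormD.
  - exact: energy_norm_uniform_convexity.
  - exact: (energy_norm_compact p1 s0 r0 n0 Ar K0).
  - exact: power_form_lin.
  - exact: power_form_le.
  - by move=> u _; exact: power_form_diag.
  - exact: power_form_tangent.
  - exact: power_formZ.
  - exact: power_form_cont.
  - exact: box_mean_lin.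
  - by move=> u; exact: box_mean_minimizer.
  - move=> t u tr Mu [Wu mini]; apply: (nores t u tr Wu Mu).
    apply: (EL _ _ _ _ _ _ Wu mini) => a v w Wv Ww.
    by rewrite (power_form_lin p1 a Wu Wv Ww) mulrDr mulrCA.
  - by split.
exists u => //.
apply: (EL _ _ _ (fun v => rl `^ p * b u v + h v) u _ Wu mini) => a v w Wv Ww.
rewrite (power_form_lin p1 a Wu Wv Ww) (hl a v w Wv Ww).
by move: (b _ _) (b _ _) (h _) (h _) => x y z t; ring.
Qed.

End solvability.

(** * Eigenvalues as thresholds for N / M, and conclusion *)

Section eigenvalues.
Context {R : realType} {n : nat}.
Variables (s p : R) (e : 'rV[R]_n) (A : set 'rV[R]_n).
Hypothesis p1 : 1 < p.
Let K := Kconst s p e.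
Hypothesis K0 : 0 < K.
Local Notation X := 'rV[R]_n.
Local Notation mu := (lebesgue_rV R n).
Local Notation mu2 := (lebesgue_rV R n \x lebesgue_rV R n)%E.
Local Notation fd := (frac_diff s p).
Local Notation W := (frac_space s p A).
Local Notation N := (energy_norm s p K).
Local Notation M := (pnorm mu p).
Local Notation b := (power_form p).
Implicit Types (u v w : X -> R).

Let p0 : 0 < p. Proof. exact: lt_trans p1. Qed.

Lemma gagliardo_pmass u : W u -> gagliardo s p setT u = (pmass mu2 p (fd u))%:E.
Proof. by move=> [_ _ Lu]; rewrite (pmassE Lu); exact: gagliardoE. Qed.

Lemma gagliardo_energy u : W u -> (K%:E * gagliardo s p setT u)%E = (N u `^ p)%:E.
Proof.
move=> Wu; rewrite (gagliardo_pmass Wu) -EFinM.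
by congr EFin; apply/esym; exact: energy_norm_powR.
Qed.

Lemma Lp_norm_pnorm u : W u -> Lp_norm p A u = (M u)%:E.
Proof.
move=> [u0 Lu _]; rewrite /Lp_norm (_ : u \_ A = u).
  by apply/esym; exact: pnormE.
by apply/funext => x; rewrite patchE; case: ifPn => // /negP; rewrite inE => /u0.
Qed.

Lemma lambda1_ge0 : (0 <= lambda1 s p e A)%E.
Proof.
apply: le_ereal_inf_tmp => _ [u [/(Wtilde_frac_space s p1) Wu _] <-].
by rewrite (gagliardo_energy Wu) lee_fin powR_ge0.
Qed.

Lemma lambda1_near (l1 : R) t : lambda1 s p e A = l1%:E -> l1 `^ p^-1 < t ->
  exists2 u, W u & N u < t * M u.
Proof.
move=> l1E l1t.
have l10 : 0 <= l1 by rewrite -lee_fin -l1E lambda1_ge0.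
have t0 : 0 <= t by rewrite (le_trans _ (ltW l1t))// powR_ge0.
have : (lambda1 s p e A < (t `^ p)%:E)%E.
  by rewrite l1E lte_fin -{1}(powR_invK p1 l10); apply: powR_lt; rewrite // powR_ge0.
move=> /ereal_inf_lt[_ [u [/(Wtilde_frac_space s p1) Wu Mu] <-]].
rewrite (gagliardo_energy Wu) lte_fin => lt; exists u; first exact: Wu.
move: Mu; rewrite (Lp_norm_pnorm Wu) => -[->]; rewrite mulr1.
by rewrite -(powR_ltE p1 (energy_norm_ge0 _ _ _ _) t0).
Qed.

Lemma lambda1_le (l1 : R) u : lambda1 s p e A = l1%:E -> W u ->
  l1 `^ p^-1 * M u <= N u.
Proof.
move=> l1E Wu; have [_ Lu _] := Wu.
have l10 : 0 <= l1 by rewrite -lee_fin -l1E lambda1_ge0.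
have M0 : 0 <= M u by exact: powR_ge0.
have N0 := energy_norm_ge0 s p K u.
move: M0; rewrite le_eqVlt => /orP[/eqP <-|M0]; first by rewrite mulr0.
have Wv : W (fun x => (M u)^-1 * u x + (fun=> 0) x).
  exact: (frac_space_lin p1 _ Wu (frac_space0 s A p1)).
have vE : (fun x => (M u)^-1 * u x + (fun=> 0) x) = fun x => (M u)^-1 * u x.
  by apply/funext => x; rewrite addr0.
rewrite vE in Wv.
have Mi0 : 0 <= (M u)^-1 by rewrite invr_ge0 ltW.
have Mv : M (fun x => (M u)^-1 * u x) = 1.
  have E := pnormZ p1 (M u)^-1 Lu.
  by apply: (etrans E); rewrite (ger0_norm Mi0) mulVf ?gt_eqF.
have : (lambda1 s p e A <= (N (fun x => (M u)^-1 * u x) `^ p)%:E)%E.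
  apply: ereal_inf_lbound; exists (fun x => (M u)^-1 * u x).
    split; first exact/Wtilde_frac_space.
    by rewrite (Lp_norm_pnorm Wv) Mv.
  exact: gagliardo_energy.
rewrite l1E lee_fin (energy_normZ K p1 _ Wu) (ger0_norm Mi0) => H.
have MN0 : 0 <= (M u)^-1 * N u by exact: (mulr_ge0 Mi0 N0).
rewrite -(ler_pdivlMr _ _ M0) mulrC -(powR_leE p1 (powR_ge0 _ _) MN0).
by rewrite (powR_invK p1 l10).
Qed.

Lemma weak_eigenvalue (t : R) u : W u -> 0 < M u ->
  (forall v, W v -> t * b u v = K * (p * pform mu2 p (fd u) (fd v))) ->
  eigenvalue_plap s p e A t.
Proof.
move=> Wu Mu Hu; have [u0 Lu _] := Wu; exists u; split.
- exact/Wtilde_frac_space.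
- move=> ae0; move: Mu.
  have ae0' : {ae mu, forall x, 0 = u x} by apply: filterS ae0 => x ->.
  have [_ E] := eq_pmass ae0' Lu.1 (Lpf_0 mu p1).
  have z : pmass mu p u = 0 by apply: (etrans E); exact: pmass_0.
  by rewrite (pnorm_eq0 p1 z) ltxx.
- move=> v /(Wtilde_frac_space s p1) Wv.
  rewrite (plap_formE p1 e Wu Wv) (Lp_formE p1 Wu Wv) -EFinM; congr EFin.
  have := Hu v Wv; rewrite /power_form mulrCA [RHS]mulrCA.
  by move/(mulfI (lt0r_neq0 p0)) => ->.
Qed.

End eigenvalues.

Theorem theorem1p1 (R : realType) (N : nat) (s p : R) (e : 'rV[R]_N)
  (Omega : set 'rV[R]_N) (f : ('rV[R]_N -> R) -> R) (lambda : R)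
  (hN : (0 < N)%N) (hs0 : 0 < s) (hs1 : s < 1) (hp : 1 < p)
  (he : sphere e)
  (hsmooth : smooth_open Omega) (hbounded : bounded_set Omega)
  (hf : Wdual s p Omega f)
  (h1 : (lambda1 s p e Omega < lambda%:E)%E)
  (h2 : (lambda%:E < lambda2 s p e Omega)%E) :
  exists u : 'rV[R]_N -> R, weak_solution s p e Omega lambda f u.
Proof.
have p0 : 0 < p by exact: lt_trans hp.
have K0 := Kconst_gt0 hN hs1 p0 he.
have [r r0 Or] := bounded_hcube hbounded.
have [l1 l1E] : exists l1 : R, lambda1 s p e Omega = l1%:E.
  exists (fine (lambda1 s p e Omega)); rewrite fineK// ge0_fin_numE.
    by apply: lt_trans h1 (ltry _).
  exact: lambda1_ge0.
have l10 : 0 <= l1 by rewrite -lee_fin -l1E lambda1_ge0.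
have l1l : l1 < lambda by rewrite -lte_fin -l1E.
have l0 : 0 <= lambda by exact: le_trans l10 (ltW l1l).
(* [lambda2] may be +oo, when there is no eigenvalue above [lambda1]; any real number beyond lambda
   then serves as the upper end of the gap. *)
have [l2 ll2 l2E] : exists2 l2 : R, lambda < l2 & (l2%:E <= lambda2 s p e Omega)%E.
  case: (lambda2 s p e Omega) h2 => [l2||//]; last by exists (lambda + 1); rewrite ?leey// ltrDl.
  by rewrite lte_fin => ?; exists l2.
have l20 : 0 <= l2 by exact: le_trans l0 (ltW ll2).
have root_lt (x y : R) : 0 <= x -> 0 <= y -> x < y -> x `^ p^-1 < y `^ p^-1.
  by move=> x0 y0 xy; rewrite -(powR_ltE hp) ?powR_ge0// !(powR_invK hp).
have [f_lin [C fC]] := hf.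
pose K := Kconst s p e.
have Ki0 : 0 < K `^ p^-1 by exact: powR_gt0.
have fp v : Wtilde s p Omega v ->
    `|f v| <= `|C| / K `^ p^-1 * energy_norm s p K v.
  move=> Wv; have := fC v Wv; have Wv' := (Wtilde_frac_space s hp Omega v).1 Wv.
  rewrite (gagliardo_pmass hp Wv') poweR_EFin -EFinM lee_fin => H.
  rewrite /energy_norm mulrA mulfVK ?gt_eqF//; apply: (le_trans H).
  by apply: ler_wpM2r (ler_norm C); exact: powR_ge0.
have [u Wu Hu] : exists2 u, frac_space s p Omega u & forall v, frac_space s p Omega v ->
    (lambda `^ p^-1) `^ p * power_form p u v + p * f v =
    K * (p * pform (lebesgue_rV R N \x lebesgue_rV R N)%E p (frac_diff s p u) (frac_diff s p v)).
  apply: (@frac_dirichlet_solvable R N s p r K Omega hp hs0 r0 hN Or K0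
    (l1 `^ p^-1) (l2 `^ p^-1) (lambda `^ p^-1) (p * (`|C| / K `^ p^-1))
    (fun v => p * f v) (powR_ge0 _ _)).
  - by move=> t; exact: lambda1_near.
  - by move=> v; exact: lambda1_le.
  (* Such a u makes t^p an eigenvalue strictly between [lambda1] and [l2], against the definition of
     [lambda2] as an infimum. *)
  - move=> t u /andP[l1t tl2] Wu Mu Hu.
    have t0 : 0 <= t by exact: le_trans (powR_ge0 _ _) (ltW l1t).
    have tp1 : l1 < t `^ p.
      by rewrite -(powR_invK hp l10); apply: powR_lt; rewrite // powR_ge0.
    have tp2 : t `^ p < l2.
      by rewrite -[ltRHS](powR_invK hp l20); apply: powR_lt.
    have : (lambda2 s p e Omega <= (t `^ p)%:E)%E.
      apply: ereal_inf_lbound; exists (t `^ p) => //; split.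
        by rewrite l1E lte_fin.
      exact: (weak_eigenvalue hp Wu Mu Hu).
    by move=> /(le_trans l2E); rewrite lee_fin leNgt tp2.
  - by rewrite !root_lt.
  - by rewrite mulr_ge0 ?(ltW p0)// divr_ge0 ?(ltW Ki0).
  - move=> a v w /(Wtilde_frac_space s hp) Wv /(Wtilde_frac_space s hp) Ww.
    by rewrite f_lin// mulrDr mulrCA.
  - move=> v /(Wtilde_frac_space s hp) Wv.
    by rewrite normrM (gtr0_norm p0) -mulrA ler_wpM2l ?(ltW p0)// fp.
exists u; split.
- apply: (What_frac_space hp hbounded Wu).
  by rewrite addr_ge0// mulr_ge0// ltW.
- by have [u0 _ _] := Wu; apply: aeW => x; exact: u0.
- move=> v Wv; have Wv' := (Wtilde_frac_space s hp Omega v).1 Wv.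
  rewrite (plap_formE hp e Wu Wv') (Lp_formE hp Wu Wv') -EFinM -EFinD; congr EFin.
  have := Hu v Wv'; rewrite (powR_invK hp l0) /power_form -/K.
  (* The common factor p is cancelled here. *)
  move: (pform _ _ _ _) (pform _ _ _ _) (f v) => x y z H.
  apply: (mulfI (lt0r_neq0 p0)); move: H; clear; lra.
Qed.
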